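(* Let assumptions (A1), (A2), (A3) of the context hold, with all objects defined as in the context. For any $\alpha>0$: i) The functional $\widetilde{\mathcal F}_\alpha$ attains a minimizer on the set $Ad$ of admissible functions, i.e. those satisfying the constraints $\mathcal W(\phi)=0$ and $M(\mathcal K,K)=0$. ii) The constrained problem $$(P_\alpha)\qquad \min_{(\mathcal K,K,\phi)\in X}\mathcal F_\alpha(\mathcal K,K,\phi)\quad\text{s.t. } \mathcal W(\phi)=0,\ M(\mathcal K,K)=0$$ has a solution in $Ad$. iii) Let $\bar\lambda_\alpha\in(L^2(\Omega))^2$ support an exact penalty representation with associated threshold $\bar\mu_\alpha$ and let $\mu_\alpha>\bar\mu_\alpha$. Then the augmented Lagrangian $\mathcal L_\alpha(\cdot;\bar\lambda_\alpha,\mu_\alpha)$ attains a minimizer on $Ad$. iv) With $\bar\lambda_\alpha,\mu_\alpha$ as in iii), a solution of $(P_\alpha)$ can be obtained by solving the unconstrained optimization problem $\min_{(\mathcal K,K,\phi)\in X}\mathcal L_\alpha(\mathcal K,K,\phi;\bar\lambda_\alpha,\mu_\alpha)$. v) [Convergence] Assume exact data, i.e. $\delta=0$ and $y^\delta=y$. For every $\alpha>0$ let $(\mathcal K_\alpha,K_\alpha,\phi_\alpha)\in Ad$ be a minimizer of $\mathcal L_\alpha(\cdot;\bar\lambda_\alpha,\mu_\alpha)$, with $\bar\lambda_\alpha,\mu_\alpha$ as in iii). Then for every sequence $\{\alpha_j\}$ of positive numbers converging to zero, the corresponding sequence $\{(\mathcal K_{\alpha_j},K_{\alpha_j},\phi_{\alpha_j})\}$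 has a subsequence that converges strongly in $(L^2(\Omega))^2\times L^p(\Omega)$, for $1\le p$. Its limit $(\mathcal K,K,\phi)$ is an admissible function and is a solution of the system $B(K,\phi)=y$, $\mathcal W(\phi)=0$. vi) [Stability] Let $\alpha=\alpha(\delta)$ be a positive function with $\lim_{\delta\to0}\alpha(\delta)=0$ and $\lim_{\delta\to0}\delta^2/\alpha(\delta)=0$. Let $\{\delta_j\}$ be a sequence of positive numbers converging to zero and let $y^{\delta_j}\in L^2(\Omega)$ be corresponding noisy data with $\|y-y^{\delta_j}\|_{L^2(\Omega)}\le\delta_j$. Then there exist a subsequence, again denoted $\{\delta_j\}$, and a sequence $\{\alpha_j:=\alpha(\delta_j)\}$ such that the corresponding minimizers $(\mathcal K_{\alpha_j},K_{\alpha_j},\phi_{\alpha_j})$ of $\mathcal L_{\alpha_j}(\cdot;\bar\lambda_{\alpha_j},\mu_{\alpha_j})$ (formed with data $y^{\delta_j}$) converge in $(L^2(\Omega))^2\times L^p(\Omega)$, for $1\le p$, to a solution of the system $B(K,\phi)=y$, $\mathcal W(\phi)=0$.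
   Context: **Assumptions.** (A1) $\Omega\subset\mathbb R$ is a bounded interval. (A2) $\alpha,\beta_1,\beta_2,\beta_3>0$. (A3) There exist $\hat\sigma>0$, $\hat K=K(\hat\sigma)\in L^2(\Omega)$ and $\hat u\in BV(\Omega)\cap L^\infty(\Omega)$ with $B(\hat K,\hat u)=y$; moreover there is $\hat\phi\in BV(\Omega)\cap L^{4n}(\Omega)$ with $\hat\phi=\hat u$ and $\mathcal W(\hat\phi)=0$. Here $K(\sigma)(x)=\chi_\Omega(x)\frac{\gamma}{\sigma\sqrt{2\pi}}e^{-x^2/(2\sigma^2)}$ with a known amplitude $\gamma>0$. **Operators and data.** $B:L^2(\Omega)\times L^1(\Omega)\to L^2(\Omega)$, $B(K,u)=K\ast u$ (functions on $\Omega$ are extended by zero to $\mathbb R$ and the convolution is restricted to $\Omega$). $y\in L^2(\Omega)$ is the exact data and $y^\delta\in L^2(\Omega)$ is noisy data with $\|y-y^\delta\|_{L^2(\Omega)}\le\delta$. For a fixed $n\in\{1,2,\dots\}$, $\mathcal W:L^{4n}(\Omega)\cap BV(\Omega)\to L^2(\Omega)$, $\mathcal W(\phi)=\phi^n(\phi-1)^n$. $M:L^2(\Omega)\times L^2(\Omega)\to L^2(\Omega)$, $M(\mathcal K,K)=\mathcal K-K$. $X:=L^2(\Omega)\times L^2(\Omega)\times(L^{4n}(\Omega)\cap BV(\Omega))$. $K_0\in H^1(\Omega)$ is fixed. The set of admissible functions is $Ad=\{(\mathcal K,K,\phi)\in X:\mathcal W(\phi)=0,\ M(\mathcal K,K)=0,\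 K\ast\phi\in L^2(\Omega)\}$. **Functionals.** On $X$, $$\mathcal R(\mathcal K,K,\phi)=\beta_1\|K-K_0\|_{H^1(\Omega)}^2+\beta_2\|\phi\|_{L^{4n}}^2+\beta_3|\phi|_{BV}+\beta_1\|\mathcal K-K_0\|_{H^1(\Omega)},$$ $$\mathcal F_\alpha(\mathcal K,K,\phi)=\|B(K,\phi)-y^\delta\|_{L^2(\Omega)}^2+\alpha\,\mathcal R(\mathcal K,K,\phi),$$ where $|\cdot|_{BV}$ is the total variation seminorm and an $H^1$ norm is $+\infty$ for arguments not in $H^1(\Omega)$. **Duality objects.** $\langle\cdot,\cdot\rangle,\|\cdot\|$ are the inner product and norm of $(L^2(\Omega))^2$. For $z\in(L^2(\Omega))^2$, $\Gamma(z)=\{(\mathcal K,K,\phi)\in X:(M(\mathcal K,K),\mathcal W(\phi))=z\}$. $\delta_A$ is the indicator function ($0$ on $A$, $+\infty$ off $A$). $\widetilde{\mathcal F}_\alpha=\mathcal F_\alpha$ on $X\cap\Gamma(0)$ and $+\infty$ otherwise. $f(\mathcal K,K,\phi,z)=\mathcal F_\alpha(\mathcal K,K,\phi)+\delta_{\Gamma(z)}(\mathcal K,K,\phi)$; $\theta(z)=\inf_{X}f(\cdot,z)$; $\rho(z,\lambda,\mu)=-\langle\lambda,z\rangle-\mu\|z\|$ for $z,\lambda\in(L^2(\Omega))^2$, $\mu\in\mathbb R_+$. The augmented Lagrangian is $\mathcal L_\alpha(\mathcal K,K,\phi;\lambda,\mu)=\inf_{z\in(L^2(\Omega))^2}\{f(\mathcal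 K,K,\phi,z)-\rho(z,\lambda,\mu)\}$, and $Q(\lambda,\mu)=\inf_{X}\mathcal L_\alpha(\cdot;\lambda,\mu)$. All these take extended real values. **Exact penalty.** $\bar\lambda\in(L^2(\Omega))^2$ supports an exact penalty representation (for minimizing $\widetilde{\mathcal F}_\alpha$) if there exists a threshold $\bar\mu>0$ such that for every $\mu>\bar\mu$: $\theta(0)=Q(\bar\lambda,\mu)$ and $\arg\min_{X}\widetilde{\mathcal F}_\alpha=\arg\min_{X}\mathcal L_\alpha(\cdot;\bar\lambda,\mu)$. In v) and vi), for each $\alpha$ (and each data), $\bar\lambda_\alpha$ supports an exact penalty representation for the corresponding functional and $\mu_\alpha$ exceeds the corresponding threshold. *)

(* Defs.v *)
From HB Require Import structures.
From mathcomp Require Import all_boot all_order all_algebra.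
From mathcomp Require Import all_classical all_reals all_analysis.

Set Implicit Arguments.
Unset Strict Implicit.
Unset Printing Implicit Defensive.
Import Order.TTheory GRing.Theory Num.Theory.
Import numFieldNormedType.Exports.

Local Open Scope classical_set_scope.
Local Open Scope ring_scope.

(* Classes of functions on Omega are represented by functions R -> R whose
   values off Omega are irrelevant: every notion below depends on f only
   through its extension by zero f \_ Omega, up to equality a.e. *)
Section FunctionSpaces.
Context {R : realType}.
Variable Omega : set R.
Implicit Types (f g u v K psi : R -> R) (p : \bar R).

Local Notation mu := (@lebesgue_measure R).

Definition Lp p : set (R -> R) := [set f | f \_ Omega \in Lfun mu p].

Definition Lpnorm p f : \bar R := 'N[mu]_p [EFin \o f \_ Omega]%E.

Definition eq_on f g : Prop := ae_eq mu Omega f g.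

(* C^1_c of the open interval; only the endpoints of Omega are removed by
   taking the interior. *)
Definition test_function : set (R -> R) :=
  [set psi : R -> R | [/\ forall x : R, derivable psi x 1, continuous (derive1 psi) &
     exists2 A : set R, compact A /\ A `<=` Omega° &
       forall x, ~ A x -> psi x = 0]].

Definition weak_derivative f g : Prop :=
  forall psi, test_function psi ->
    \int[mu]_(x in Omega) (f x * derive1 psi x) =
    - \int[mu]_(x in Omega) (g x * psi x).

(* Weak derivatives in L^2 are unique a.e., so the infimum ranges over at most
   one value; it is +oo when f is not in H^1. *)
Definition H1norm f : \bar R :=
  ereal_inf [set ((Lpnorm 2%:E f ^+ 2 + Lpnorm 2%:E g ^+ 2) `^ 2^-1)%E |
    g in [set g | [/\ Lp 2%:E f, Lp 2%:E g & weak_derivative f g]]].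

Definition H1space : set (R -> R) :=
  [set f | Lp 2%:E f /\
    exists2 g, Lp 2%:E g & weak_derivative f g].

Definition BVseminorm f : \bar R :=
  ereal_sup [set (\int[mu]_(x in Omega) (f x * derive1 psi x))%:E |
    psi in [set psi : R -> R | test_function psi /\ forall x, `|psi x| <= 1]].

Definition BV : set (R -> R) :=
  [set f | Lp 1%E f /\ (BVseminorm f < +oo)%E].

Definition convolution K u : R -> R :=
  fun x => \int[mu]_t ((K \_ Omega) (x - t) * (u \_ Omega) t).

Definition Lp_cvg p (u : nat -> R -> R) (l : R -> R) : Prop :=
  [/\ forall j, Lp p (u j), Lp p l &
      Lpnorm p (u j \- l) @[j --> \oo] --> 0%E].

Definition gaussian (gamma sigma : R) : R -> R :=
  fun x => \1_Omega x *
    (gamma / (sigma * Num.sqrt (2 * pi)) * expR (- (x ^+ 2 / (2 * sigma ^+ 2)))).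

Definition L2pair : set ((R -> R) * (R -> R)) :=
  [set z | Lp 2%:E z.1 /\ Lp 2%:E z.2].

Definition inner (w z : (R -> R) * (R -> R)) : R :=
  \int[mu]_(x in Omega) (w.1 x * z.1 x) + \int[mu]_(x in Omega) (w.2 x * z.2 x).

Definition norm2 (z : (R -> R) * (R -> R)) : R := Num.sqrt (inner z z).

End FunctionSpaces.

Section Problem.
Context {R : realType}.
Variables (Omega : set R) (n : nat).

(* A triple (K', K, phi), where K' is the calligraphic K of the splitting
   constraint K' - K = 0. *)
Definition triple : Type := ((R -> R) * (R -> R) * (R -> R))%type.
Definition pair2 : Type := ((R -> R) * (R -> R))%type.

Definition L4n : set (R -> R) := Lp Omega (4 * n)%:R%:E.

Definition W (phi : R -> R) : R -> R := fun x => phi x ^+ n * (phi x - 1) ^+ n.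

Definition M (K' K : R -> R) : R -> R := K' \- K.

Definition X : set triple :=
  [set x | let: (K', K, phi) := x in
    [/\ Lp Omega 2%:E K', Lp Omega 2%:E K & (L4n `&` BV Omega) phi]].

Definition Gamma (z : pair2) : set triple :=
  [set x | let: (K', K, phi) := x in
    [/\ X x, eq_on Omega (M K' K) z.1 & eq_on Omega (W phi) z.2]].

Definition Ad : set triple :=
  [set x | let: (K', K, phi) := x in
    [/\ X x, eq_on Omega (W phi) (cst 0), eq_on Omega (M K' K) (cst 0) &
        Lp Omega 2%:E (convolution Omega K phi)]].

Definition solves_system (y : R -> R) (x : triple) : Prop :=
  let: (K', K, phi) := x in
  [/\ X x, eq_on Omega (convolution Omega K phi) y & eq_on Omega (W phi) (cst 0)].

Definition attainable (gamma : R) (y : R -> R) : Prop :=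
  exists sigma : R, exists K u phi : R -> R,
    [/\ 0 < sigma, K = gaussian Omega gamma sigma /\ Lp Omega 2%:E K,
        (BV Omega `&` Lp Omega +oo%E) u,
        eq_on Omega (convolution Omega K u) y &
        [/\ (BV Omega `&` L4n) phi, eq_on Omega phi u &
            eq_on Omega (W phi) (cst 0)]].

Definition X_cvg (p : R) (u : nat -> triple) (l : triple) : Prop :=
  [/\ Lp_cvg Omega 2%:E (fun j => (u j).1.1) l.1.1,
      Lp_cvg Omega 2%:E (fun j => (u j).1.2) l.1.2 &
      Lp_cvg Omega p%:E (fun j => (u j).2) l.2].

Definition argmin (g : triple -> \bar R) : set triple :=
  [set x | X x /\ forall x', X x' -> (g x <= g x')%E].

Definition indicator (A : set triple) (x : triple) : \bar R :=
  if x \in A then 0%E else +oo%E.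

Definition rho (z lambda : pair2) (m : R) : R :=
  - inner Omega lambda z - m * norm2 Omega z.

Variables (beta1 beta2 beta3 : R) (K0 : R -> R).

Definition Reg (x : triple) : \bar R :=
  let: (K', K, phi) := x in
  (beta1%:E * H1norm Omega (K \- K0)%R ^+ 2
   + beta2%:E * Lpnorm Omega (4 * n)%:R%:E phi ^+ 2
   + beta3%:E * BVseminorm Omega phi
   + beta1%:E * H1norm Omega (K' \- K0)%R)%E.

Variables (yd : R -> R) (alpha : R).

Definition F (x : triple) : \bar R :=
  let: (K', K, phi) := x in
  (Lpnorm Omega 2%:E (convolution Omega K phi \- yd)%R ^+ 2 + alpha%:E * Reg x)%E.

Definition Ftilde (x : triple) : \bar R :=
  if x \in X `&` Gamma (cst 0, cst 0) then F x else +oo%E.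

Definition solves_P (x : triple) : Prop :=
  let feasible := [set x : triple | let: (K', K, phi) := x in
    [/\ X x, eq_on Omega (W phi) (cst 0) & eq_on Omega (M K' K) (cst 0)]] in
  feasible x /\ forall x', feasible x' -> (F x <= F x')%E.

Definition dualizing (x : triple) (z : pair2) : \bar R :=
  (F x + indicator (Gamma z) x)%E.

Definition theta (z : pair2) : \bar R :=
  ereal_inf [set dualizing x z | x in X].

Definition Lagr (lambda : pair2) (m : R) (x : triple) : \bar R :=
  ereal_inf [set (dualizing x z - (rho z lambda m)%:E)%E | z in L2pair Omega].

Definition Q (lambda : pair2) (m : R) : \bar R :=
  ereal_inf [set Lagr lambda m x | x in X].

Definition exact_penalty_threshold (lambda : pair2) (mbar : R) : Prop :=
  [/\ L2pair Omega lambda, 0 < mbar & forall m : R, mbar < m ->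
    theta (cst 0, cst 0) = Q lambda m /\ argmin Ftilde = argmin (Lagr lambda m)].

End Problem.

Arguments triple R : clear implicits.
Arguments pair2 R : clear implicits.

(* Main.v *)
(**
By the constraints, phi takes only the values 0 and 1, and the two kernels
agree a.e.  Since an exact multiplier makes the minimizers of the augmented
Lagrangian those of the constrained functional, everything reduces to the
direct method for the latter on bounded sequences (K_j, phi_j) of admissible
points.

Strong L^2 compactness of sequences bounded in BV rests on one estimate: if s
is bounded with compact support in the interior of Omega and mean 0, the
Steklov means of its primitive S are test functions, so |int f s| is at most
sup |S| times the variation of f.  It yields the embedding into L^oo, and the
control of the L^2 norm of a difference by the sup norm of its primitive; the
primitives are equi-Lipschitz, hence converge uniformly along an ultrafilter.
Lower semicontinuity of the H^1 norm follows from the parallelogram law, and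
that of the variation from its definition as a supremum.  The convolution is
jointly continuous by Cauchy-Schwarz and the invariance of Lebesgue measure
under reflections.  As the phi_j are binary, L^2 convergence is L^p
convergence for every finite p.
*)
Require Import Defs.
From HB Require Import structures.
From mathcomp Require Import all_boot all_order all_algebra.
From mathcomp Require Import all_classical all_reals all_analysis.
From mathcomp Require Import measurable_realfun lebesgue_integrable.
From mathcomp Require Import ring lra.

Set Implicit Arguments.
Unset Strict Implicit.
Unset Printing Implicit Defensive.
Import Order.TTheory GRing.Theory Num.Theory.
Import numFieldNormedType.Exports.

Local Open Scope classical_set_scope.
Local Open Scope ring_scope.

(** The ultrafilter makes a single extraction possible: along it the $H^1$ norms, the variations and
    the primitives at all grid points converge at once, and one subsequence with rates $2^{-j}$ is
    taken at the very end, in place of repeated diagonal arguments. With such rates completeness of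
    $L^2$ is needed only for fast Cauchy sequences. The kernels need no compactness theorem of their
    own: an $H^1$ bound on [K \- K0] bounds its variation. The obstacle there is the weak derivative
    of the limit, because the functions converge strongly but their derivatives do not; a derivative
    of the limit is found among nearly minimal derivatives of nearby functions. Assumption [A3]
    provides a feasible point where the functional equals $\|y - y^\delta\|^2 + \alpha c$, with [c]
    independent of $\alpha$ and of the data. It makes the infimum finite and, after division by
    $\alpha$, bounds the $H^1$ norms and the variations of the minimizers as $\alpha \to 0$. *)

(** * Pre-Hilbert structure on square integrable functions *)

Section SquareIntegrable.
Context {R : realType}.
Variable D : set R.
Local Notation mu := (@lebesgue_measure R).
Implicit Types (f g h : R -> R).

(** Measurability of [f] is a separate conjunct, since integrability of $f^2$ gives only that of the
    square. *)
Definition sqint f :=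
  measurable_fun D f /\ mu.-integrable D (EFin \o (fun x => f x ^+ 2)).

Definition ip f g : R := \int[mu]_(x in D) (f x * g x).

Hypothesis mD : measurable D.

(** Domination: $|fg| \le f^2 + g^2$, from $(|f| - |g|)^2 \ge 0$. *)
Lemma sqint_mul f g : sqint f -> sqint g ->
  mu.-integrable D (EFin \o (fun x => f x * g x)).
Proof.
move=> [mf f2] [mg g2].
apply: (@le_integrable _ _ _ mu D mD _
    (EFin \o (fun x => f x ^+ 2 + g x ^+ 2))) => //.
- by apply/measurable_EFinP; exact: measurable_funM.
- move=> x _ /=; rewrite lee_fin normrM.
  rewrite (@ger0_norm _ (_ + _)) ?addr_ge0 ?sqr_ge0//.
  rewrite -(real_normK (num_real (f x))) -(real_normK (num_real (g x))).
  have := sqr_ge0 (`|f x| - `|g x|).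
  have := normr_ge0 (f x); have := normr_ge0 (g x); nra.
- exact: (@integrableD _ _ _ mu D mD _ _ f2 g2).
Qed.

Lemma sqintD f g : sqint f -> sqint g -> sqint (f \+ g).
Proof.
move=> sf sg; split; first by apply: measurable_funD; [case: sf|case: sg].
have := @integrableD _ _ _ mu D mD _ _ sf.2
  (@integrableD _ _ _ mu D mD _ _ (@integrableZl _ _ _ mu D mD 2 _ (sqint_mul sf sg)) sg.2).
apply: eq_integrable => // x _ /=; rewrite -EFinM -!EFinD; congr EFin; ring.
Qed.

Lemma sqintZ k f : sqint f -> sqint (fun x => k * f x).
Proof.
move=> [mf f2]; split; first exact: measurable_funM.
have := @integrableZl _ _ _ mu D mD (k ^+ 2) _ f2.
by apply: eq_integrable => // x _ /=; rewrite -EFinM; congr EFin; ring.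
Qed.

Lemma sqintB f g : sqint f -> sqint g -> sqint (f \- g).
Proof.
move=> sf sg; have := sqintD sf (sqintZ (-1) sg).
by congr sqint; apply/funext => x /=; rewrite mulN1r.
Qed.

Lemma sqint0 : sqint (cst 0).
Proof.
split; first exact: measurable_cst.
have := @integrable0 _ _ _ mu D.
by apply: eq_integrable => // x _ /=; rewrite expr0n.
Qed.

Lemma ipC f g : ip f g = ip g f.
Proof. by apply: eq_Rintegral => x _; rewrite mulrC. Qed.

Lemma ip_ge0 f : 0 <= ip f f.
Proof. by apply: Rintegral_ge0 => x _; rewrite -expr2 sqr_ge0. Qed.

Lemma ipDl f g h : sqint f -> sqint g -> sqint h ->
  ip (f \+ g) h = ip f h + ip g h.
Proof.
move=> sf sg sh; rewrite /ip -(@RintegralD _ _ _ mu _ _ _ mD (sqint_mul sf sh) (sqint_mul sg sh)).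
by apply: eq_Rintegral => x _ /=; rewrite mulrDl.
Qed.

Lemma ipZl k f h : sqint f -> sqint h -> ip (fun x => k * f x) h = k * ip f h.
Proof.
move=> sf sh; rewrite /ip -(@RintegralZl _ _ _ mu _ _ k mD (sqint_mul sf sh)).
by apply: eq_Rintegral => x _ /=; rewrite mulrA.
Qed.

Lemma ipBl f g h : sqint f -> sqint g -> sqint h ->
  ip (f \- g) h = ip f h - ip g h.
Proof.
move=> sf sg sh; rewrite /ip -(@RintegralB _ _ _ mu _ _ _ mD (sqint_mul sf sh) (sqint_mul sg sh)).
by apply: eq_Rintegral => x _ /=; rewrite mulrBl.
Qed.

Lemma ipBr f g h : sqint f -> sqint g -> sqint h ->
  ip h (f \- g) = ip h f - ip h g.
Proof. by move=> *; rewrite ipC ipBl// !(ipC h). Qed.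

Lemma ipBB f g : sqint f -> sqint g ->
  ip (f \- g) (f \- g) = ip f f - 2 * ip f g + ip g g.
Proof.
move=> sf sg; have sfg := sqintB sf sg.
by rewrite ipBl// !ipBr// (ipC g f); ring.
Qed.

Lemma ipDD f g : sqint f -> sqint g ->
  ip (f \+ g) (f \+ g) = ip f f + 2 * ip f g + ip g g.
Proof.
move=> sf sg; have sfg := sqintD sf sg.
by rewrite ipDl// (ipC f) (ipC g (_ \+ _)) !ipDl// (ipC g f); ring.
Qed.

Lemma cauchy_schwarz_sqr f g : sqint f -> sqint g ->
  ip f g ^+ 2 <= ip f f * ip g g.
Proof.
move=> sf sg; set a := ip f f; set b := ip f g; set c := ip g g.
have key t : 0 <= a - 2 * t * b + t ^+ 2 * c.
  have st := sqintZ t sg; have := ip_ge0 (f \- (fun x => t * g x)).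
  rewrite ipBB// [ip f (fun x => t * g x)]ipC ipZl// ipZl//.
  rewrite [ip g (fun x => t * g x)]ipC ipZl// (ipC g f) -/a -/b -/c.
  by congr (0 <= _); ring.
have c0 : 0 <= c by exact: ip_ge0.
have a0 : 0 <= a by exact: ip_ge0.
have [c00|cn0] := eqVneq c 0.
  have [->|b0] := eqVneq b 0; first by rewrite expr0n mulr_ge0.
  (* With [c = 0] the polynomial is affine; at this [t] its value is $a - 2(a+1) < 0$, a
     contradiction. *)
  have := key ((a + 1) / b); rewrite c00 mulr0 addr0.
  by rewrite -mulrA divfK//; lra.
have cp : 0 < c by rewrite lt_def cn0.
have := key (b / c); rewrite -(pmulr_rge0 _ cp).
suff -> : c * (a - 2 * (b / c) * b + (b / c) ^+ 2 * c) = a * c - b ^+ 2 by lra.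
by field.
Qed.

Lemma cauchy_schwarz f g : sqint f -> sqint g ->
  `|ip f g| <= Num.sqrt (ip f f) * Num.sqrt (ip g g).
Proof.
move=> sf sg; rewrite -sqrtr_sqr -sqrtrM ?ip_ge0//.
by rewrite ler_sqrt ?mulr_ge0 ?ip_ge0// cauchy_schwarz_sqr.
Qed.

Definition nrm f : R := Num.sqrt (ip f f).

Lemma nrm_ge0 f : 0 <= nrm f. Proof. exact: sqrtr_ge0. Qed.

Lemma sqr_nrm f : nrm f ^+ 2 = ip f f.
Proof. by rewrite sqr_sqrtr// ip_ge0. Qed.

Lemma nrm_triangle f g : sqint f -> sqint g -> nrm (f \+ g) <= nrm f + nrm g.
Proof.
move=> sf sg; rewrite -(@ler_pXn2r _ 2)// ?nnegrE ?addr_ge0 ?nrm_ge0//.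
rewrite sqrrD !sqr_nrm ipDD//.
have := le_trans (ler_norm _) (cauchy_schwarz sf sg); rewrite -/(nrm f) -/(nrm g).
by rewrite -mulr_natl; lra.
Qed.

Lemma nrmB_sym f g : nrm (f \- g) = nrm (g \- f).
Proof.
by rewrite /nrm; congr Num.sqrt; apply: eq_Rintegral => x _ /=; ring.
Qed.

Lemma eq_nrm f g : f =1 g -> nrm f = nrm g.
Proof. by move=> /funext ->. Qed.

Lemma nrm_le f g : sqint f -> sqint g -> nrm f <= nrm g + nrm (f \- g).
Proof.
move=> sf sg; have := nrm_triangle sg (sqintB sf sg).
by rewrite (@eq_nrm (g \+ _) f)// => x /=; ring.
Qed.

Lemma nrm_dist f g : sqint f -> sqint g -> `|nrm f - nrm g| <= nrm (f \- g).
Proof.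
move=> sf sg; have := nrm_le sf sg; have := nrm_le sg sf.
by rewrite (nrmB_sym g f) ler_norml; lra.
Qed.

Lemma nrm_distD f g h : sqint f -> sqint g -> sqint h ->
  nrm (f \- h) <= nrm (f \- g) + nrm (g \- h).
Proof.
move=> sf sg sh; have := nrm_triangle (sqintB sf sg) (sqintB sg sh).
by rewrite (@eq_nrm _ (f \- h))// => x /=; ring.
Qed.

Lemma nrmZ k f : sqint f -> nrm (fun x => k * f x) = `|k| * nrm f.
Proof.
move=> sf; rewrite /nrm ipZl//; last exact: sqintZ.
by rewrite ipC ipZl// mulrA -expr2 sqrtrM ?sqr_ge0// sqrtr_sqr.
Qed.

Lemma parallelogram f g : sqint f -> sqint g ->
  ip (f \- g) (f \- g) = 2 * ip f f + 2 * ip g g - ip (f \+ g) (f \+ g).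
Proof. by move=> sf sg; rewrite ipBB// ipDD//; ring. Qed.

End SquareIntegrable.

(** * Square integrable functions on a set of finite measure *)

Section Completeness.
Context {R : realType}.
Variable D : set R.
Local Notation mu := (@lebesgue_measure R).
Hypothesis mD : measurable D.
Hypothesis Dfin : (mu D < +oo)%E.
Implicit Types (f g h : R -> R).

Lemma aeS (P Q : R -> Prop) : (forall x, P x -> Q x) ->
  {ae mu, forall x, P x} -> {ae mu, forall x, Q x}.
Proof. by move=> PQ; apply: filterS; first exact: (ae_filter_ringOfSetsType mu). Qed.

Lemma aeS2 (P1 P2 Q : R -> Prop) : (forall x, P1 x -> P2 x -> Q x) ->
  {ae mu, forall x, P1 x} -> {ae mu, forall x, P2 x} -> {ae mu, forall x, Q x}.
Proof. by move=> PQ; apply: filterS2; first exact: (ae_filter_ringOfSetsType mu). Qed.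

Lemma ae_eq_Rintegral f g : measurable_fun D f -> measurable_fun D g ->
  ae_eq mu D f g -> \int[mu]_(x in D) f x = \int[mu]_(x in D) g x.
Proof.
move=> mf mg fg; congr fine; apply: (ae_eq_integral (mu := mu)) => //.
- exact/measurable_EFinP.
- exact/measurable_EFinP.
- exact: (ae_eq_comp EFin fg).
Qed.

Lemma sqint_bounded f M : measurable_fun D f ->
  (forall x, D x -> `|f x| <= M) -> sqint D f.
Proof.
move=> mf fM; split => //; apply: (@measurable_bounded_integrable _ _ _ mu) => //.
  exact: measurable_funX.
exists (M ^+ 2); split; first exact: num_real.
move=> y My x Dx /=; apply: le_trans (ltW My).
by rewrite normrX lerXn2r ?nnegrE ?fM// (le_trans _ (fM x Dx)).
Qed.

Lemma sqint_integrable f : sqint D f -> mu.-integrable D (EFin \o f).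
Proof.
move=> sf; have s1 : sqint D (cst 1).
  by apply: (@sqint_bounded _ 1) => // x _ /=; rewrite normr1.
by have := sqint_mul mD sf s1; apply: eq_integrable => // x _ /=; rewrite mulr1.
Qed.

Lemma sqint_norm f : sqint D f -> sqint D (Num.norm \o f).
Proof.
move=> [mf f2]; split; first exact: (measurableT_comp (@normr_measurable R setT)).
by apply: eq_integrable f2 => // x _ /=; rewrite real_normK// num_real.
Qed.

Lemma ip_norm f : ip D (Num.norm \o f) (Num.norm \o f) = ip D f f.
Proof.
by apply: eq_Rintegral => x _ /=; rewrite -!expr2 real_normK// num_real.
Qed.

Lemma integral_norm_le_nrm f : sqint D f ->
  \int[mu]_(x in D) `|f x| <= nrm D f * Num.sqrt (fine (mu D)).
Proof.
move=> sf; have s1 : sqint D (cst 1).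
  by apply: (@sqint_bounded _ 1) => // x _ /=; rewrite normr1.
have := le_trans (ler_norm _) (cauchy_schwarz mD (sqint_norm sf) s1).
rewrite ip_norm -/(nrm D f).
suff -> : ip D (cst 1) (cst 1) = fine (mu D).
  by congr (_ <= _); apply: eq_Rintegral => x _ /=; rewrite mulr1.
rewrite /ip -[RHS]mul1r -(@Rintegral_cst _ _ _ mu _ mD).
by apply: eq_Rintegral => x _ /=; rewrite mul1r.
Qed.

(** Fatou's lemma for the squares; the shift by [N] turns the eventual bound into one for all
    indices. *)
Lemma ip_lim g (h : nat -> R -> R) c :
  (forall k, sqint D (h k)) -> measurable_fun D g ->
  (forall x, D x -> h k x @[k --> \oo] --> g x) ->
  (\forall k \near \oo, ip D (h k) (h k) <= c) ->
  sqint D g /\ ip D g g <= c.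
Proof.
move=> sh mg hg [N _ hc].
have key : (\int[mu]_(x in D) (g x ^+ 2)%:E <= c%:E)%E.
  have -> : (\int[mu]_(x in D) (g x ^+ 2)%:E =
      \int[mu]_(x in D) limn_einf (fun k => (h (k + N)%N x ^+ 2)%:E))%E.
    apply: eq_integral => x /[!inE] Dx.
    have hx : ((h (k + N)%N x ^+ 2)%:E @[k --> \oo] --> (g x ^+ 2)%:E)%E.
      apply: cvg_EFin; first exact: nearW.
      apply: (@cvg_comp _ _ _ (fun k => h (k + N)%N x) (fun y => y ^+ 2) \oo (nbhs (g x))).
        by rewrite (cvg_shiftn N (h ^~ x)); exact: hg.
      exact: exprn_continuous.
    rewrite is_cvg_limn_einfE; last by apply/cvg_ex; eexists; exact: hx.
    by move/cvg_lim : hx => ->.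
  apply: (le_trans (fatou mu mD _ _)).
  - by move=> k; apply/measurable_EFinP; apply: measurable_funX; case: (sh (k + N)%N).
  - by move=> k x _; rewrite lee_fin sqr_ge0.
  rewrite limn_einf_lim; apply: lime_le; first exact: is_cvg_einfs.
  apply: nearW => k; apply: (@le_trans _ _
      (\int[mu]_(x in D) (h (k + N)%N x ^+ 2)%:E)%E).
    by apply: ereal_inf_lbound; exists k => /=.
  rewrite -(@fineK _ (\int[mu]_(x in D) (h (k + N)%N x ^+ 2)%:E)%E).
    by rewrite lee_fin; apply: hc => /=; exact: leq_addl.
  exact: (@integrable_fin_num _ _ _ mu D mD _ (sh _).2).
have sg : sqint D g.
  split=> //; apply/integrableP; split.
    by apply/measurable_EFinP; exact: measurable_funX.
  rewrite (le_lt_trans _ (ltry c))//.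
  apply: le_trans key; rewrite le_eqVlt; apply/orP; left; apply/eqP.
  by apply: eq_integral => x _ /=; rewrite ger0_norm ?sqr_ge0.
split => //; rewrite -lee_fin; apply: le_trans key.
rewrite /ip /Rintegral fineK; first by rewrite le_eqVlt; apply/orP; left; apply/eqP/eq_integral.
exact: (@integrable_fin_num _ _ _ mu D mD _ (sqint_mul mD sg sg)).
Qed.

End Completeness.

(** * Completeness of $L^2$ along fast Cauchy sequences *)

Section FastCauchy.
Context {R : realType}.
Variable D : set R.
Local Notation mu := (@lebesgue_measure R).
Hypothesis mD : measurable D.
Hypothesis Dfin : (mu D < +oo)%E.
Implicit Types (f g h : R -> R).

Lemma eq_on_ip f f' g g' : sqint D f -> sqint D f' -> sqint D g -> sqint D g' ->
  eq_on D f f' -> eq_on D g g' -> ip D f g = ip D f' g'.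
Proof.
move=> sf sf' sg sg' ff' gg'; apply: ae_eq_Rintegral => //.
- by apply: measurable_funM; [exact: sf.1|exact: sg.1].
- by apply: measurable_funM; [exact: sf'.1|exact: sg'.1].
move: ff' gg'; apply: aeS2 => x fx gx Dx.
by rewrite fx// gx.
Qed.

Lemma eq_on_nrm f g : sqint D f -> sqint D g -> eq_on D f g -> nrm D f = nrm D g.
Proof. by move=> sf sg fg; congr Num.sqrt; exact: eq_on_ip. Qed.

Lemma nrm_fast_cauchy (f : nat -> R -> R) : (forall j, sqint D (f j)) ->
  (forall j, nrm D (f j.+1 \- f j) <= 2^-1 ^+ j) ->
  forall j k, (j <= k)%N -> nrm D (f j \- f k) <= 2 * 2^-1 ^+ j.
Proof.
move=> sf fast j k /subnK <-; move: (k - j)%N => {}k.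
(* Subtracting the tail closes the induction: from [k] to [k.+1] the right-hand side grows by
   exactly $2^{-(k+j)}$. *)
suff : nrm D (f j \- f (k + j)%N) <= 2 * 2^-1 ^+ j - 2 * 2^-1 ^+ (k + j).
  by move=> /le_trans; apply; rewrite gerBl mulr_ge0// exprn_ge0 ?invr_ge0.
elim: k => [|k ih].
  rewrite add0n subrr (_ : f j \- f j = cst 0); last by apply/funext => x /=; rewrite subrr.
  by rewrite /nrm ler0_sqrtr// /ip; under eq_Rintegral do rewrite mulr0; rewrite Rintegral_cst// mul0r.
have := nrm_distD mD (sf j) (sf (k + j)%N) (sf (k.+1 + j)%N).
have := fast (k + j)%N; rewrite nrmB_sym -addSn => h1 h2.
apply: le_trans h2 _; apply: le_trans (lerD ih h1) _.
by rewrite addSn exprS; set q := _ ^+ (k + j); lra.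
Qed.

(** Riesz-Fischer: the sum [T] of the absolute increments is integrable, hence finite a.e., so the
    sequence converges a.e.; Fatou's lemma then gives the rate. *)
Lemma sqint_fast_complete (f : nat -> R -> R) : (forall j, sqint D (f j)) ->
  (forall j, nrm D (f j.+1 \- f j) <= 2^-1 ^+ j) ->
  exists2 g, sqint D g & forall j, nrm D (f j \- g) <= 2 * 2^-1 ^+ j.
Proof.
move=> sf fast; pose d j x := f j.+1 x - f j x.
have sd j : sqint D (d j) by exact: sqintB.
pose T x := (\sum_(j <oo) (`|d j x|)%:E)%E.
have md j : measurable_fun D (fun x => (`|d j x|)%:E).
  by apply/measurable_EFinP; exact: (sqint_norm mD (sd j)).1.
have mT : measurable_fun D T.
  by apply: ge0_emeasurable_sum => // j x Dx _; rewrite lee_fin.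
have intT : mu.-integrable D T.
  apply/integrableP; split => //.
  under eq_integral => x _ do rewrite gee0_abs ?nneseries_ge0//.
  rewrite (integral_nneseries mu mD md); last by move=> *; rewrite lee_fin.
  pose c := Num.sqrt (fine (mu D)).
  have le_c j : (\int[mu]_(x in D) (`|d j x|)%:E <= (c * 2^-1 ^+ j)%:E)%E.
    rewrite -(@fineK _ (\int[mu]_(x in D) (`|d j x|)%:E)%E); last first.
      have := sqint_integrable mD Dfin (sqint_norm mD (sd j)).
      exact: (@integrable_fin_num _ _ _ mu D mD).
    rewrite lee_fin; apply: le_trans (integral_norm_le_nrm mD Dfin (sd j)) _.
    by rewrite mulrC ler_wpM2l ?sqrtr_ge0//; exact: fast.
  apply: (@le_lt_trans _ _ (\sum_(j <oo) (c * 2^-1 ^+ j)%:E)%E).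
    by apply: lee_nneseries => [j _ _|j _]; [exact: integral_ge0|exact: le_c].
  rewrite (_ : (fun n => _) = EFin \o series (geometric c 2^-1)); last first.
    by apply/funext => n; rewrite /= sumEFin /series/=.
  have cvg_g : cvgn (series (geometric c (2^-1 : R))).
    by apply: is_cvg_geometric_series; rewrite ger0_norm ?invr_ge0// invf_lt1// ltr1n.
  by rewrite EFin_lim// ltry.
pose C := D `&` [set x | T x \is a fin_num].
have mC : measurable C by exact: emeasurable_fin_num.
have CD : {ae mu, forall x, D x -> C x}.
  have := @integrable_ae _ _ _ mu D mD _ intT.
  by apply: aeS => x + Dx => /(_ Dx).
pose F j := f j \_ C.
have FE j : eq_on D (F j) (f j).
  by move: CD; apply: aeS => x DC Dx; rewrite /F patchE mem_set//; exact: DC.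
have sF j : sqint D (F j).
  have mF : measurable_fun D (F j).
    apply/(measurable_restrict (f j) mC mD).
    by apply: measurable_funS (sf j).1 => // x [].
  split => //; apply: (@le_integrable _ _ _ mu D mD _ _ _ _ (sf j).2).
    by apply/measurable_EFinP; exact: measurable_funX.
  by move=> x _ /=; rewrite /F patchE; case: ifP => // _; rewrite expr0n/= normr0 lee_fin.
have cvF x : D x -> cvgn (F ^~ x).
  move=> Dx; have [Cx|nCx] := pselect (C x); last first.
    rewrite (_ : F^~ x = cst 0); first exact: is_cvg_cst.
    by apply/funext => j; rewrite /F patchE memNset.
  have -> : F ^~ x = (fun j => f 0%N x + series (d ^~ x) j).
    apply/funext => j; rewrite /F patchE mem_set// /series/= /d.
    by rewrite (telescope_sumr (fun k => f k x))// addrC subrK.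
  apply: is_cvgD; first exact: is_cvg_cst.
  apply: normed_cvg; apply: nnseries_is_cvg => [j|]; first exact: normr_ge0.
  by move: Cx => [_ /=]; rewrite /T ge0_fin_numE// nneseries_ge0.
pose g x := limn (F ^~ x).
have Fg x : D x -> F k x @[k --> \oo] --> g x by move/cvF.
have mg : measurable_fun D g by apply: measurable_fun_cvg Fg => j; case: (sF j).
have Fdist j k : nrm D (F j \- F k) = nrm D (f j \- f k).
  apply: eq_on_nrm; [exact: sqintB|exact: sqintB|].
  by move: (FE j) (FE k); apply: aeS2 => x h1 h2 Dx /=; rewrite h1// h2.
(* For fixed [j], the limit is taken in [k] in the bound on [F j \- F k]. *)
have key j : sqint D (F j \- g) /\ ip D (F j \- g) (F j \- g) <= (2 * 2^-1 ^+ j) ^+ 2.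
  apply: (@ip_lim _ _ mD _ (fun k => F j \- F k)).
  - by move=> k; exact: sqintB.
  - by apply: measurable_funB => //; exact: (sF j).1.
  - by move=> x Dx; apply: cvgB; [exact: cvg_cst|exact: Fg].
  - exists j => // k /= jk; rewrite -sqr_nrm Fdist.
    by rewrite lerXn2r ?nnegrE ?nrm_ge0 ?mulr_ge0 ?exprn_ge0 ?invr_ge0// nrm_fast_cauchy.
have sg : sqint D g.
  have := sqintB mD (sF 0%N) (key 0%N).1.
  by congr sqint; apply/funext => x /=; ring.
exists g => // j.
have -> : nrm D (f j \- g) = nrm D (F j \- g).
  apply: eq_on_nrm; [exact: sqintB|exact: sqintB|].
  by move: (FE j); apply: aeS => x h1 Dx /=; rewrite h1.
have := (key j).2; rewrite -sqr_nrm ler_pXn2r// nnegrE ?nrm_ge0//.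
Qed.

End FastCauchy.

(** * Powers of one half, and limits of nearly minimal elements *)

Section MidpointClosed.
Context {R : realType}.
Implicit Types (x y C e : R).

Lemma half_pow_lt C e : 0 < e -> exists k, C * 2^-1 ^+ k < e.
Proof.
move=> e0; have [C0|C0] := leP C 0.
  by exists 0%N; rewrite expr0 mulr1 (le_lt_trans C0).
have := @cvg_expr R 2^-1; rewrite ger0_norm ?invr_ge0// invf_lt1// ltr1n => /(_ isT).
move/cvgrPdist_lt => /(_ (e / C)); rewrite divr_gt0// => /(_ isT)[k _ /(_ k (leqnn k))].
rewrite sub0r normrN ger0_norm ?exprn_ge0 ?invr_ge0// ltr_pdivlMr// => hk.
by exists k; rewrite mulrC.
Qed.

Lemma le_half_pow C x y : (forall k, x <= y + C * 2^-1 ^+ k) -> x <= y.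
Proof.
move=> h; apply/ler_addgt0Pr => e e0; have [k hk] := half_pow_lt C e0.
by apply: le_trans (h k) _; rewrite lerD2l ltW.
Qed.

Lemma sqrtr_leD x y : 0 <= x -> 0 <= y -> Num.sqrt (x + y) <= Num.sqrt x + Num.sqrt y.
Proof.
move=> x0 y0; rewrite -(@ler_pXn2r _ 2)// ?nnegrE ?addr_ge0 ?sqrtr_ge0//.
rewrite sqrrD !sqr_sqrtr ?addr_ge0// -addrA [_ *+ 2 + _]addrC addrA lerDl.
by rewrite mulrn_wge0// mulr_ge0 ?sqrtr_ge0.
Qed.

Variable D : set R.
Local Notation mu := (@lebesgue_measure R).
Hypothesis mD : measurable D.
Hypothesis Dfin : (mu D < +oo)%E.

(* The elements of nearly minimal norm of the sets S m form a Cauchy sequence,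
   by the parallelogram law; this replaces weak compactness. *)
Lemma midpoint_limit (S : nat -> set (R -> R)) (c : R) :
  (forall m f, S m f -> sqint D f) ->
  (forall m f, S m.+1 f -> S m f) ->
  (forall m f g, S m f -> S m g -> S m (fun x => 2^-1 * (f x + g x))) ->
  (forall m e, 0 < e -> exists2 f, S m f & ip D f f <= c + e) ->
  exists g, [/\ sqint D g, ip D g g <= c &
    forall m e, 0 < e -> exists2 f, S m f & nrm D (f \- g) <= e].
Proof.
move=> Ssq Sdecr Smid Sc.
pose A m := [set ip D f f | f in S m].
have A0 m : A m !=set0.
  by have [f Sf _] := Sc m 1 ltr01; exists (ip D f f); exists f.
have Alb m : lbound (A m) 0 by move=> _ [f Sf <-]; exact: ip_ge0.
have hA m : has_inf (A m) by split => //; exists 0; exact: Alb.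
pose d m := inf (A m).
have dS m f : S m f -> d m <= ip D f f.
  by move=> Sf; apply: inf_lbound; [exists 0; exact: Alb|exists f].
have dc m : d m <= c.
  apply/ler_addgt0Pr => e e0; have [f Sf fc] := Sc m e e0.
  exact: le_trans (dS _ _ Sf) fc.
have Smono m k f : (m <= k)%N -> S k f -> S m f.
  by move=> /subnK <-; elim: (k - m)%N => // i ih; rewrite addSn => /Sdecr.
have dmono m k : (m <= k)%N -> d m <= d k.
  move=> mk; apply: lb_le_inf; first exact: A0.
  by move=> _ [f Sf <-]; apply: dS; exact: Smono Sf.
(* The factor 1/8 comes from the parallelogram law: two squared norms below [L + eta k] whose
   midpoint has squared norm above [L - eta k] differ by at most $8\,\eta_k = (2^{-k})^2$ in squared
   norm. *)
pose eta k : R := 8^-1 * (2^-1 ^+ k) ^+ 2.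
have eta0 k : 0 < eta k by rewrite mulr_gt0 ?invr_gt0// !exprn_gt0 ?invr_gt0.
pose B := range d.
have hB : has_sup B by split; [exists (d 0%N); exists 0%N|exists c => _ [m _ <-]].
pose L := sup B.
have dL m : d m <= L by apply: ub_le_sup; [exact: hB.2|exists m].
have Lc : L <= c by apply: ge_sup; [exact: hB.1|move=> _ [m _ <-]].
have /choice[m0 hm0] k : exists m, L - eta k < d m.
  by have [_ [m _ <-] ?] := sup_adherent (eta0 k) hB; exists m.
(* The partial sums are monotone in [k] and dominate both [m0 k] and [k]. *)
pose m_ k := (\sum_(i < k.+1) (m0 i).+1)%N.
have m_ge k : (k <= m_ k)%N.
  rewrite /m_; elim: k => // k ih; rewrite big_ord_recr/= addnS ltnS.
  exact: leq_trans ih (leq_addr _ _).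
have m_mono k : (m_ k <= m_ k.+1)%N by rewrite /m_ (big_ord_recr k.+1)/= leq_addr.
have m_L k : L - eta k < d (m_ k).
  apply: lt_le_trans (hm0 k) _; apply: dmono.
  by rewrite /m_ big_ord_recr/= addnS; apply: leqW; exact: leq_addl.
have /choice[p hp] k : exists f, S (m_ k) f /\ ip D f f < L + eta k.
  have [_ [f Sf <-] hf] := inf_adherent (eta0 k) (hA (m_ k)).
  by exists f; split => //; apply: lt_le_trans hf _; rewrite lerD2r; exact: dL.
have sp k : sqint D (p k) by apply: Ssq; exact: (hp k).1.
have eta_le k : eta k.+1 <= eta k.
  by rewrite /eta [_ ^+ k.+1]exprS; set q := _ ^+ k; have := sqr_ge0 q; rewrite exprMn expr2; nra.
have fast k : nrm D (p k.+1 \- p k) <= 2^-1 ^+ k.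
  rewrite -(@ler_pXn2r _ 2)// ?nnegrE ?nrm_ge0 ?exprn_ge0 ?invr_ge0//.
  rewrite sqr_nrm (parallelogram mD)//.
  have Sp : S (m_ k) (p k.+1) by apply: Smono (hp k.+1).1; exact: m_mono.
  have := dS _ _ (Smid _ _ _ Sp (hp k).1).
  have -> : ip D (fun x => 2^-1 * (p k.+1 x + p k x)) (fun x => 2^-1 * (p k.+1 x + p k x))
      = 4^-1 * ip D (p k.+1 \+ p k) (p k.+1 \+ p k).
    have sq := sqintD mD (sp k.+1) (sp k).
    have sZ := sqintZ mD 2^-1 sq.
    rewrite (ipZl mD 2^-1 sq sZ) ipC (ipZl mD 2^-1 sq sq) mulrA; congr (_ * _).
    by field.
  have := m_L k; have := (hp k).2; have := (hp k.+1).2; have := eta_le k.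
  have -> : (2^-1 ^+ k) ^+ 2 = 8 * eta k by rewrite /eta mulrA mulfV ?mul1r.
  by lra.
have [g sg hg] := sqint_fast_complete mD Dfin sp fast.
exists g; split => //.
- have c0 : 0 <= c.
    apply/ler_addgt0Pr => e e0; have [f _] := Sc 0%N e e0.
    exact: le_trans (ip_ge0 _ _).
  rewrite -(sqr_sqrtr c0) -sqr_nrm lerXn2r ?nnegrE ?nrm_ge0 ?sqrtr_ge0//.
  apply: (@le_half_pow 3) => k.
  apply: le_trans (nrm_le mD sg (sp k)) _; rewrite nrmB_sym.
  (* Here [L <= c] and [eta k] is at most $(2^{-k})^2$, and the square root is subadditive. *)
  have hk : nrm D (p k) <= Num.sqrt c + 2^-1 ^+ k.
    have : nrm D (p k) <= Num.sqrt (c + (2^-1 ^+ k) ^+ 2).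
      rewrite ler_sqrt ?addr_ge0 ?sqr_ge0//; apply: le_trans (ltW (hp k).2) _.
      by apply: lerD => //; rewrite /eta; have := sqr_ge0 ((2^-1 : R) ^+ k); lra.
    move=> /le_trans; apply; apply: le_trans (sqrtr_leD c0 (sqr_ge0 _)) _.
    by rewrite sqrtr_sqr ger0_norm// exprn_ge0 ?invr_ge0.
  by apply: le_trans (lerD hk (hg k)) _; lra.
- move=> m e e0; have [k hk] := half_pow_lt 2 e0.
  exists (p (maxn m k)).
    by apply: Smono (hp _).1; exact: leq_trans (leq_maxl m k) (m_ge _).
  apply: le_trans (hg _) _; apply: le_trans (ltW hk).
  by rewrite ler_pM2l// ler_wiXn2l ?invr_ge0// ?leq_maxr// invf_le1// ler1n.
Qed.

End MidpointClosed.

(** * Primitives of bounded functions with compact support *)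

Section Primitive.
Context {R : realType}.
Local Notation mu := (@lebesgue_measure R).
Variables (s : R -> R) (B c d : R).
Hypothesis ms : measurable_fun setT s.
Hypothesis sB : forall x, `|s x| <= B.
Hypothesis s0 : forall x, x \notin `[c, d] -> s x = 0.

Definition primitive x : R := \int[mu]_(t in `]-oo, x]) s t.

Lemma compact_support_integrable : mu.-integrable setT (EFin \o s).
Proof.
have si : mu.-integrable `[c, d] (EFin \o s).
  apply: (@measurable_bounded_integrable _ _ _ mu) => //.
  - by rewrite /= lebesgue_measure_itv; case: ifP => // _; rewrite -EFinB ltry.
  - exact: measurable_funTS.
  - exists B; split; first exact: num_real.
    by move=> y By x _; apply: le_trans (sB x) (ltW By).
have := (@integrable_mkcond _ _ _ mu _ (EFin \o s) (measurable_itv `[c, d])).1 si.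
apply: eq_integrable => // x _; rewrite patchE; case: ifPn => //.
by rewrite notin_setE/= => /negP xcd; rewrite s0.
Qed.

Lemma support_integrable D : measurable D -> mu.-integrable D (EFin \o s).
Proof.
by move=> mD; apply: (@integrableS _ _ _ mu setT) compact_support_integrable.
Qed.

Lemma primitiveB x y : x <= y ->
  primitive y - primitive x = \int[mu]_(t in `]x, y]) s t.
Proof.
move=> xy; rewrite /primitive Rintegral_itvB//; exact: support_integrable.
Qed.

Lemma primitive_lipschitz x y : x <= y -> `|primitive y - primitive x| <= B * (y - x).
Proof.
move=> xy; rewrite primitiveB//.
have si : mu.-integrable `]x, y] (EFin \o s) by exact: support_integrable.
apply: le_trans (@le_normr_Rintegral _ _ _ mu _ _ _ si) _ => //.
have muE : fine (mu `]x, y]) = y - x.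
  rewrite /= lebesgue_measure_itv/= lte_fin.
  by move: xy; rewrite le_eqVlt => /predU1P[->|xy]; rewrite ?ltxx ?subrr ?xy.
rewrite -muE -(@Rintegral_cst _ _ _ mu)//; apply: le_Rintegral => //.
- by apply: (@integrable_norm _ _ _ mu).
- apply: (@measurable_bounded_integrable _ _ _ mu) => //.
    by rewrite /= lebesgue_measure_itv; case: ifP => // _; rewrite -EFinB ltry.
  by exists `|B|; split; [exact: num_real|move=> z /ltW + t _; exact].
Qed.

Lemma primitive_dist x y : `|primitive y - primitive x| <= B * `|y - x|.
Proof.
have [xy|/ltW yx] := leP x y.
  by rewrite (@ger0_norm _ (y - x)) ?subr_ge0// primitive_lipschitz.
by rewrite distrC (distrC y) (@ger0_norm _ (x - y)) ?subr_ge0// primitive_lipschitz.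
Qed.

Lemma primitive_continuous : continuous primitive.
Proof.
move=> x; apply/cvgrPdist_le => e e0.
have B0 : 0 <= B by apply: le_trans (sB 0).
near=> y; rewrite distrC; apply: le_trans (primitive_dist _ _) _.
apply: (@le_trans _ _ ((B + 1) * `|y - x|)); first by rewrite ler_wpM2r// lerDl.
rewrite mulrC -ler_pdivlMr ?ltr_wpDl// distrC; near: y.
by apply: cvgr_dist_le => //; rewrite divr_gt0// ltr_wpDl.
Unshelve. all: by end_near. Qed.

Lemma primitive_left x : x < c -> primitive x = 0.
Proof.
move=> xc; transitivity (\int[mu]_(t in `]-oo, x]) (0 : R)); last first.
  by rewrite (@Rintegral_cst _ _ _ mu) ?mul0r.
apply: eq_Rintegral => t; rewrite inE/= in_itv/= => tx.
by rewrite s0// in_itv/= negb_and -ltNge (le_lt_trans tx xc).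
Qed.

Lemma primitive_right x : d <= x -> primitive x = \int[mu]_t s t.
Proof.
move=> dx; rewrite /primitive Rintegral_mkcond; apply: eq_Rintegral => t _.
rewrite patchE; case: ifPn => //; rewrite notin_setE/= in_itv/= => /negP.
rewrite -ltNge => xt; rewrite s0// in_itv/= negb_and -!ltNge.
by rewrite (le_lt_trans dx xt) orbT.
Qed.

End Primitive.

(** * Bounding an integral by the variation through Steklov means *)

Section Steklov.
Context {R : realType}.
Local Notation mu := (@lebesgue_measure R).

Lemma derive1_seq (f : R -> R) x (e : nat -> R) : derivable f x 1 ->
  (forall k, e k != 0) -> e k @[k --> \oo] --> 0 ->
  (e k)^-1 * (f (x + e k) - f x) @[k --> \oo] --> derive1 f x.
Proof.
move=> /cvg_ex[l fl] e0 ek.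
have -> : derive1 f x = l by rewrite derive1E; exact: cvg_lim fl.
have := (cvgr_dnbhsP _ _ _).1 fl e (conj e0 ek).
apply: cvg_trans; apply: near_eq_cvg; apply: nearW => k /=.
by rewrite [e k *: 1]mulr1 (addrC x).
Qed.

Variables (s : R -> R) (B c d M : R).
Hypothesis ms : measurable_fun setT s.
Hypothesis sB : forall x, `|s x| <= B.
Hypothesis s0 : forall x, x \notin `[c, d] -> s x = 0.
Hypothesis tot0 : \int[mu]_t s t = 0.
Let S := primitive s.
Hypothesis M0 : 0 < M.
Hypothesis SM : forall x, `|S x| <= M.
Let P := primitive S.

Let S_continuous : continuous S.
Proof. exact: primitive_continuous s0. Qed.

Let mS : measurable_fun setT S.
Proof. exact: continuous_measurable_fun. Qed.

(** To the right of [d] the primitive equals the total integral of [s]; this is where mean zero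
    enters. *)
Let S0 x : x \notin `[c, d] -> S x = 0.
Proof.
rewrite in_itv/= negb_and -!ltNge => /orP[xc|dx].
  by rewrite /S (primitive_left (c := c) (d := d)).
by rewrite /S (primitive_right (c := c) (d := d))// ltW.
Qed.

Let dP (x : R) : is_derive x 1 P (S x).
Proof.
have [] := @continuous_FTC1 R S -oo%O x (x + 1).
- by rewrite ltrDl.
- exact: (support_integrable mS SM S0).
- by rewrite ltNyr.
- exact: S_continuous.
by rewrite -/P derive1E => dPx <-; exact: derivableP.
Qed.

(** The mean of [S] over $[x, x+e]$, written with the primitive [P] of [S]. It is $C^1$ although [S]
    is only Lipschitz, and its derivative is a difference quotient of [S]. *)
Definition steklov (e x : R) : R := e^-1 * (P (x + e) - P x).

Lemma is_derive_steklov (e x : R) : is_derive x 1 (steklov e) (e^-1 * (S (x + e) - S x)).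
Proof.
have h1 : is_derive x 1 (P \o shift e) (S (x + e)).
  have := @is_derive1_comp R P (shift e) x (S (x + e)) 1 (dP _) (is_derive_shift _ _ _).
  by rewrite mulr1.
exact: (@is_deriveZ _ _ _ _ e^-1 x 1 _ (is_deriveB h1 (dP x))).
Qed.

Lemma derive1_steklov e : (derive1 (steklov e)) = (fun x => e^-1 * (S (x + e) - S x)).
Proof.
by apply/funext => x; rewrite derive1E; have [_ ->] := is_derive_steklov e x.
Qed.

Lemma derive1_steklov_continuous e : continuous (derive1 (steklov e)).
Proof.
rewrite derive1_steklov => x.
apply: cvgMr; apply: cvgB; last exact: S_continuous.
apply: (@cvg_comp _ _ _ (fun y => y + e) S _ (nbhs (x + e))).
  by apply: cvgD => //; exact: cvg_cst.
exact: S_continuous.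
Qed.

Lemma derive1_steklov_bound e x : 0 < e -> `|(derive1 (steklov e)) x| <= B.
Proof.
move=> e0; rewrite derive1_steklov normrM normfV (gtr0_norm e0) mulrC.
rewrite ler_pdivrMr//; apply: le_trans (primitive_lipschitz ms sB s0 _) _.
  by rewrite lerDl ltW.
by rewrite addrC addKr.
Qed.

Lemma steklov_bound e x : 0 < e -> `|steklov e x| <= M.
Proof.
move=> e0; rewrite /steklov normrM normfV (gtr0_norm e0) mulrC.
rewrite ler_pdivrMr//; apply: le_trans (primitive_lipschitz mS SM S0 _) _.
  by rewrite lerDl ltW.
by rewrite addrC addKr.
Qed.

(** The mean looks forward only, so the support grows to the left alone; hence room is reserved by
    [c' < c] on that side and none beyond [d]. *)
Lemma steklov_out e x : 0 < e -> x \notin `[c - e, d] -> steklov e x = 0.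
Proof.
move=> e0; rewrite in_itv/= negb_and -!ltNge /steklov /P => /orP[xc|dx].
  have xec : x + e < c by lra.
  have {}xc : x < c by lra.
  by rewrite (primitive_left S0 xec) (primitive_left S0 xc) subrr mulr0.
have dxe : d <= x + e by lra.
by rewrite (primitive_right S0 dxe) (primitive_right S0 (ltW dx)) subrr mulr0.
Qed.

Variables (Omega : set R) (f : R -> R) (V c' : R).
Hypothesis mO : measurable Omega.
Hypothesis intf : mu.-integrable Omega (EFin \o f).
Hypothesis fV : (BVseminorm Omega f <= V%:E)%E.
Hypothesis c'c : c' < c.
Hypothesis sub : `[c', d] `<=` Omega°.

Lemma steklov_integral_le e : 0 < e -> e <= c - c' ->
  \int[mu]_(x in Omega) (f x * (derive1 (steklov e)) x) <= M * V.
Proof.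
move=> e0 ec.
(* Normalized by the bound [M] on [S], so that [psi] competes in the supremum defining the
   variation. *)
pose psi x := M^-1 * steklov e x.
have dpsi (x : R) : is_derive x 1 psi (M^-1 * (derive1 (steklov e)) x).
  rewrite derive1_steklov.
  exact: (@is_deriveZ _ _ _ (steklov e) M^-1 x 1 _ (is_derive_steklov e x)).
have d1psi : derive1 psi = (fun x => M^-1 * (derive1 (steklov e)) x).
  by apply/funext => x; rewrite derive1E; have [_ ->] := dpsi x.
have tpsi : test_function Omega psi.
  split.
  - by move=> x; have [] := dpsi x.
  - rewrite d1psi => x; apply: cvgMr; exact: derive1_steklov_continuous.
  - exists `[c - e, d]%classic; first split.
    + exact: segment_compact.
    + apply: subset_trans sub; apply: subset_itvr; rewrite bnd_simp; lra.
    + by move=> x xA; rewrite /psi steklov_out ?mulr0//; apply/negP.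
have psi1 x : `|psi x| <= 1.
  rewrite /psi normrM normfV (gtr0_norm M0) mulrC ler_pdivrMr// mul1r.
  exact: steklov_bound.
have : ((\int[mu]_(x in Omega) (f x * derive1 psi x))%:E <= V%:E)%E.
  by apply: le_trans fV; apply: ereal_sup_ubound; exists psi.
rewrite lee_fin d1psi.
suff -> : \int[mu]_(x in Omega) (f x * (M^-1 * (derive1 (steklov e)) x)) =
    M^-1 * \int[mu]_(x in Omega) (f x * (derive1 (steklov e)) x).
  by rewrite mulrC ler_pdivrMr// mulrC.
rewrite -(@RintegralZl _ _ _ mu)//.
  by apply: eq_Rintegral => x _; rewrite mulrCA.
apply: (@integrableMl _ _ _ mu Omega mO (EFin \o f)) => //.
  apply: measurable_funTS; apply: continuous_measurable_fun.
  exact: derive1_steklov_continuous.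
exists B; split; first exact: num_real.
by move=> y By x _; apply: le_trans (derive1_steklov_bound x e0) (ltW By).
Qed.

(* The Steklov means of the primitive of s are admissible test functions whose
   derivatives converge to s a.e. *)
Lemma integral_le_BV : \int[mu]_(x in Omega) (f x * s x) <= M * V.
Proof.
(* Widths that tend to 0 and never exceed [c - c'], which keeps the supports inside [[c', d]]. *)
pose e k : R := (c - c') * 2^-1 ^+ k.
have e0 k : 0 < e k by rewrite mulr_gt0 ?subr_gt0// exprn_gt0// invr_gt0.
have eC k : e k <= c - c'.
  by rewrite ler_piMr ?subr_ge0 ?(ltW c'c)// exprn_ile1 ?invr_ge0// invf_le1// ler1n.
have ecvg : e k @[k --> \oo] --> 0.
  rewrite -[X in _ --> X](mulr0 (c - c')); apply: cvgMr; apply: cvg_expr.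
  by rewrite ger0_norm ?invr_ge0// invf_lt1// ltr1n.
(* Lebesgue differentiation: the derivatives of the means, being difference quotients of [S], tend
   to [s] a.e., and [B * |f|] dominates the integrands. *)
have aeS' : {ae mu, forall x, derivable S x 1 /\ derive1 S x = s x}.
  apply: FTC1Ny; first by move=> y; exact: (support_integrable ms sB s0).
  by apply: open_integrable_locally openT _; exact: (support_integrable ms sB s0).
have mf : measurable_fun Omega f by apply/measurable_EFinP; exact: (measurable_int mu intf).
have [] := @dominated_convergence _ _ _ mu Omega mO
  (fun k x => (f x * (derive1 (steklov (e k))) x)%:E) (fun x => (f x * s x)%:E)
  (fun x => (B * `|f x|)%:E).
- move=> k; apply/measurable_EFinP; apply: measurable_funM => //.
  apply: measurable_funTS; apply: continuous_measurable_fun.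
  exact: derive1_steklov_continuous.
- apply/measurable_EFinP; apply: measurable_funM => //; exact: measurable_funTS.
- apply: aeS aeS' => x [dS S's] Ox; apply: cvg_EFin; first exact: nearW.
  apply: cvgMr; rewrite -S's.
  under eq_fun do rewrite derive1_steklov.
  by apply: derive1_seq => // k; rewrite gt_eqF.
- have := @integrableZl _ _ _ mu Omega mO B _ (integrable_norm intf).
  by apply: eq_integrable.
- apply: aeW => x k Ox; rewrite lee_fin normrM mulrC ler_wpM2r//.
  exact: derive1_steklov_bound.
move=> ifs _ cvgI.
rewrite -lee_fin /Rintegral fineK; last exact: (@integrable_fin_num _ _ _ mu Omega mO).
move/cvg_lim : (cvgI) => <- //; apply: lime_le; first by apply/cvg_ex; eexists; exact: cvgI.
apply: nearW => k /=; rewrite -[leLHS]fineK.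
  by rewrite lee_fin; exact: steklov_integral_le.
apply: (@integrable_fin_num _ _ _ mu Omega mO).
apply: (@integrableMl _ _ _ mu Omega mO (EFin \o f)) => //.
  apply: measurable_funTS; apply: continuous_measurable_fun.
  exact: derive1_steklov_continuous.
exists B; split; first exact: num_real.
by move=> y By x _; apply: le_trans (derive1_steklov_bound x (e0 k)) (ltW By).
Qed.

End Steklov.

(** * The variation bounds the difference of two means *)

Section AverageBV.
Context {R : realType}.
Local Notation mu := (@lebesgue_measure R).
Implicit Types (A J : set R) (f : R -> R).

Lemma Rintegral_indicM D A f : measurable D -> measurable A -> A `<=` D ->
  \int[mu]_(x in D) (f x * \1_A x) = \int[mu]_(x in A) f x.
Proof.
move=> mD mA AD; rewrite -[in RHS](setIidr AD) Rintegral_mkcondr.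
apply: eq_Rintegral => x _; rewrite indicE patchE.
by case: (x \in A); rewrite ?mulr1 ?mulr0.
Qed.

Lemma measurable_subitv_lty A (c d : R) : A `<=` `[c, d] -> measurable A ->
  (mu A < +oo)%E.
Proof.
move=> Acd mA; apply: (@le_lt_trans _ _ (mu `[c, d]%classic)).
  by apply: le_measure => //; rewrite inE.
by rewrite /= lebesgue_measure_itv; case: ifP => // _; rewrite -EFinB ltry.
Qed.

Lemma primitive_indic A (c d x : R) : A `<=` `[c, d] -> measurable A ->
  0 <= primitive (\1_A) x <= fine (mu A).
Proof.
move=> Acd mA; have muA := measurable_subitv_lty Acd mA.
have mx : measurable (A `&` `]-oo, x]) by exact: measurableI.
rewrite /primitive /Rintegral integral_indic//.
rewrite fine_ge0//= fine_le//.
- rewrite ge0_fin_numE// (le_lt_trans _ muA)//; apply: le_measure; rewrite ?inE//.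
- by rewrite ge0_fin_numE.
- by apply: le_measure; rewrite ?inE//; exact: measurable_itv.
Qed.

Variables (Omega : set R) (f : R -> R) (V c' c d : R).
Hypothesis mO : measurable Omega.
Hypothesis intf : mu.-integrable Omega (EFin \o f).
Hypothesis fV : (BVseminorm Omega f <= V%:E)%E.
Hypothesis c'c : c' < c.
Hypothesis sub : `[c', d] `<=` Omega°.

(** The function $s = 1_A/|A| - 1_J/|J|$ has mean zero, and its primitive is a difference of two
    numbers in $[0,1]$; hence [integral_le_BV] applies with [M = 1]. *)
Lemma average_diff_le_BV A J : measurable A -> measurable J ->
  A `<=` `[c, d] -> J `<=` `[c, d] -> (0 < mu A)%E -> (0 < mu J)%E ->
  (fine (mu A))^-1 * \int[mu]_(x in A) f x -
  (fine (mu J))^-1 * \int[mu]_(x in J) f x <= V.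
Proof.
move=> mA mJ Acd Jcd A0 J0.
have muA := measurable_subitv_lty Acd mA.
have muJ := measurable_subitv_lty Jcd mJ.
have a0 : 0 < fine (mu A) by rewrite fine_gt0// A0.
have j0 : 0 < fine (mu J) by rewrite fine_gt0// J0.
have cdO : `[c, d] `<=` Omega.
  apply: subset_trans (@interior_subset _ _); apply: subset_trans sub.
  by apply: subset_itvr; rewrite bnd_simp ltW.
pose s x : R := (fine (mu A))^-1 * \1_A x - (fine (mu J))^-1 * \1_J x.
have mi A' : measurable A' -> measurable_fun setT (\1_A' : R -> R) by [].
have ii A' D : measurable A' -> A' `<=` `[c, d] -> measurable D ->
    mu.-integrable D (EFin \o (\1_A' : R -> R)).
  move=> mA' Acd' mD.
  apply: (@support_integrable _ (\1_A') 1 c d) => //.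
    by move=> x; rewrite indicE; case: (x \in A'); rewrite ?normr1 ?normr0.
  by move=> x /negP xcd; rewrite indicE memNset// => /Acd'.
have iZ A' D k : measurable A' -> A' `<=` `[c, d] -> measurable D ->
    mu.-integrable D (EFin \o (fun x => k * \1_A' x)).
  move=> mA' Acd' mD.
  by have := @integrableZl _ _ _ mu D mD k _ (ii _ _ mA' Acd' mD); apply: eq_integrable.
have sE D : measurable D -> \int[mu]_(x in D) s x =
  (fine (mu A))^-1 * \int[mu]_(x in D) \1_A x - (fine (mu J))^-1 * \int[mu]_(x in D) \1_J x.
  move=> mD; rewrite (@RintegralB _ _ _ mu _ _ _ mD) ?iZ//.
  by rewrite !(@RintegralZl _ _ _ mu)//; exact: ii.
have Iint A' : measurable A' -> A' `<=` `[c, d] -> \int[mu]_x \1_A' x = fine (mu A').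
  by move=> mA' Acd'; rewrite /Rintegral integral_indic// setIT.
have iO A' k : measurable A' -> A' `<=` `[c, d] ->
    mu.-integrable Omega (EFin \o (fun x => f x * (k * \1_A' x))).
  move=> mA' Acd'.
  apply: (@integrableMl _ _ _ mu Omega mO (EFin \o f) (fun x => k * \1_A' x)) => //.
    by apply: measurable_funM => //; apply: measurable_funTS.
  exists `|k|; split; first exact: num_real.
  move=> y ky x _; apply: le_trans (ltW ky).
  by rewrite normrM indicE; case: (x \in A'); rewrite ?normr1 ?normr0 ?mulr1 ?mulr0.
have -> : (fine (mu A))^-1 * \int[mu]_(x in A) f x -
    (fine (mu J))^-1 * \int[mu]_(x in J) f x = \int[mu]_(x in Omega) (f x * s x).
  transitivity (\int[mu]_(x in Omega) (f x * ((fine (mu A))^-1 * \1_A x) -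
      f x * ((fine (mu J))^-1 * \1_J x))); last first.
    by apply: eq_Rintegral => x _; rewrite mulrBr.
  rewrite (@RintegralB _ _ _ mu _ _ _ mO) ?iO//.
  have h A' k : measurable A' -> A' `<=` `[c, d] ->
      \int[mu]_(x in Omega) (f x * (k * \1_A' x)) = k * \int[mu]_(x in A') f x.
    move=> mA' Acd'; rewrite -(Rintegral_indicM _ mO mA' (subset_trans Acd' cdO)).
    rewrite -(@RintegralZl _ _ _ mu)//; first by apply: eq_Rintegral => x _; rewrite mulrCA.
    have := iO A' 1 mA' Acd'; apply: eq_integrable => // x _ /=; by rewrite mul1r.
  by rewrite !h.
rewrite -[leRHS]mul1r.
apply: (@integral_le_BV _ s ((fine (mu A))^-1 + (fine (mu J))^-1) c d 1 _ _ _ _ _ _ Omega f V c') => //.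
- by apply: measurable_funB; apply: measurable_funM.
- have hn A' k x : 0 < k -> `|k^-1 * \1_A' x| <= k^-1.
    move=> k0; rewrite normrM gtr0_norm ?invr_gt0// indicE.
    by case: (x \in A'); rewrite ?normr1 ?normr0 ?mulr1 ?mulr0// invr_ge0 ltW.
  by move=> x; apply: le_trans (ler_normB _ _) _; apply: lerD; exact: hn.
- move=> x /negP xcd; rewrite /s !indicE !memNset ?mulr0 ?subrr//.
    by move/Jcd.
  by move/Acd.
- by rewrite sE// !Iint// !mulVf ?gt_eqF// subrr.
- move=> x; rewrite /primitive sE//.
  have /andP[] := primitive_indic x Acd mA; have /andP[] := primitive_indic x Jcd mJ.
  rewrite /primitive => j1 j2 a1 a2.
  have hA : 0 <= (fine (mu A))^-1 * \int[mu]_(x in `]-oo, x]) \1_A x <= 1.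
    by rewrite mulr_ge0 ?invr_ge0 ?(ltW a0)//= mulrC ler_pdivrMr// mul1r.
  have hJ : 0 <= (fine (mu J))^-1 * \int[mu]_(x in `]-oo, x]) \1_J x <= 1.
    by rewrite mulr_ge0 ?invr_ge0 ?(ltW j0)//= mulrC ler_pdivrMr// mul1r.
  by rewrite ler_norml; lra.
Qed.

End AverageBV.

(** * Embedding of BV into $L^\infty$ *)

Section EssentialBound.
Context {R : realType}.
Local Notation mu := (@lebesgue_measure R).
Variables (Omega : set R) (a b : R).
Hypothesis mO : measurable Omega.
Hypothesis ab : a < b.
Hypothesis subO : `]a, b[ `<=` Omega°.
Hypothesis clO : Omega `<=` `[a, b].
Implicit Types f g : R -> R.

Lemma Omega_lty : (mu Omega < +oo)%E.
Proof. exact: measurable_subitv_lty clO mO. Qed.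

(** The middle third, a fixed reference set contained in every interval [[a + e k, b - e k]] of the
    exhaustion used below. *)
Definition mid_itv : set R := `[(2 * a + b) / 3, (a + 2 * b) / 3]%classic.

Definition mid_average f : R := (fine (mu mid_itv))^-1 * \int[mu]_(x in mid_itv) f x.

Lemma mid_itv_gt0 : (0 < mu mid_itv)%E.
Proof.
have h : (2 * a + b) / 3 < (a + 2 * b) / 3 by have := ab; lra.
by rewrite lebesgue_measure_itv/= lte_fin h -EFinB lte_fin subr_gt0.
Qed.

Let e k : R := (b - a) / 3 * 2^-1 ^+ k.

Let e0 k : 0 < e k.
Proof. by rewrite mulr_gt0 ?exprn_gt0 ?invr_gt0// divr_gt0// subr_gt0. Qed.

Let e3 k : e k <= (b - a) / 3.
Proof.
rewrite ler_piMr// ?exprn_ile1 ?invr_ge0// ?invf_le1// ?ler1n//.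
by rewrite ltW// divr_gt0// subr_gt0.
Qed.

(** The extra [e k / 2] at the left is the room required by the Steklov means on
    [[a + e k, b - e k]]. *)
Let small k : `[a + e k / 2, b - e k] `<=` Omega°.
Proof.
apply: subset_trans subO => x /=; rewrite !in_itv/= => /andP[h1 h2].
by have ? := e0 k; have ? := ab; apply/andP; split; lra.
Qed.

Lemma exhaust x : Omega x -> x != a -> x != b ->
  exists k, forall i, (k <= i)%N -> x \in `[a + e i, b - e i].
Proof.
move=> /clO/=; rewrite in_itv/= => /andP[ax xb] xna xnb.
have {}ax : a < x by rewrite lt_neqAle eq_sym xna.
have {}xb : x < b by rewrite lt_neqAle xnb.
have m0 : 0 < Num.min (x - a) (b - x) by rewrite lt_min !subr_gt0 ax.
have [k hk] := half_pow_lt ((b - a) / 3) m0.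
exists k => i ki; have : e i <= e k.
  rewrite ler_wpM2l//; first by rewrite ltW// divr_gt0// subr_gt0.
  by rewrite ler_wiXn2l ?invr_ge0// invf_le1// ler1n.
move: hk; rewrite -/(e k) lt_min => /andP[h1 h2] h.
by rewrite in_itv/=; apply/andP; split; lra.
Qed.

(** If [f] exceeded its reference mean by more than [V] on a set of positive measure, so would its
    mean over that set, against [average_diff_le_BV]. *)
Lemma ae_le_BV f V : mu.-integrable Omega (EFin \o f) ->
  (BVseminorm Omega f <= V%:E)%E ->
  {ae mu, forall x, Omega x -> `|f x - mid_average f| <= V}.
Proof.
move=> intf fV; set m := mid_average f.
have mf : measurable_fun Omega f by apply/measurable_EFinP; exact: (measurable_int mu intf).
have mJ : measurable mid_itv by exact: measurable_itv.
have IO k : `[a + e k, b - e k] `<=` Omega.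
  apply: subset_trans (@interior_subset _ _); apply: subset_trans (@small k).
  by apply: subset_itvr; rewrite bnd_simp lerD2l; have := e0 k; lra.
have JI k : mid_itv `<=` `[a + e k, b - e k].
  move=> x; rewrite /mid_itv/= !in_itv/= => /andP[h1 h2]; have ? := e3 k; have ? := ab; apply/andP; split; lra.
(* One index serves both the excess and the distance to the endpoints, as both conditions weaken
   when [k] grows; countably many null sets then suffice. *)
pose A k := (Omega `&` [set x | m + V + 2^-1 ^+ k <= f x]) `&` `[a + e k, b - e k].
pose A' k := (Omega `&` [set x | f x <= m - V - 2^-1 ^+ k]) `&` `[a + e k, b - e k].
have mA k : measurable (A k).
  apply: measurableI => //; apply: measurable_fun_le => //.
have mA' k : measurable (A' k).
  apply: measurableI => //; apply: measurable_fun_le => //.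
have avg B k : measurable B -> B `<=` `[a + e k, b - e k] -> (0 < mu B)%E ->
    `|(fine (mu B))^-1 * \int[mu]_(x in B) f x - m| <= V.
  move=> mB BI B0.
  have h1 : a + e k / 2 < a + e k by rewrite ltrD2l; have := e0 k; lra.
  have := average_diff_le_BV mO intf fV h1 (@small k) mB mJ BI (@JI k) B0 mid_itv_gt0.
  have := average_diff_le_BV mO intf fV h1 (@small k) mJ mB (@JI k) BI mid_itv_gt0 B0.
  by rewrite -/(mid_average f) -/m ler_norml; lra.
have fin B k : measurable B -> B `<=` `[a + e k, b - e k] -> (0 < mu B)%E ->
    0 < fine (mu B).
  by move=> mB BI B0; rewrite fine_gt0// B0 (measurable_subitv_lty BI mB).
have cstI B k t : measurable B -> B `<=` `[a + e k, b - e k] ->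
    mu.-integrable B (EFin \o cst t).
  move=> mB BI; apply: (@measurable_bounded_integrable _ _ _ mu) => //.
    exact: measurable_subitv_lty BI mB.
  by exists `|t|; split; [exact: num_real|move=> z /ltW + x _; exact].
have fI B k : measurable B -> B `<=` `[a + e k, b - e k] ->
    mu.-integrable B (EFin \o f).
  move=> mB BI; apply: (@integrableS _ _ _ mu Omega) => //.
  exact: subset_trans (@IO k).
have null B : measurable B -> ((0 < mu B)%E -> False) -> mu.-negligible B.
  move=> mB B0; exists B; split => //; apply/eqP; rewrite eq_le measure_ge0 andbT.
  by rewrite leNgt; apply/negP.
have nA k : mu.-negligible (A k).
  apply: (null _ (mA k)) => A0; have AI : A k `<=` `[a + e k, b - e k] by move=> x [].
  have := avg _ _ (mA k) AI A0; have f0 := fin _ _ (mA k) AI A0.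
  have : (m + V + 2^-1 ^+ k) * fine (mu (A k)) <= \int[mu]_(x in A k) f x.
    rewrite -(@Rintegral_cst _ _ _ mu); last exact: mA k.
    apply: (@le_Rintegral _ _ _ mu); first exact: mA k.
    - exact: (cstI _ k _ (mA k) AI).
    - exact: (fI _ k (mA k) AI).
    - by move=> x [[]].
  rewrite -ler_pdivlMr// mulrC ler_norml => h1 /andP[_ h2].
  have := le_trans h1 (_ : _ <= V + m).
  have : 0 < (2^-1 : R) ^+ k by rewrite exprn_gt0 ?invr_gt0.
  by move: h2; rewrite lerBlDr => h2 h3 /(_ h2); lra.
have nA' k : mu.-negligible (A' k).
  apply: (null _ (mA' k)) => A0; have AI : A' k `<=` `[a + e k, b - e k] by move=> x [].
  have := avg _ _ (mA' k) AI A0; have f0 := fin _ _ (mA' k) AI A0.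
  have : \int[mu]_(x in A' k) f x <= (m - V - 2^-1 ^+ k) * fine (mu (A' k)).
    rewrite -(@Rintegral_cst _ _ _ mu); last exact: mA' k.
    apply: (@le_Rintegral _ _ _ mu); first exact: mA' k.
    - exact: (fI _ k (mA' k) AI).
    - exact: (cstI _ k _ (mA' k) AI).
    - by move=> x [[]].
  rewrite -ler_pdivrMr// mulrC ler_norml => h1 /andP[h2 _].
  have : 0 < (2^-1 : R) ^+ k by rewrite exprn_gt0 ?invr_gt0.
  by move: h1 h2; set q := _^-1 * _; lra.
have nab t : mu.-negligible [set t].
  by exists [set t]; split => //; exact: lebesgue_measure_set1.
(* The endpoints may belong to [Omega] without lying in any interval of the exhaustion. *)
have big : mu.-negligible (([set a] `|` [set b]) `|` (\bigcup_k A k `|` \bigcup_k A' k)).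
  by apply: negligibleU; apply: negligibleU => //; apply: negligible_bigcup.
apply: negligibleS big => x /=; apply: contra_notP => /not_orP[/not_orP[xa xb]].
move=> /not_orP[nAx nA'x] Ox.
have [k hk] := exhaust Ox (introN eqP xa) (introN eqP xb).
rewrite ler_norml; apply/andP; split; rewrite leNgt; apply/negP => h.
- apply: nA'x; have [i hi] : exists i, 1 * 2^-1 ^+ i < - V - (f x - m).
    by apply: half_pow_lt; lra.
  exists (maxn k i) => //; split; last by apply: hk; exact: leq_maxl.
  split => //=; have : (2^-1 : R) ^+ maxn k i <= 2^-1 ^+ i.
    by rewrite ler_wiXn2l ?invr_ge0// ?leq_maxr// invf_le1// ler1n.
  by move: hi; rewrite mul1r; lra.
- apply: nAx; have [i hi] : exists i, 1 * 2^-1 ^+ i < (f x - m) - V.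
    by apply: half_pow_lt; lra.
  exists (maxn k i) => //; split; last by apply: hk; exact: leq_maxl.
  split => //=; have : (2^-1 : R) ^+ maxn k i <= 2^-1 ^+ i.
    by rewrite ler_wiXn2l ?invr_ge0// ?leq_maxr// invf_le1// ler1n.
  by move: hi; rewrite mul1r; lra.
Qed.

End EssentialBound.

(** * Interpolation between the variation and the primitive of a difference *)

Section Interpolation.
Context {R : realType}.
Local Notation mu := (@lebesgue_measure R).
Variables (Omega : set R) (a b : R).
Hypothesis mO : measurable Omega.
Hypothesis ab : a < b.
Hypothesis subO : `]a, b[ `<=` Omega°.
Hypothesis clO : Omega `<=` `[a, b].
Variables (f g : R -> R) (L V m c d : R).
Hypothesis mf : measurable_fun setT f.
Hypothesis mg : measurable_fun setT g.
Hypothesis fL : forall x, `|f x| <= L.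
Hypothesis gL : forall x, `|g x| <= L.
Hypothesis f0 : forall x, ~ Omega x -> f x = 0.
Hypothesis g0 : forall x, ~ Omega x -> g x = 0.
Hypothesis fV : (BVseminorm Omega f <= V%:E)%E.
Hypothesis gV : (BVseminorm Omega g <= V%:E)%E.
Hypothesis ac : a < c.
Hypothesis cd : c < d.
Hypothesis db : d < b.
Hypothesis m0 : 0 < m.
Let h x := f x - g x.
Hypothesis hm : forall x, `|primitive h x| <= m.

Let mh : measurable_fun setT h.
Proof. exact: measurable_funB. Qed.

Let hL x : `|h x| <= 2 * L.
Proof.
by have := ler_normB (f x) (g x); have := fL x; have := gL x; rewrite /h; lra.
Qed.

Let h0 x : x \notin `[a, b] -> h x = 0.
Proof.
by move=> xab; rewrite /h f0 ?g0 ?subrr//; move=> /clO; apply/negP.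
Qed.

Let ih D : measurable D -> mu.-integrable D (EFin \o h).
Proof. by move=> mD; exact: (support_integrable mh hL h0 mD). Qed.

Let integral_itv x : c <= x -> `|\int[mu]_(t in `[c, x]) h t| <= 2 * m.
Proof.
move=> cx; rewrite -Rintegral_itv_obnd_cbnd; last exact: ih.
rewrite -(primitiveB mh hL h0 cx).
by have := ler_normB (primitive h x) (primitive h c); have := hm x; have := hm c; lra.
Qed.

Let J := `[c, d]%classic.
Let mJ : measurable J.
Proof. exact: measurable_itv. Qed.

Let k := (d - c)^-1 * \int[mu]_(t in J) h t.
Let s x := (h x - k) * \1_J x.

Let dc0 : 0 < d - c.
Proof. by rewrite subr_gt0. Qed.

Let kdc : `|k| * (d - c) <= 2 * m.
Proof.
rewrite /k normrM normfV (gtr0_norm dc0) mulrAC mulVf ?gt_eqF// mul1r.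
exact/integral_itv/ltW.
Qed.

Let muJ x : c <= x -> fine (mu `[c, x]%classic) = x - c.
Proof.
move=> cx; rewrite /= lebesgue_measure_itv/= lte_fin.
by move: cx; rewrite le_eqVlt => /predU1P[->|cx]; rewrite ?ltxx ?subrr ?cx.
Qed.

Let s_integral D x : measurable D -> D `&` J = `[c, x]%classic -> c <= x ->
  \int[mu]_(t in D) s t = \int[mu]_(t in `[c, x]) h t - k * (x - c).
Proof.
move=> mD DJ cx; transitivity (\int[mu]_(t in `[c, x]) (h t - k)).
  rewrite -DJ Rintegral_mkcondr; apply: eq_Rintegral => t _.
  by rewrite /s indicE patchE; case: (t \in J); rewrite ?mulr1 ?mulr0.
have ik : mu.-integrable `[c, x] (EFin \o (fun=> k)).
  apply: (@measurable_bounded_integrable _ _ _ mu) => //.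
    by rewrite /= lebesgue_measure_itv; case: ifP => // _; rewrite -EFinB ltry.
  by exists `|k|; split; [exact: num_real|move=> z /ltW + y _; exact].
rewrite (@RintegralB _ _ _ mu)//; last exact: ih.
by rewrite (@Rintegral_cst _ _ _ mu)// muJ.
Qed.

Let ms : measurable_fun setT s.
Proof.
apply: measurable_funM; last by apply: measurable_indic; exact: measurable_itv.
exact: (measurable_funB mh (measurable_cst k)).
Qed.

Let sB x : `|s x| <= 2 * L + `|k|.
Proof.
have k0 := normr_ge0 k; have hx := hL x; have hx0 := normr_ge0 (h x).
rewrite /s normrM indicE; case: (x \in J); rewrite ?normr1 ?normr0 ?mulr1 ?mulr0.
  by have := ler_normB (h x) k; lra.
lra.
Qed.

Let s0 x : x \notin `[c, d] -> s x = 0.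
Proof. by move=> /negP xcd; rewrite /s indicE memNset// mulr0. Qed.

Let s_tot : \int[mu]_x s x = 0.
Proof.
rewrite (@s_integral setT d) ?setTI// ?(ltW cd)//.
by rewrite /k mulrAC mulVf ?gt_eqF// mul1r subrr.
Qed.

(** The integral of [h] from [c] to [x] contributes [2 * m], and the recentring term [k * (x - c)]
    another [2 * m] by [kdc]. *)
Let s_prim x : `|primitive s x| <= 4 * m.
Proof.
have [xc|cx] := ltP x c.
  by rewrite (primitive_left s0 xc) normr0 mulr_ge0// ltW.
have [xd|dx] := leP x d; last first.
  by rewrite (primitive_right s0 (ltW dx)) s_tot normr0 mulr_ge0// ltW.
have DJ : `]-oo, x]%classic `&` J = `[c, x]%classic.
  apply/seteqP; split => t; rewrite /J/= !in_itv/=.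
    by move=> [-> /andP[-> _]].
  by move=> /andP[-> tx]; rewrite tx (le_trans tx xd).
rewrite /primitive (s_integral _ DJ cx)//.
have := integral_itv cx; have : `|k * (x - c)| <= 2 * m.
  rewrite normrM (@ger0_norm _ (x - c)) ?subr_ge0//.
  by apply: le_trans kdc; rewrite ler_wpM2l// lerD2r.
by have := ler_normB (\int[mu]_(t in `[c, x]) h t) (k * (x - c)); lra.
Qed.

Let JO : J `<=` Omega.
Proof.
apply: subset_trans (@interior_subset _ _); apply: subset_trans subO.
by apply: subset_itv; rewrite bnd_simp.
Qed.

Let fi (u : R -> R) : measurable_fun setT u -> (forall x, `|u x| <= L) ->
  mu.-integrable Omega (EFin \o u).
Proof.
move=> mu' uL; apply: (@measurable_bounded_integrable _ _ _ mu) => //.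
- exact: Omega_lty clO.
- exact: measurable_funTS.
- by exists L; split; [exact: num_real|move=> z /ltW + y _; apply: le_trans].
Qed.

Let c'c : (a + c) / 2 < c.
Proof. by have := ac; lra. Qed.

Let sub' : `[(a + c) / 2, d] `<=` Omega°.
Proof.
apply: subset_trans subO; apply: subset_itv; rewrite bnd_simp//.
by have := ac; lra.
Qed.

Let us (u : R -> R) : measurable_fun setT u -> (forall x, `|u x| <= L) ->
  mu.-integrable Omega (EFin \o (fun x => u x * s x)).
Proof.
move=> mu' uL; apply: (@integrableMl _ _ _ mu Omega mO (EFin \o u)).
- exact: fi.
- exact: measurable_funTS.
- by exists (2 * L + `|k|); split; [exact: num_real|move=> z /ltW + y _; apply: le_trans].
Qed.

(* Testing the variation of f and g against the primitive of s, the recentred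
   restriction of h to J, bounds the L^2 norm of h by the sup norm of its
   primitive. *)
Lemma sqr_integral_le_BV :
  \int[mu]_(x in J) h x ^+ 2 <= 8 * m * V + 4 * m ^+ 2 / (d - c).
Proof.
have h1 : \int[mu]_(x in Omega) (f x * s x) <= 4 * m * V.
  have m4 : 0 < 4 * m by exact: mulr_gt0.
  exact: (integral_le_BV ms sB s0 s_tot m4 s_prim mO (fi mf fL) fV c'c sub').
(* The variation bounds integrals from above only, so [g] is tested against [- s]. *)
have h2 : - (\int[mu]_(x in Omega) (g x * s x)) <= 4 * m * V.
  have Ns D : measurable D -> \int[mu]_(x in D) (- s x) = - (\int[mu]_(x in D) s x).
    move=> mD; rewrite -mulN1r -(@RintegralZl _ _ _ mu)//.
      by apply: eq_Rintegral => x _; rewrite mulN1r.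
    exact: (support_integrable ms sB s0).
  have -> : - (\int[mu]_(x in Omega) (g x * s x)) = \int[mu]_(x in Omega) (g x * - s x).
    rewrite -mulN1r -(@RintegralZl _ _ _ mu)//; last exact: us.
    by apply: eq_Rintegral => x _; rewrite mulN1r mulrN.
  apply: (@integral_le_BV _ (fun x => - s x) (2 * L + `|k|) c d (4 * m) _ _ _ _ _ _
     Omega g V ((a + c) / 2)) => //.
  - exact: measurable_funN.
  - by move=> x; rewrite normrN.
  - by move=> x /s0 ->; rewrite oppr0.
  - by rewrite Ns// s_tot oppr0.
  - exact: mulr_gt0.
  - by move=> x; rewrite /primitive Ns// normrN; exact: s_prim.
  - exact: fi.
have i2 : mu.-integrable J (EFin \o (fun x => h x ^+ 2)).
  apply: (@measurable_bounded_integrable _ _ _ mu) => //.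
  - by rewrite /J/= lebesgue_measure_itv; case: ifP => // _; rewrite -EFinB ltry.
  - by apply: measurable_funX; apply: measurable_funTS.
  - exists ((2 * L) ^+ 2); split; [exact: num_real|move=> z /ltW zL y _ /=].
    apply: le_trans zL; rewrite normrX lerXn2r ?nnegrE//.
    exact: le_trans (hL y).
(* Both sides are the integral of [h * s]; the term with [k] is the cost of recentring, quadratic in
   [m] by [h4]. *)
have h3 : \int[mu]_(x in J) h x ^+ 2 - k * \int[mu]_(x in J) h x =
    \int[mu]_(x in Omega) (f x * s x) - \int[mu]_(x in Omega) (g x * s x).
  rewrite -(@RintegralB _ _ _ mu)//; [|exact: us|exact: us].
  rewrite -(@RintegralZl _ _ _ mu)//; last exact: ih.
  rewrite -(@RintegralB _ _ _ mu)//; last first.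
    by have := @integrableZl _ _ _ mu J (measurable_itv _) k _ (ih (measurable_itv `[c, d]));
      apply: eq_integrable.
  transitivity (\int[mu]_(x in Omega) ((h x ^+ 2 - k * h x) * \1_J x)).
    by rewrite (Rintegral_indicM _ mO (measurable_itv `[c, d]) JO).
  by apply: eq_Rintegral => x _; rewrite /s /h; ring.
have h4 : k * \int[mu]_(x in J) h x <= 4 * m ^+ 2 / (d - c).
  rewrite ler_pdivlMr//; set I := Rintegral _ _ _.
  have Im : `|I| <= 2 * m by apply: integral_itv; exact: ltW.
  apply: le_trans (ler_norm _) _.
  have -> : `|k * I * (d - c)| = `|I| * (`|k| * (d - c)).
    by rewrite !normrM (gtr0_norm dc0); ring.
  apply: (@le_trans _ _ ((2 * m) * (2 * m))); last by rewrite expr2; lra.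
  by apply: ler_pM => //; rewrite mulr_ge0// ltW.
by lra.
Qed.

Lemma nrmB_sqr_le_BV :
  nrm Omega (f \- g) ^+ 2 <= 8 * m * V + 4 * m ^+ 2 / (d - c)
    + (2 * L) ^+ 2 * ((b - a) - (d - c)).
Proof.
rewrite sqr_nrm /ip.
have sq D : measurable D -> (mu D < +oo)%E -> mu.-integrable D (EFin \o (fun x => h x ^+ 2)).
  move=> mD Dfin; apply: (@measurable_bounded_integrable _ _ _ mu) => //.
  - by apply: measurable_funX; apply: measurable_funTS.
  - exists ((2 * L) ^+ 2); split; [exact: num_real|move=> z /ltW zL y _ /=].
    apply: le_trans zL; rewrite normrX lerXn2r ?nnegrE//.
    exact: le_trans (hL y).
have mOJ : measurable (`[a, b]%classic `\` J) by exact: measurableD.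
have abfin : (mu `[a, b]%classic < +oo)%E.
  by rewrite /= lebesgue_measure_itv; case: ifP => // _; rewrite -EFinB ltry.
have abJfin : (mu (`[a, b]%classic `\` J) < +oo)%E.
  by apply: le_lt_trans abfin; apply: le_measure; rewrite ?inE//; exact: subDsetl.
have Jab : J `<=` `[a, b] by apply: subset_trans clO; exact: JO.
have -> : \int[mu]_(x in Omega) ((f \- g) x * (f \- g) x) =
    \int[mu]_(x in `[a, b]) h x ^+ 2.
  rewrite Rintegral_mkcond [RHS]Rintegral_mkcond; apply: eq_Rintegral => x _.
  rewrite !patchE; case: ifPn => [xO|]; case: ifPn => [xab|xab]; rewrite ?expr2//.
  - by move: xab; rewrite inE in xO; rewrite notin_setE => /(_ (clO xO)).
  - by rewrite notin_setE => xO; rewrite /h f0// g0// subrr mul0r.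
rewrite -(setDUK Jab) (@Rintegral_setU _ _ _ mu)//; last 2 first.
- by rewrite setDUK//; exact: sq.
- by rewrite disj_set2E; apply/eqP/seteqP; split => x //= [? []].
apply: lerD; first exact: sqr_integral_le_BV.
have -> : (b - a) - (d - c) = fine (mu (`[a, b]%classic `\` J)).
  rewrite (@measureD _ _ _ mu _ _ (measurable_itv `[a, b]) mJ abfin).
  rewrite (setIidr Jab) /= !lebesgue_measure_itv/= !lte_fin ab cd.
  by rewrite -!EFinB.
rewrite -(@Rintegral_cst _ _ _ mu)//; apply: (@le_Rintegral _ _ _ mu) => //.
- exact: sq.
- apply: (@measurable_bounded_integrable _ _ _ mu) => //.
  by exists `|(2 * L) ^+ 2|; split; [exact: num_real|move=> z /ltW + y _; exact].
- move=> x _; rewrite -(real_normK (num_real (h x))) lerXn2r ?nnegrE//.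
  exact: le_trans (hL x).
Qed.

End Interpolation.

(** * Limits along an ultrafilter *)

Section UltraLimits.
Context {R : realType}.
Variable U : set_system nat.
Hypothesis UU : UltraFilter U.

Let PU : ProperFilter U. Proof. exact: ultra_proper. Qed.

(** A cluster point in the compact segment is a limit, since an ultrafilter contains each set or its
    complement. *)
Lemma ultra_cvg_bounded (u : nat -> R) B :
  (forall j, `|u j| <= B) -> exists l : R, u j @[j --> U] --> l.
Proof.
move=> uB; have cB := @segment_compact R (- B) B.
have UB : U (u @^-1` `[- B, B]).
  by apply: filterE => j /=; rewrite in_itv/= -ler_norml; exact: uB.
have [l [_ cl]] := cB (u @ U) (fmap_proper_filter u PU) UB.
exists l => N Nl; have [//|nN] := in_ultra_setVsetC (u @^-1` N) UU.
by have [x [nNx Nx]] := cl (~` N) N nN Nl.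
Qed.

Lemma ultra_cauchy (u : nat -> R) B e : (forall j, `|u j| <= B) -> 0 < e ->
  exists2 A, U A & forall i j, A i -> A j -> `|u i - u j| <= e.
Proof.
move=> /ultra_cvg_bounded[l ul] e0.
have e20 : 0 < e / 2 by rewrite divr_gt0.
exists [set i | `|l - u i| < e / 2]; first by move/cvgrPdist_lt : ul => /(_ _ e20).
move=> i j /= hi hj; have := ler_normB (l - u j) (l - u i).
by rewrite (_ : l - u j - (l - u i) = u i - u j); [lra|ring].
Qed.

(** Arzela-Ascoli in ultrafilter form: pointwise Cauchy estimates on a finite grid hold on a common
    set of [U], and the common Lipschitz constant carries them to all of [[a, b]]. *)
Lemma ultra_uniform_cauchy (Phi : nat -> R -> R) (a b L B e : R) : a < b ->
  (forall j x y, `|Phi j x - Phi j y| <= L * `|x - y|) ->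
  (forall j x, `|Phi j x| <= B) -> 0 < e ->
  exists2 A, U A & forall i j x, A i -> A j -> x \in `[a, b] ->
    `|Phi i x - Phi j x| <= e.
Proof.
move=> ab PL PB e0.
have L0 : 0 <= L.
  have := PL 0%N a b; rewrite distrC => /(le_trans (normr_ge0 _)).
  by rewrite pmulr_lge0// normr_gt0 subr_eq0 lt_eqF.
(* A grid of mesh $(b-a)2^{-N_0}$: moving to a grid point costs at most [e / 3], twice, and
   comparing there costs the last third. *)
have [N0 hN0] := half_pow_lt (L * (b - a)) (divr_gt0 e0 (ltr0n R 3)).
pose N := (2 ^ N0)%N.
have N_gt0 : 0 < (N%:R : R) by rewrite ltr0n expn_gt0.
pose g (k : 'I_N.+1) := a + (b - a) * (k%:R / N%:R).
have /choice[A hA] (k : 'I_N.+1) : exists A : set nat, U A /\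
    forall i j, A i -> A j -> `|Phi i (g k) - Phi j (g k)| <= e / 3.
  have e3 : 0 < e / 3 by rewrite divr_gt0.
  have [A UA hA] := @ultra_cauchy (fun j => Phi j (g k)) B (e / 3) (fun j => PB j _) e3.
  by exists A.
exists [set i | forall k, A k i].
  by apply: filter_forall => k; have [] := hA k.
move=> i j x Ai Aj; rewrite in_itv/= => /andP[ax xb].
pose t := (x - a) / (b - a) * N%:R.
have ba0 : 0 < b - a by rewrite subr_gt0.
have t0 : 0 <= t by rewrite mulr_ge0 ?divr_ge0 ?subr_ge0// ltW.
have tN : t <= N%:R.
  by rewrite /t ler_piMl ?ler0n// ler_pdivrMr// mul1r lerD2r.
(* The truncation of the rescaled position [t] is the index of the grid point just to the left of
   [x]. *)
have /andP[kt tk] := Num.Theory.truncn_itv t0; set k := Num.truncn t in kt tk.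
have kN : (k < N.+1)%N.
  by rewrite ltnS -(ler_nat R); apply: le_trans kt tN.
pose K := Ordinal kN.
have xg : `|x - g K| <= (b - a) * 2^-1 ^+ N0.
  have -> : x - g K = (b - a) * 2^-1 ^+ N0 * (t - k%:R).
    have -> : (2^-1 : R) ^+ N0 = N%:R^-1 by rewrite /N natrX exprVn.
    by rewrite /g /t /=; field; rewrite !gt_eqF.
  rewrite normrM ger0_norm ?mulr_ge0 ?exprn_ge0 ?invr_ge0 ?(ltW ba0)//.
  rewrite ler_piMr ?mulr_ge0 ?exprn_ge0 ?invr_ge0 ?(ltW ba0)//.
  rewrite ger0_norm ?subr_ge0// lerBlDr.
  by rewrite addrC natr1 ltW.
have lip l : `|Phi l x - Phi l (g K)| <= e / 3.
  apply: le_trans (PL l _ _) _; apply: le_trans (ltW hN0).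
  by rewrite -mulrA ler_wpM2l.
have := (hA K).2 i j (Ai K) (Aj K); have := lip i; have := lip j.
have -> : Phi i x - Phi j x = (Phi i x - Phi i (g K)) +
   (Phi i (g K) - Phi j (g K)) - (Phi j x - Phi j (g K)) by ring.
have := ler_normB (Phi i x - Phi i (g K) + (Phi i (g K) - Phi j (g K))) (Phi j x - Phi j (g K)).
have := ler_normD (Phi i x - Phi i (g K)) (Phi i (g K) - Phi j (g K)).
by lra.
Qed.

End UltraLimits.

(** * Bounded representatives of BV functions *)

Section BVCompactness.
Context {R : realType}.
Local Notation mu := (@lebesgue_measure R).
Variables (Omega : set R) (a b : R).
Hypothesis mO : measurable Omega.
Hypothesis ab : a < b.
Hypothesis subO : `]a, b[ `<=` Omega°.
Hypothesis clO : Omega `<=` `[a, b].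
Implicit Types (f g psi : R -> R).

Lemma test_function0 : test_function Omega (cst 0).
Proof.
split.
- by move=> x; exact: derivable_cst.
- rewrite (_ : derive1 (cst 0) = cst 0); first exact: cst_continuous.
  by apply/funext => x; rewrite derive1_cst.
- by exists set0; [split; [exact: compact0|]|].
Qed.

Lemma BVseminorm_ge0 f : (0 <= BVseminorm Omega f)%E.
Proof.
apply: ereal_sup_ubound; exists (cst 0).
  by split; [exact: test_function0|move=> x; rewrite normr0].
congr EFin; transitivity (\int[mu]_(x in Omega) (0 : R)).
  by apply: eq_Rintegral => x _; rewrite derive1_cst mulr0.
by rewrite (@Rintegral_cst _ _ _ mu)// mul0r.
Qed.

Lemma BVseminorm_ae f g : measurable_fun Omega f -> measurable_fun Omega g ->
  eq_on Omega f g -> BVseminorm Omega f = BVseminorm Omega g.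
Proof.
move=> mf mg fg; congr ereal_sup; apply/seteqP.
have E psi : test_function Omega psi ->
    \int[mu]_(x in Omega) (f x * derive1 psi x) =
    \int[mu]_(x in Omega) (g x * derive1 psi x).
  move=> [_ cpsi _].
  have mpsi : measurable_fun Omega (derive1 psi).
    by apply: measurable_funTS; exact: continuous_measurable_fun.
  apply: ae_eq_Rintegral => //; [exact: measurable_funM|exact: measurable_funM|].
  by move: fg; apply: aeS => x h Ox; rewrite h.
by split => _ [psi [tpsi p1] <-]; exists psi => //; rewrite E.
Qed.

(** The first summand bounds the mean over the middle third, by Cauchy-Schwarz on [Omega]; [V]
    bounds the deviation from that mean. *)
Definition sup_bound (C V : R) :=
  (fine (mu (mid_itv a b)))^-1 * (C * Num.sqrt (fine (mu Omega))) + V.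

(** Truncation at the essential bound changes [f] on a null set only. The representative is bounded
    everywhere and zero off [Omega], as the estimates on primitives demand. *)
Lemma bounded_representative f C V : sqint Omega f -> nrm Omega f <= C ->
  (BVseminorm Omega f <= V%:E)%E ->
  exists g, [/\ measurable_fun setT g, forall x, `|g x| <= sup_bound C V,
    forall x, ~ Omega x -> g x = 0, eq_on Omega f g &
    (BVseminorm Omega g <= V%:E)%E].
Proof.
move=> sf fC fV; set L := sup_bound C V.
have Ofin := Omega_lty mO clO.
have intf := sqint_integrable mO Ofin sf.
have mJ : measurable (mid_itv a b) by exact: measurable_itv.
have JO : mid_itv a b `<=` Omega.
  apply: subset_trans (@interior_subset _ _); apply: subset_trans subO.
  by apply: subset_itv; rewrite bnd_simp; have := ab; lra.
have avgL : `|mid_average a b f| <= L - V.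
  rewrite /L /sup_bound addrK /mid_average normrM normfV.
  rewrite (@ger0_norm _ (fine _)) ?fine_ge0// ler_wpM2l ?invr_ge0 ?fine_ge0//.
  have intJ : mu.-integrable (mid_itv a b) (EFin \o f).
    exact: (@integrableS _ _ _ mu Omega).
  apply: le_trans (@le_normr_Rintegral _ _ _ mu _ _ mJ intJ) _.
  apply: (@le_trans _ _ (\int[mu]_(x in Omega) `|f x|)).
    apply: fine_le.
    - have := integrable_norm intJ; exact: (@integrable_fin_num _ _ _ mu _ mJ).
    - have := integrable_norm intf; exact: (@integrable_fin_num _ _ _ mu _ mO).
    - apply: ge0_subset_integral => //.
      by have /measurable_int := integrable_norm intf.
  apply: le_trans (integral_norm_le_nrm mO Ofin sf) _.
  by rewrite ler_wpM2r ?sqrtr_ge0.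
have aeL : {ae mu, forall x, Omega x -> `|f x| <= L}.
  have := ae_le_BV mO ab subO clO intf fV; apply: aeS => x + Ox => /(_ Ox).
  have := ler_normD (f x - mid_average a b f) (mid_average a b f).
  by rewrite subrK; have := avgL; lra.
have L0 : 0 <= L.
  have V0 : 0 <= V.
    by rewrite -lee_fin; apply: le_trans fV; exact: BVseminorm_ge0.
  by have := le_trans (normr_ge0 _) avgL; lra.
pose g := (fun x => Num.max (- L) (Num.min L (f x))) \_ Omega.
have gL x : `|g x| <= L.
  rewrite /g patchE; case: ifP => _; last by rewrite normr0.
  by rewrite ler_norml le_max lexx/= ge_max ge_min lexx/= andbT -subr_ge0 opprK addr_ge0.
have mg : measurable_fun setT g.
  apply/(measurable_restrictT _ mO).
  apply: measurable_maxr => //; apply: measurable_minr => //; exact: sf.1.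
have fg : eq_on Omega f g.
  move: aeL; apply: aeS => x h Ox; rewrite /g patchE mem_set//.
  move: (h Ox); rewrite ler_norml => /andP[h1 h2].
  by rewrite (min_idPr h2) (max_idPr h1).
exists g; split => //.
- by move=> x nOx; rewrite /g patchE memNset.
- by rewrite -(BVseminorm_ae sf.1 _ fg)//; exact: measurable_funTS.
Qed.

End BVCompactness.

(** * Precompactness in $L^2$ of sequences bounded in BV *)

Section BVUltraCauchy.
Context {R : realType}.
Local Notation mu := (@lebesgue_measure R).
Variable U : set_system nat.
Hypothesis UU : UltraFilter U.

Let PU : ProperFilter U. Proof. exact: ultra_proper. Qed.

Lemma BV_ultra_cauchy_itv (Omega : set R) (a b : R) (f : nat -> R -> R) (C V e : R) :
  measurable Omega -> a < b -> `]a, b[ `<=` Omega° -> Omega `<=` `[a, b] ->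
  (forall j, sqint Omega (f j)) -> (forall j, nrm Omega (f j) <= C) ->
  (forall j, (BVseminorm Omega (f j) <= V%:E)%E) -> 0 < e ->
  exists2 A, U A & forall i j, A i -> A j -> nrm Omega (f i \- f j) <= e.
Proof.
move=> mO ab subO clO sf fC fV e0.
have Ofin := Omega_lty mO clO.
have /choice[g hg] j := bounded_representative mO ab subO clO (sf j) (fC j) (fV j).
set L := sup_bound Omega a b C V in hg.
have mg j : measurable_fun setT (g j) by case: (hg j).
have gL j x : `|g j x| <= L by case: (hg j).
have g0 j x : ~ Omega x -> g j x = 0 by case: (hg j) => _ _ + _ _; exact.
have fg j : eq_on Omega (f j) (g j) by case: (hg j).
have gV j : (BVseminorm Omega (g j) <= V%:E)%E by case: (hg j).
have sg j : sqint Omega (g j).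
  by apply: (@sqint_bounded _ _ mO Ofin _ L) => //; exact: measurable_funTS.
have L0 : 0 <= L by exact: le_trans (gL 0%N 0).
have V0 : 0 <= V.
  by rewrite -lee_fin; apply: le_trans (gV 0%N); exact: BVseminorm_ge0.
have g0' j x : x \notin `[a, b] -> g j x = 0.
  by move=> /negP xab; apply: g0 => /clO.
have gi j D : measurable D -> mu.-integrable D (EFin \o g j).
  by move=> mD; exact: (support_integrable (mg j) (gL j) (g0' j) mD).
have e2 : 0 < e ^+ 2 by rewrite exprn_gt0.
have ba0 : 0 < b - a by rewrite subr_gt0.
(* Half of $e^2$ is for the interior: with $m \le 1$ and $d - c \ge (b-a)/2$, $8mV + 4m^2/(d-c) \le
   m(8V + 8/(b-a))$. *)
pose m : R := Num.min 1 (e ^+ 2 / 2 / (8 * V + 8 / (b - a))).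
have q0 : 0 < 8 * V + 8 / (b - a) by rewrite ltr_wpDl ?mulr_ge0 ?divr_gt0.
have m0 : 0 < m by rewrite lt_min ltr01 !divr_gt0.
(* Width of the two margins at the ends: they cost $(2L)^2 \cdot 2t = 8L^2 t$, the other half of
   $e^2$. The added 1 keeps the quotient meaningful when [L = 0]. *)
pose t : R := Num.min ((b - a) / 4) (e ^+ 2 / (16 * L ^+ 2 + 1)).
have r0 : 0 < 16 * L ^+ 2 + 1 by rewrite ltr_wpDl ?mulr_ge0 ?sqr_ge0.
have t0 : 0 < t by rewrite lt_min !divr_gt0.
have tba : t <= (b - a) / 4 by rewrite ge_min lexx.
have tL : t * (16 * L ^+ 2 + 1) <= e ^+ 2 by rewrite -ler_pdivlMr// ge_min lexx orbT.
have mV : m * (8 * V + 8 / (b - a)) <= e ^+ 2 / 2.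
  by rewrite -ler_pdivlMr// ge_min lexx orbT.
have m1 : m <= 1 by rewrite ge_min lexx.
have primB i j x : primitive (fun z => g i z - g j z) x =
    primitive (g i) x - primitive (g j) x.
  by rewrite /primitive (@RintegralB _ _ _ mu)//; exact: gi.
have prim_left j x : x < a -> primitive (g j) x = 0.
  by move=> xa; exact: (primitive_left (g0' j) xa).
have prim_right j x : b <= x -> primitive (g j) x = primitive (g j) b.
  by move=> bx; rewrite (primitive_right (g0' j) bx) (primitive_right (g0' j) (lexx b)).
have prim_dist j x y : `|primitive (g j) x - primitive (g j) y| <= L * `|x - y|.
  exact: (primitive_dist (mg j) (gL j) (g0' j)).
have prim_le j x : `|primitive (g j) x| <= L * (b - a + 1).
  have bnd y : y <= b -> `|primitive (g j) y| <= L * (b - a + 1).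
    move=> yb; have [ya|ay] := ltP y a.
      by rewrite prim_left// normr0 mulr_ge0// addr_ge0// ltW.
    have a1 : a - 1 < a by lra.
    have := prim_dist j y (a - 1); rewrite (prim_left _ _ a1) subr0 => /le_trans; apply.
    by rewrite ler_wpM2l// ger0_norm; lra.
  have [xb|bx] := leP x b; first exact: bnd.
  by rewrite prim_right ?(ltW bx)//; exact: bnd.
have [A UA hA] := ultra_uniform_cauchy UU ab prim_dist prim_le m0.
exists A => // i j Ai Aj.
(* Uniform closeness on [[a, b]] is closeness on the line: the primitives vanish to the left of [a]
   and are constant to the right of [b]. *)
have hm x : `|primitive (fun z => g i z - g j z) x| <= m.
  rewrite primB; have [xa|ax] := ltP x a.
    by rewrite !prim_left// subrr normr0 ltW.
  have [xb|bx] := leP x b; first by apply: hA => //; rewrite in_itv/= ax.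
  by rewrite !(prim_right _ _ (ltW bx)); apply: hA => //; rewrite in_itv/= lexx ltW.
have ac : a < a + t by rewrite ltrDl.
have cd : a + t < b - t by lra.
have db : b - t < b by lra.
rewrite -(@ler_pXn2r _ 2)// ?nnegrE ?nrm_ge0 ?(ltW e0)//.
have -> : nrm Omega (f i \- f j) = nrm Omega (g i \- g j).
  apply: eq_on_nrm; [exact: mO|exact: sqintB|exact: sqintB|].
  by move: (fg i) (fg j); apply: aeS2 => x h1 h2 Ox /=; rewrite h1// h2.
have := nrmB_sqr_le_BV mO ab subO clO (mg i) (mg j) (gL i) (gL j) (g0 i) (g0 j)
  (gV i) (gV j) ac cd db m0 hm.
move/le_trans; apply.
have h1 : 4 * m ^+ 2 / (b - t - (a + t)) <= m * (8 / (b - a)).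
  have -> : m * (8 / (b - a)) = 4 * m / ((b - a) / 2) by field; rewrite gt_eqF.
  apply: ler_pM; [by rewrite mulr_ge0 ?sqr_ge0| | |].
  - by rewrite invr_ge0 ltW//; lra.
  - by rewrite ler_pM2l// expr2 ler_piMl// ltW.
  - by rewrite lef_pV2 ?posrE; lra.
have h2 : (2 * L) ^+ 2 * (b - a - (b - t - (a + t))) <= e ^+ 2 / 2.
  have -> : (2 * L) ^+ 2 * (b - a - (b - t - (a + t))) = t * (16 * L ^+ 2) / 2 by field.
  rewrite ler_pM2r ?invr_gt0//; apply: le_trans tL.
  by rewrite ler_pM2l// lerDl.
have -> : e ^+ 2 = e ^+ 2 / 2 + e ^+ 2 / 2 by field.
by move: mV; rewrite mulrDr; lra.
Qed.

(** An empty or one-point interval has no interior to carry test functions, but it is null;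
    otherwise [a] and [b] are the infimum and the supremum. *)
Lemma bounded_interval_cases (Omega : set R) : is_interval Omega -> bounded_set Omega ->
  [/\ measurable Omega, (mu Omega < +oo)%E & mu Omega = 0%E \/
    exists a b, [/\ a < b, `]a, b[ `<=` Omega° & Omega `<=` `[a, b]]].
Proof.
move=> iO bO; have mO : measurable Omega by exact: is_interval_measurable.
have [lO uO] : has_lbound Omega /\ has_ubound Omega.
  have [M [_ hM]] := bO; have M1 : M < M + 1 by rewrite ltrDl.
  have h x : Omega x -> `|x| <= M + 1 by exact: hM.
  by split; [exists (- (M + 1))|exists (M + 1)] => x /h; rewrite ler_norml => /andP[].
have clO : Omega `<=` `[inf Omega, sup Omega].
  by move=> x Ox /=; rewrite in_itv/= inf_lbound// ub_le_sup.
split => //; first exact: measurable_subitv_lty clO mO.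
have [ab|ba] := ltP (inf Omega) (sup Omega); [right|left].
  exists (inf Omega), (sup Omega); split => //.
  by rewrite (interval_bounded_interior iO lO uO) => x /=; rewrite in_itv.
apply/eqP; rewrite eq_le measure_ge0 andbT.
have -> : 0%E = mu [set inf Omega] by rewrite lebesgue_measure_set1.
apply: le_measure; rewrite ?inE//.
by move=> x /clO/=; rewrite in_itv/= => /andP[h1 h2]; apply/eqP; rewrite eq_le h1 andbT (le_trans h2).
Qed.

Lemma BV_ultra_cauchy (Omega : set R) (f : nat -> R -> R) (C V e : R) :
  is_interval Omega -> bounded_set Omega ->
  (forall j, sqint Omega (f j)) -> (forall j, nrm Omega (f j) <= C) ->
  (forall j, (BVseminorm Omega (f j) <= V%:E)%E) -> 0 < e ->
  exists2 A, U A & forall i j, A i -> A j -> nrm Omega (f i \- f j) <= e.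
Proof.
move=> iO bO sf fC fV e0.
have [mO Ofin] := bounded_interval_cases iO bO; case=> [muO0|[a [b [ab subO clO]]]]; last first.
  exact: (BV_ultra_cauchy_itv mO ab subO clO sf fC fV e0).
exists setT; first exact: filterT.
move=> i j _ _; rewrite /nrm /ip /Rintegral null_set_integral ?sqrtr0 ?ltW//.
by apply/measurable_EFinP; apply: measurable_funM; exact: (sqintB mO (sf i) (sf j)).1.
Qed.

(** Since [U] refines the filter at infinity, a finite intersection of sets [E i] has elements
    beyond any index; [s j] is picked in the first [j + 1] of them, past the previous choice. *)
Lemma ultra_subseq (E : nat -> set nat) : (\oo `<=` U) -> (forall m, U (E m)) ->
  exists2 s : nat -> nat, {homo s : i j / (i < j)%N} &
    forall m j, (m <= j)%N -> E m (s j).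
Proof.
move=> ooU UE.
have step mN : exists k, (mN.2 < k)%N /\ forall i, (i <= mN.1)%N -> E i k.
  case: mN => m N; have : U ([set k | (N < k)%N] `&` [set k | forall i : 'I_m.+1, E i k]).
    apply: filterI; first by apply: ooU; exists N.+1.
    by apply: filter_forall => i; exact: UE.
  move=> /filter_ex[k [/= Nk hk]]; exists k; split => // i im.
  by have := hk (Ordinal (im : (i < m.+1)%N)).
have [g hg] := choice step.
pose s := fix s j := if j is i.+1 then g (j, s i) else g (0%N, 0%N).
exists s.
  apply: homo_ltn; first exact: ltn_trans.
  by move=> j; exact: (hg (j.+1, s j)).1.
by move=> m [|j] mj; [exact: (hg (0%N, 0%N)).2|exact: (hg (j.+1, s j)).2].
Qed.

End BVUltraCauchy.

(** * Translation of the $L^p$ norms into real integrals *)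

Section LpSqint.
Context {R : realType}.
Local Notation mu := (@lebesgue_measure R).
Variable Omega : set R.
Hypothesis mO : measurable Omega.
Implicit Types (f g : R -> R) (p : R).

Lemma LpnormE p f : p != 0 -> Lpnorm Omega p%:E f =
  ((\int[mu]_(x in Omega) (`|f x| `^ p)%:E) `^ p^-1)%E.
Proof.
move=> p0; rewrite /Lpnorm unlock /Lnorm; congr (_ `^ _)%E.
rewrite [RHS]integral_mkcond; apply: eq_integral => x _ /=.
rewrite !patchE; case: ifPn => _ //=.
by rewrite ?poweR_EFin normr0 powR0.
Qed.

Lemma LpP p f : 1 <= p -> Lp Omega p%:E f <->
  measurable_fun Omega f /\ (\int[mu]_(x in Omega) (`|f x| `^ p)%:E < +oo)%E.
Proof.
move=> p1; have p0 : p != 0 by rewrite gt_eqF// (lt_le_trans ltr01).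
have LE : (finite_norm mu p%:E (f \_ Omega) <->
    (\int[mu]_(x in Omega) (`|f x| `^ p)%:E < +oo)%E).
  have -> : finite_norm mu p%:E (f \_ Omega) = (Lpnorm Omega p%:E f < +oo)%E by [].
  rewrite LpnormE//; split => [/(poweR_lty p)|/poweR_lty]; last exact.
  rewrite -poweRrM mulVf// poweRe1//; apply: integral_ge0 => x _.
  by rewrite lee_fin powR_ge0.
rewrite /Lp /= inE; split=> [/andP[]|[mf If]].
  by rewrite !inE/= => /(measurable_restrictT _ mO) mf /LE.
by apply/andP; rewrite !inE/=; split; [exact/(measurable_restrictT _ mO)|exact/LE].
Qed.

Lemma powR2 (x : R) : `|x| `^ 2 = x ^+ 2.
Proof. by rewrite powR_mulrn// real_normK// num_real. Qed.

Lemma Lp2P f : Lp Omega 2%:E f <-> sqint Omega f.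
Proof.
rewrite LpP ?ler1n//.
have -> : (\int[mu]_(x in Omega) (`|f x| `^ 2)%:E = \int[mu]_(x in Omega) (f x ^+ 2)%:E)%E.
  by apply: eq_integral => x _; rewrite powR2.
split=> -[mf If]; split=> //.
  apply/integrableP; split; first by apply/measurable_EFinP; exact: measurable_funX.
  apply: le_lt_trans If; rewrite le_eqVlt; apply/orP; left; apply/eqP.
  by apply: eq_integral => x _ /=; rewrite ger0_norm ?sqr_ge0.
move/integrableP : If => [_]; apply: le_lt_trans.
rewrite le_eqVlt; apply/orP; left; apply/eqP.
by apply: eq_integral => x _ /=; rewrite ger0_norm ?sqr_ge0.
Qed.

Lemma Lpnorm2E f : sqint Omega f -> Lpnorm Omega 2%:E f = (nrm Omega f)%:E.
Proof.
move=> sf; rewrite LpnormE// /nrm /ip /Rintegral.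
have -> : (\int[mu]_(x in Omega) (`|f x| `^ 2)%:E = \int[mu]_(x in Omega) (f x * f x)%:E)%E.
  by apply: eq_integral => x _; rewrite powR2 expr2.
rewrite -{1}[X in (X `^ _)%E]fineK; last first.
  exact: (@integrable_fin_num _ _ _ mu Omega mO _ (sqint_mul mO sf sf)).
by rewrite poweR_EFin -powR12_sqrt// -/(Rintegral mu Omega (fun x => f x * f x)) ip_ge0.
Qed.

Lemma Lp1P f : Lp Omega 1%E f <-> mu.-integrable Omega (EFin \o f).
Proof.
have E : (\int[mu]_(x in Omega) (`|f x| `^ 1)%:E = \int[mu]_(x in Omega) `|(f x)%:E|)%E.
  by apply: eq_integral => x _; rewrite powRr1.
split=> [/(LpP f (lexx 1))[mf If]|/integrableP[mf If]].
  by apply/integrableP; split; [exact/measurable_EFinP|move: If; rewrite E].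
by apply/(LpP f (lexx 1)); rewrite E; split => //; exact/measurable_EFinP.
Qed.

End LpSqint.

(** * The $H^1$ norm and the variation under strong $L^2$ limits *)

Section H1BV.
Context {R : realType}.
Local Notation mu := (@lebesgue_measure R).
Variable Omega : set R.
Hypothesis mO : measurable Omega.
Hypothesis bO : bounded_set Omega.
Hypothesis Ofin : (mu Omega < +oo)%E.
Implicit Types (f g h u psi : R -> R).

Lemma sqint_continuous f : continuous f -> sqint Omega f.
Proof.
move=> cf; have [M [_ hM]] := bO; have M1 : M < M + 1 by rewrite ltrDl.
have OM : Omega `<=` `[- (M + 1), M + 1].
  have h x : Omega x -> `|x| <= M + 1 by exact: hM.
  by move=> x /h; rewrite /= in_itv/= ler_norml.
have /compact_bounded[N [_ hN]] : compact (f @` `[- (M + 1), M + 1]).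
  by apply: continuous_compact; [exact: continuous_subspaceT|exact: segment_compact].
apply: (@sqint_bounded _ _ mO Ofin _ (N + 1)).
  by apply: measurable_funTS; exact: continuous_measurable_fun.
move=> x /OM xM; apply: (hN (N + 1)); first by rewrite ltrDl.
by exists x.
Qed.

Lemma sqint_test psi : test_function Omega psi ->
  sqint Omega psi /\ sqint Omega (derive1 psi).
Proof.
move=> [dpsi cpsi _]; split; last exact: sqint_continuous.
apply: sqint_continuous => x; apply: differentiable_continuous.
exact/derivable1_diffP.
Qed.

Lemma nrm_le_sqrt_measure f : measurable_fun Omega f -> (forall x, `|f x| <= 1) ->
  nrm Omega f <= Num.sqrt (fine (mu Omega)).
Proof.
move=> mf f1; have sf : sqint Omega f by apply: (@sqint_bounded _ _ mO Ofin _ 1).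
rewrite /nrm ler_sqrt ?fine_ge0// /ip -[leRHS]mul1r -(@Rintegral_cst _ _ _ mu _ mO).
apply: (@le_Rintegral _ _ _ mu _ _ _ mO).
- exact: sqint_mul.
- apply: (@measurable_bounded_integrable _ _ _ mu) => //.
  by exists `|1 : R|; split; [exact: num_real|move=> z /ltW + y _; exact].
- move=> x _; rewrite -expr2 -(real_normK (num_real (f x))).
  by rewrite expr_le1.
Qed.

Lemma weak_derivativeP f g : weak_derivative Omega f g <->
  forall psi, test_function Omega psi -> ip Omega f (derive1 psi) = - ip Omega g psi.
Proof. by []. Qed.

(** A strict bound on the infimum exhibits a weak derivative, without any appeal to its
    uniqueness. *)
Lemma H1norm_lt f (h : R) : (H1norm Omega f < h%:E)%E ->
  exists g, [/\ sqint Omega f, sqint Omega g, weak_derivative Omega f g &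
    ip Omega f f + ip Omega g g < h ^+ 2].
Proof.
move=> /ereal_inf_lt[_ [g [/(Lp2P mO) sf /(Lp2P mO) sg wfg] <-]].
rewrite !(Lpnorm2E mO)// -!EFin_expe -EFinD poweR_EFin lte_fin !sqr_nrm => lth.
exists g; split=> //; move: lth; rewrite powR12_sqrt ?addr_ge0 ?ip_ge0// => lth.
rewrite -(sqr_sqrtr (addr_ge0 (ip_ge0 Omega f) (ip_ge0 Omega g))).
by rewrite ltrXn2r// nnegrE ?sqrtr_ge0// (le_trans _ (ltW lth))// sqrtr_ge0.
Qed.

Lemma H1norm_le f g : sqint Omega f -> sqint Omega g -> weak_derivative Omega f g ->
  (H1norm Omega f <= (Num.sqrt (ip Omega f f + ip Omega g g))%:E)%E.
Proof.
move=> sf sg wfg; apply: ereal_inf_lbound; exists g.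
  by split; [exact/(Lp2P mO)|exact/(Lp2P mO)|].
rewrite !(Lpnorm2E mO)// -!EFin_expe -EFinD poweR_EFin !sqr_nrm.
by rewrite powR12_sqrt ?addr_ge0 ?ip_ge0.
Qed.

Lemma H1norm_ge0 f : (0 <= H1norm Omega f)%E.
Proof. by apply: le_ereal_inf_tmp => _ [g _ <-]; exact: poweR_ge0. Qed.

(** Moving the derivative onto [f] and applying Cauchy-Schwarz with $|\psi| \le 1$; this brings BV
    compactness to bear on the kernels. *)
Lemma BVseminorm_le_H1norm f (h : R) : (H1norm Omega f < h%:E)%E ->
  (BVseminorm Omega f <= (h * Num.sqrt (fine (mu Omega)))%:E)%E.
Proof.
move=> fh; have h0 : 0 <= h.
  by rewrite -lee_fin; exact: le_trans (H1norm_ge0 f) (ltW fh).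
have [g [sf sg wfg fgh]] := H1norm_lt fh.
apply: ge_ereal_sup => _ [psi [tpsi psi1] <-].
have [spsi _] := sqint_test tpsi.
rewrite (wfg _ tpsi) lee_fin -/(ip Omega g psi).
apply: le_trans (ler_norm _) _; rewrite normrN.
apply: le_trans (cauchy_schwarz mO sg spsi) _.
apply: ler_pM; [exact: sqrtr_ge0|exact: sqrtr_ge0| |exact: (nrm_le_sqrt_measure spsi.1)].
rewrite -(@ler_pXn2r _ 2)// ?nnegrE ?sqrtr_ge0// sqr_sqrtr ?ip_ge0//.
by have := ip_ge0 Omega f; lra.
Qed.

Lemma eq_on_H1norm f g : sqint Omega f -> sqint Omega g -> eq_on Omega f g ->
  H1norm Omega f = H1norm Omega g.
Proof.
move=> sf sg fg; congr ereal_inf; apply/seteqP.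
have E psi : test_function Omega psi ->
    ip Omega f (derive1 psi) = ip Omega g (derive1 psi).
  move=> /sqint_test[_ sp]; apply: eq_on_ip => //.
  exact: ae_eq_refl.
have N : Lpnorm Omega 2%:E f = Lpnorm Omega 2%:E g.
  by rewrite !(Lpnorm2E mO)//; congr EFin; exact: eq_on_nrm.
split => _ [h [_ lh wh] <-]; exists h; rewrite ?N//; split => //; try exact/(Lp2P mO).
  by apply/weak_derivativeP => psi tpsi; rewrite -E//; exact: (wh _ tpsi).
by apply/weak_derivativeP => psi tpsi; rewrite E//; exact: (wh _ tpsi).
Qed.

(* Only exponential rates are used: they hold along the subsequences
   extracted below, and spare limit computations. *)
Lemma BVseminorm_closed (f : nat -> R -> R) g (v : nat -> R) (c : R) :
  (forall j, sqint Omega (f j)) -> sqint Omega g ->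
  (forall j, nrm Omega (f j \- g) <= 2 * 2^-1 ^+ j) ->
  (forall j, (BVseminorm Omega (f j) <= (v j)%:E)%E) ->
  (forall j, v j <= c + 2^-1 ^+ j) ->
  (BVseminorm Omega g <= c%:E)%E.
Proof.
move=> sf sg fg fv vc; apply: ge_ereal_sup => _ [psi [tpsi psi1] <-].
have [spsi sdpsi] := sqint_test tpsi.
rewrite lee_fin -/(ip Omega g (derive1 psi)).
apply: (@le_half_pow _ (1 + 2 * nrm Omega (derive1 psi))) => j.
have h1 : ip Omega (f j) (derive1 psi) <= v j.
  by rewrite -lee_fin; apply: le_trans (fv j); apply: ereal_sup_ubound; exists psi.
have h2 : ip Omega g (derive1 psi) - ip Omega (f j) (derive1 psi) <=
    2 * 2^-1 ^+ j * nrm Omega (derive1 psi).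
  rewrite -(ipBl mO)//; apply: le_trans (ler_norm _) _.
  apply: le_trans (cauchy_schwarz mO (sqintB mO sg (sf j)) sdpsi) _.
  by rewrite ler_wpM2r ?sqrtr_ge0// -/(nrm _ _) nrmB_sym.
by have := vc j; move: h1 h2; lra.
Qed.

(** The sets [S m] of weak derivatives of functions close to [g] are stable under midpoints and
    shrink with [m]; a limit of nearly minimal elements is a weak derivative of [g] with the right
    norm. *)
Lemma H1norm_closed (f : nat -> R -> R) g (v : nat -> R) (c : R) :
  (forall j, sqint Omega (f j)) -> sqint Omega g -> 0 <= c ->
  (forall j, nrm Omega (f j \- g) <= 2 * 2^-1 ^+ j) ->
  (forall j, (H1norm Omega (f j) <= (v j)%:E)%E) ->
  (forall j, v j <= c + 2^-1 ^+ j) ->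
  (H1norm Omega g <= c%:E)%E.
Proof.
move=> sf sg c0 fg fv vc.
pose S m := [set w | sqint Omega w /\ exists u, [/\ sqint Omega u,
  nrm Omega (u \- g) <= 2 * 2^-1 ^+ m & weak_derivative Omega u w]].
have [||||w [sw wc Sw]] := @midpoint_limit _ Omega mO Ofin S (c ^+ 2 - ip Omega g g).
- by move=> m w [].
- move=> m w [sw [u [su ug wuw]]]; split => //; exists u; split => //.
  apply: le_trans ug _; rewrite exprS ler_pM2l// ler_piMl ?exprn_ge0 ?invr_ge0//.
  by rewrite invf_le1// ler1n.
- move=> m w1 w2 [sw1 [u1 [su1 ug1 wu1]]] [sw2 [u2 [su2 ug2 wu2]]].
  have mid (p q : R -> R) : (fun x => 2^-1 * (p x + q x)) = (fun x => 2^-1 * (p \+ q) x) by [].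
  split; first by apply: sqintZ => //; exact: sqintD.
  exists (fun x => 2^-1 * (u1 x + u2 x)); split.
  + by apply: sqintZ => //; exact: sqintD.
  + have -> : nrm Omega ((fun x => 2^-1 * (u1 x + u2 x)) \- g) =
      nrm Omega (fun x => 2^-1 * ((u1 \- g) \+ (u2 \- g)) x).
      by apply: eq_nrm => x /=; field.
    have s1 := sqintB mO su1 sg; have s2 := sqintB mO su2 sg.
    rewrite (nrmZ mO)//; last exact: sqintD.
    rewrite ger0_norm ?invr_ge0//; have := nrm_triangle mO s1 s2; lra.
  + apply/weak_derivativeP => psi tpsi; have [sp sdp] := sqint_test tpsi.
    rewrite !mid !(ipZl mO)//; try exact: sqintD.
    have e1 : ip Omega u1 (derive1 psi) = - ip Omega w1 psi := wu1 _ tpsi.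
    have e2 : ip Omega u2 (derive1 psi) = - ip Omega w2 psi := wu2 _ tpsi.
    by rewrite !(ipDl mO)// e1 e2; ring.
- move=> m e e0.
  (* The part [4 * c + 4] comes from squaring $c + 2 \cdot 2^{-j}$, the part with [nrm Omega g] from
     exchanging the norm of [f j] for that of [g]; 8 is slack. *)
  pose A := 4 * c + 4 + 4 * nrm Omega g + 8.
  have [k hk] := half_pow_lt A e0.
  pose j := maxn m k.
  have q1 : (2^-1 : R) ^+ j <= 2^-1 ^+ k.
    by rewrite ler_wiXn2l ?invr_ge0// ?leq_maxr// invf_le1// ler1n.
  have q2 : (2^-1 : R) ^+ j <= 2^-1 ^+ m.
    by rewrite ler_wiXn2l ?invr_ge0// ?leq_maxl// invf_le1// ler1n.
  have q0 : 0 < (2^-1 : R) ^+ j by rewrite exprn_gt0 ?invr_gt0.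
  have q01 : (2^-1 : R) ^+ j <= 1 by rewrite exprn_ile1 ?invr_ge0// invf_le1// ler1n.
  (* The doubled power makes the bound strict, as choosing a derivative requires. *)
  have lth : (H1norm Omega (f j) < (c + 2 * 2^-1 ^+ j)%:E)%E.
    apply: le_lt_trans (fv j) _; rewrite lte_fin; apply: le_lt_trans (vc j) _.
    by move: q0; lra.
  have [w [sfj sw wfw ltc]] := H1norm_lt lth.
  exists w.
    split => //; exists (f j); split => //; apply: le_trans (fg j) _.
    by rewrite ler_pM2l.
  have h1 := nrm_le mO sg sfj; rewrite nrmB_sym in h1.
  have h2 := fg j.
  have h3 : nrm Omega g ^+ 2 <= ip Omega (f j) (f j) + 4 * 2^-1 ^+ j * nrm Omega g.
    rewrite -sqr_nrm; set x := nrm Omega g in h1 *; set y := nrm Omega (f j) in h1 *.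
    have x0 : 0 <= x by exact: nrm_ge0.
    have y0 : 0 <= y by exact: nrm_ge0.
    set z := 2^-1 ^+ j in h2 q0 *.
    have h4 : x <= y + 2 * z by move: h1 h2; lra.
    have : (x - 2 * z) * x <= y * x by apply: ler_wpM2r => //; lra.
    rewrite !expr2; have := sqr_ge0 (x - y); rewrite expr2.
    have : 0 <= z * x by rewrite mulr_ge0// ltW.
    nra.
  rewrite sqr_nrm in h3.
  have h5 : (c + 2 * 2^-1 ^+ j) ^+ 2 <= c ^+ 2 + (4 * c + 4) * 2^-1 ^+ j.
    by move: q0 q01; set z := _ ^+ j; rewrite !expr2; nra.
  have h6 : A * 2^-1 ^+ j < e.
    apply: le_lt_trans hk; rewrite ler_wpM2l// /A !addr_ge0// mulr_ge0//.
    exact: nrm_ge0.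
  move: ltc h3 h5 h6; rewrite /A.
  by set z := 2^-1 ^+ j in q0 *; set x := nrm Omega g; lra.
have wgw : weak_derivative Omega g w.
  apply/weak_derivativeP => psi tpsi; have [sp sdp] := sqint_test tpsi.
  apply/eqP; rewrite -subr_eq0 opprK -normr_le0.
  apply: (@le_half_pow _ (2 * nrm Omega (derive1 psi) + nrm Omega psi)) => m.
  have q0 : 0 < (2^-1 : R) ^+ m by rewrite exprn_gt0 ?invr_gt0.
  have [p [sp' [u [su ug wup]]] pw] := Sw m _ q0.
  (* Subtracting the identity for the pair [(u, p)], which holds exactly, leaves only small
     differences. *)
  have -> : ip Omega g (derive1 psi) + ip Omega w psi =
      ip Omega (g \- u) (derive1 psi) + ip Omega (w \- p) psi.
    have e1 : ip Omega u (derive1 psi) = - ip Omega p psi := wup _ tpsi.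
    by rewrite !(ipBl mO)// e1; ring.
  apply: le_trans (ler_normD _ _) _; rewrite add0r mulrDl; apply: lerD.
    apply: le_trans (cauchy_schwarz mO (sqintB mO sg su) sdp) _.
    by rewrite mulrAC ler_wpM2r ?sqrtr_ge0// -/(nrm _ _) nrmB_sym.
  apply: le_trans (cauchy_schwarz mO (sqintB mO sw sp') sp) _.
  by rewrite mulrC ler_wpM2l ?sqrtr_ge0// -/(nrm _ _) nrmB_sym.
apply: le_trans (H1norm_le sg sw wgw) _; rewrite lee_fin -(@ler_pXn2r _ 2)// ?nnegrE ?sqrtr_ge0//.
by rewrite sqr_sqrtr ?addr_ge0 ?ip_ge0//; lra.
Qed.

End H1BV.

(** * Convolution of square integrable functions on [Omega] *)

Section Convolution.
Context {R : realType}.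
Local Notation mu := (@lebesgue_measure R).

Let reflect (x : R) : measurableTypeR R -> measurableTypeR R := fun t : R => x - t.

Let mreflect x : measurable_fun [set: measurableTypeR R] (reflect x).
Proof. exact: (@measurable_funB _ _ R setT (cst x) id). Qed.

(** Uniqueness of Lebesgue measure: the image measure agrees with it on half-open intervals, up to
    exchanging the open and the closed end. *)
Lemma lebesgue_measure_reflect (x : R) (A : set R) : measurable A ->
  mu ((fun t => x - t) @^-1` A) = mu A.
Proof.
move=> mA; pose mixin := isMeasurableFun.Build _ _ _ _ _ (mreflect x).
pose phi : {mfun measurableTypeR R >-> measurableTypeR R} := HB.pack (reflect x) mixin.
have -> : mu ((fun t => x - t) @^-1` A) = pushforward mu phi A by [].
apply/esym; apply: (@lebesgue_measure_unique R (pushforward mu phi)) => // _ [[a b] _ <-]/=.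
have -> : pushforward mu phi `]a, b] = mu `[x - b, x - a[%classic.
  congr (mu _); apply/seteqP; split => t /=; rewrite /phi/= /reflect !in_itv/= => /andP[];
    by move=> h1 h2; apply/andP; split; lra.
rewrite !lebesgue_measure_itv/= !lte_fin -!EFinB.
have -> : (x - b < x - a) = (a < b) by rewrite ltrD2l ltrN2.
by case: ifP => // _; congr EFin; ring.
Qed.

Lemma integral_reflect (x : R) (f : R -> \bar R) : measurable_fun setT f ->
  (forall t, (0 <= f t)%E) -> (\int[mu]_t f (x - t)%R = \int[mu]_t f t)%E.
Proof.
move=> mf f0; have := @ge0_integral_pushforward _ _ _ _ R _ (mreflect x) mu setT f
  measurableT mf (fun y _ => f0 y).
rewrite preimage_setT => <-.
by apply: eq_measure_integral => A mA _; exact: lebesgue_measure_reflect.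
Qed.

Variable Omega : set R.
Hypothesis mO : measurable Omega.
Implicit Types (K u : R -> R).

Lemma sqint_restrict K : sqint Omega K -> sqint setT (K \_ Omega).
Proof.
move=> [mK K2]; split; first exact/(measurable_restrictT _ mO).
have := (@integrable_mkcond _ _ _ mu _ _ mO).1 K2; apply: eq_integrable => // x _ /=.
by rewrite !patchE; case: ifP => //= _; rewrite expr0n.
Qed.

Lemma nrm_restrict K : nrm setT (K \_ Omega) = nrm Omega K.
Proof.
congr Num.sqrt; rewrite /ip [RHS]Rintegral_mkcond; apply: eq_Rintegral => x _.
by rewrite !patchE; case: ifP => // _; rewrite mulr0.
Qed.

Lemma sqint_reflect f (x : R) : sqint setT f ->
  sqint setT (fun t => f (x - t)) /\ nrm setT (fun t => f (x - t)) = nrm setT f.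
Proof.
move=> [mf f2].
have mfx : measurable_fun setT (fun t : R => f (x - t)).
  by apply: (measurableT_comp mf); exact: measurable_funB.
have E : (\int[mu]_t (f (x - t) ^+ 2)%:E = \int[mu]_t (f t ^+ 2)%:E)%E.
  apply: (@integral_reflect x (fun t => (f t ^+ 2)%:E)).
    by apply/measurable_EFinP; exact: measurable_funX.
  by move=> t; rewrite lee_fin sqr_ge0.
have absE (g : R -> R) : (\int[mu]_t `|(EFin \o (fun z => g z ^+ 2)%R) t| =
    \int[mu]_t (g t ^+ 2)%:E)%E.
  by apply: eq_integral => t _ /=; rewrite ger0_norm ?sqr_ge0.
split.
  split => //; apply/integrableP; split.
    by apply/measurable_EFinP; exact: measurable_funX.
  by move/integrableP : f2 => [_]; rewrite !absE E.
congr Num.sqrt; congr fine.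
exact: E.
Qed.

Lemma convolution_le K u x : sqint Omega K -> sqint Omega u ->
  `|convolution Omega K u x| <= nrm Omega K * nrm Omega u.
Proof.
move=> /sqint_restrict sK /sqint_restrict su.
have [sKx nKx] := sqint_reflect x sK.
have := cauchy_schwarz measurableT sKx su.
by rewrite -!/(nrm _ _) nKx !nrm_restrict.
Qed.

Lemma convolution_integrable K u x : sqint Omega K -> sqint Omega u ->
  mu.-integrable setT (EFin \o (fun t => (K \_ Omega) (x - t) * (u \_ Omega) t)).
Proof.
move=> /sqint_restrict sK /sqint_restrict su.
have [sKx _] := sqint_reflect x sK.
exact: (sqint_mul measurableT sKx su).
Qed.

Lemma convolutionBl K K' u x : sqint Omega K -> sqint Omega K' -> sqint Omega u ->
  convolution Omega (K \- K') u x = convolution Omega K u x - convolution Omega K' u x.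
Proof.
move=> sK sK' su; rewrite /convolution -(@RintegralB _ _ _ mu)//;
  try exact: convolution_integrable.
apply: eq_Rintegral => t _; rewrite !patchE; case: ifP => _; first by rewrite mulrBl.
by rewrite !mul0r subrr.
Qed.

Lemma convolutionBr K u u' x : sqint Omega K -> sqint Omega u -> sqint Omega u' ->
  convolution Omega K (u \- u') x = convolution Omega K u x - convolution Omega K u' x.
Proof.
move=> sK su su'; rewrite /convolution -(@RintegralB _ _ _ mu)//;
  try exact: convolution_integrable.
apply: eq_Rintegral => t _; rewrite -mulrBr; congr (_ * _).
by rewrite !patchE; case: ifP => _ //; rewrite subrr.
Qed.

(** Tonelli's theorem for the positive and the negative part of the joint integrand separately. *)
Lemma measurable_convolution K u : sqint Omega K -> sqint Omega u ->
  measurable_fun setT (convolution Omega K u).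
Proof.
move=> /sqint_restrict[mK _] /sqint_restrict[mu' _].
pose f (z : measurableTypeR R * measurableTypeR R) : \bar R :=
  ((K \_ Omega) (z.1 - z.2) * (u \_ Omega) z.2)%:E.
have mf : measurable_fun setT f.
  apply/measurable_EFinP; apply: measurable_funM.
    by apply: (measurableT_comp mK); apply: measurable_funB.
  exact: (measurableT_comp mu' measurable_snd).
have -> : convolution Omega K u =
    fine \o (fun x => (\int[mu]_t f^\+%E (x, t) - \int[mu]_t f^\-%E (x, t))%E).
  apply/funext => x /=; congr fine; rewrite [LHS]integralE.
  by congr (_ - _)%E; apply: eq_integral => t _; rewrite ?funeposE ?funenegE.
apply: measurableT_comp => //.
apply: emeasurable_funB.
  by apply: measurable_fun_fubini_tonelli_F => //; exact: measurable_funepos.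
by apply: measurable_fun_fubini_tonelli_F => //; exact: measurable_funeneg.
Qed.

Hypothesis Ofin : (mu Omega < +oo)%E.

Lemma sqint_convolution K u : sqint Omega K -> sqint Omega u ->
  sqint Omega (convolution Omega K u).
Proof.
move=> sK su; apply: (@sqint_bounded _ _ mO Ofin _ (nrm Omega K * nrm Omega u)).
  by apply: measurable_funTS; exact: measurable_convolution.
by move=> x _; exact: convolution_le.
Qed.

Lemma nrm_le_sup f (c : R) : sqint Omega f -> (forall x, `|f x| <= c) ->
  nrm Omega f <= c * Num.sqrt (fine (mu Omega)).
Proof.
move=> sf fc; have c0 : 0 <= c by exact: le_trans (fc 0).
rewrite -(ger0_norm c0) -sqrtr_sqr -sqrtrM ?sqr_ge0// ler_sqrt; last first.
  by rewrite mulr_ge0 ?sqr_ge0// fine_ge0.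
rewrite -(@Rintegral_cst _ _ _ mu _ mO); apply: (@le_Rintegral _ _ _ mu _ _ _ mO).
- exact: sqint_mul.
- apply: (@measurable_bounded_integrable _ _ _ mu) => //.
  by exists `|c ^+ 2|; split; [exact: num_real|move=> z /ltW + y _; exact].
- move=> x _; rewrite -expr2 -(real_normK (num_real (f x))).
  by rewrite lerXn2r// nnegrE.
Qed.

(** Bilinearity: the difference is the convolution of [K \- K'] with [u] plus that of [K'] with
    [u \- u'], each bounded pointwise by [convolution_le]. *)
Lemma nrm_convolutionB K K' u u' : sqint Omega K -> sqint Omega K' ->
  sqint Omega u -> sqint Omega u' ->
  nrm Omega (convolution Omega K u \- convolution Omega K' u') <=
  (nrm Omega (K \- K') * nrm Omega u + nrm Omega K' * nrm Omega (u \- u'))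
    * Num.sqrt (fine (mu Omega)).
Proof.
move=> sK sK' su su'; apply: nrm_le_sup.
  by apply: (sqintB mO); exact: sqint_convolution.
move=> x /=.
have -> : convolution Omega K u x - convolution Omega K' u' x =
  convolution Omega (K \- K') u x + convolution Omega K' (u \- u') x.
  by rewrite convolutionBl// convolutionBr//; ring.
apply: le_trans (ler_normD _ _) _; apply: lerD; apply: convolution_le => //.
  exact: sqintB.
exact: sqintB.
Qed.

Lemma eq_on_convolution K u u' : sqint Omega K -> sqint Omega u -> sqint Omega u' ->
  eq_on Omega u u' -> convolution Omega K u = convolution Omega K u'.
Proof.
move=> sK su su' uu'; apply/funext => x; apply/eqP; rewrite -subr_eq0 -normr_le0.
rewrite -convolutionBr//; apply: le_trans (convolution_le x sK (sqintB mO su su')) _.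
suff -> : nrm Omega (u \- u') = 0 by rewrite mulr0.
have s0 := sqint0 mO.
have -> : nrm Omega (u \- u') = nrm Omega (cst 0).
  apply: eq_on_nrm => //; first exact: sqintB.
  by move: uu'; apply: aeS => t h Ot /=; rewrite h// subrr.
by rewrite /nrm ler0_sqrtr// /ip; under eq_Rintegral do rewrite mulr0;
  rewrite (@Rintegral_cst _ _ _ mu _ mO) mul0r.
Qed.

End Convolution.

(** * The Gaussian kernel lies in $H^1$ *)

Section WeakDerivativeC1.
Context {R : realType}.
Local Notation mu := (@lebesgue_measure R).
Variable Omega : set R.
Hypothesis mO : measurable Omega.
Hypothesis bO : bounded_set Omega.
Hypothesis Ofin : (mu Omega < +oo)%E.

(** The product [p * psi] vanishes off a compact subset of the interior, so its derivative
    integrates to 0 over a large segment, hence over [Omega]. *)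
Lemma weak_derivative_C1 (p dp : R -> R) : (forall x : R, is_derive x 1 p (dp x)) ->
  continuous dp -> weak_derivative Omega p dp.
Proof.
move=> dpE cdp psi tpsi; have [spsi sdpsi] := sqint_test mO bO Ofin tpsi.
have [dpsi cdpsi [A [cA AO] psi0]] := tpsi.
have derivable_continuous (f : R -> R) : (forall x : R, derivable f x 1) -> continuous f.
  by move=> df x; apply: differentiable_continuous; exact/derivable1_diffP.
have cp : continuous p by apply: derivable_continuous => x; case: (dpE x).
have cpsi : continuous psi by exact: derivable_continuous.
have [sp sdp] : sqint Omega p /\ sqint Omega dp.
  by split; exact: (sqint_continuous mO bO Ofin).
have dpsi0 x : ~ A x -> derive1 psi x = 0.
  move=> nAx; rewrite derive1E.
  have oA : open (~` A) by apply: closed_openC; exact: compact_closed.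
  have -> : 'D_1 psi x = 'D_1 (cst 0 : R -> R) x; last exact: derive_cst.
  apply: (@near_eq_derive _ _ _ psi (cst 0) x 1); have := open_nbhs_nbhs (conj oA nAx).
  by apply: filterS => z /psi0.
have [M [_ hM]] := bO; have M1 : M < M + 1 by rewrite ltrDl.
have OM x : Omega x -> `|x| <= M + 1 by exact: hM.
(* Points of [Omega] have modulus at most [M + 1 < N], so the product vanishes at both ends; the 1
   makes the segment nondegenerate. *)
pose N := Num.max (M + 2) 1.
have N0 : 0 < N by rewrite lt_max ltr01 orbT.
have NM : M + 2 <= N by rewrite le_max lexx.
pose q x := p x * psi x.
pose dq x := p x * derive1 psi x + dp x * psi x.
have dqE (x : R) : is_derive x 1 q (dq x).
  have dpsix : is_derive x 1 psi (derive1 psi x).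
    by rewrite derive1E; exact: derivableP.
  have e : p x *: derive1 psi x + psi x *: dp x = dq x by rewrite /dq [_ *: dp x]mulrC.
  exact: (is_derive_eq (is_deriveM (dpE x) dpsix) e).
have dq1 : derive1 q = dq.
  by apply/funext => x; rewrite derive1E; case: (dqE x).
have cq : continuous q by apply: derivable_continuous => x; case: (dqE x).
have cdq : continuous dq.
  by move=> x; apply: cvgD; apply: cvgM; [exact: cp|exact: cdpsi|exact: cdp|exact: cpsi].
have out x : ~ Omega x -> q x = 0 /\ dq x = 0.
  move=> nOx; have nAx : ~ A x by move/AO/interior_subset.
  by rewrite /q /dq psi0// dpsi0// !mulr0 addr0.
have ON : Omega `<=` `[- N, N].
  by move=> x /OM; rewrite /= in_itv/= -ler_norml => h; apply: le_trans NM; lra.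
have qN x : N <= `|x| -> q x = 0.
  by move=> Nx; apply: (out _ _).1 => /OM h; lra.
have NN : - N < N by lra.
have I0 : \int[mu]_(x in `[- N, N]) dq x = 0.
  rewrite /Rintegral (@continuous_FTC2 _ dq q (- N) N NN).
  - by rewrite !qN ?subee// ?normrN ger0_norm// ltW.
  - exact: continuous_subspaceT.
  - split; first by move=> x _; case: (dqE x).
      by apply: cvg_at_right_filter; exact: cq.
    by apply: cvg_at_left_filter; exact: cq.
  - by move=> x _; rewrite dq1.
have I1 : \int[mu]_(x in Omega) dq x = 0.
  rewrite -I0 Rintegral_mkcond [RHS]Rintegral_mkcond; apply: eq_Rintegral => x _.
  rewrite !patchE; case: ifPn => [xO|]; case: ifPn => [xN|xN] //.
    by move: xN; rewrite inE in xO; rewrite notin_setE => /(_ (ON _ xO)).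
  by rewrite notin_setE => /out[].
apply/eqP; rewrite -subr_eq0 opprK; apply/eqP.
have i1 := sqint_mul mO sp sdpsi; have i2 := sqint_mul mO sdp spsi.
by rewrite -(@RintegralD _ _ _ mu _ _ _ mO i1 i2).
Qed.

(** On [Omega] the kernel coincides with a function that is $C^1$ on the line; the jump of the
    indicator is not seen by integrals over [Omega]. *)
Lemma gaussian_H1 (gamma sigma : R) : 0 < sigma ->
  sqint Omega (gaussian Omega gamma sigma) /\
  exists2 g, sqint Omega g & weak_derivative Omega (gaussian Omega gamma sigma) g.
Proof.
move=> s0; pose c := gamma / (sigma * Num.sqrt (2 * pi)).
pose k := - (2 * sigma ^+ 2)^-1.
pose p x := c * expR (k * x ^+ 2).
pose dp x := c * (expR (k * x ^+ 2) * (k * (2 * x))).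
have dpE (x : R) : is_derive x 1 p (dp x).
  have d2 : is_derive x 1 (fun z : R => k * z ^+ 2) (k * (2 * x)).
    have e : k *: ((2 * x ^+ 1) *: (1 : R)) = k * (2 * x).
      by rewrite expr1 /GRing.scale/= mulr1.
    exact: (is_derive_eq (@is_deriveZ _ _ _ _ k x 1 _
      (@is_deriveX _ _ id 2 x 1 1 (is_derive_id x 1))) e).
  exact: (@is_deriveZ _ _ _ _ c x 1 _
    (@is_derive1_comp _ expR _ x _ _ (is_derive_expR _) d2)).
have continuousX2 : continuous (fun z : R => k * z ^+ 2).
  by move=> x; apply: cvgMr; exact: exprn_continuous.
have cexp : continuous (fun z : R => expR (k * z ^+ 2)).
  move=> x; apply: (@cvg_comp _ _ _ (fun z => k * z ^+ 2) expR _ (nbhs (k * x ^+ 2))).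
    exact: continuousX2.
  exact: continuous_expR.
have cdp : continuous dp.
  move=> x; apply: cvgMr; apply: cvgM; first exact: cexp.
  by apply: cvgMr; apply: cvgMr.
have cp : continuous p by move=> x; apply: cvgMr; exact: cexp.
have GE x : Omega x -> gaussian Omega gamma sigma x = p x.
  move=> Ox; rewrite /gaussian indicE mem_set// mul1r /p /k -/c.
  by congr (c * expR _); rewrite mulNr mulrC.
have Gp : eq_on Omega (gaussian Omega gamma sigma) p by exact: aeW.
have sp := sqint_continuous mO bO Ofin cp; have sdp := sqint_continuous mO bO Ofin cdp.
have sG : sqint Omega (gaussian Omega gamma sigma).
  split; first by apply: eq_measurable_fun sp.1 => x /[!inE] /GE.
  by apply: eq_integrable sp.2 => // x /[!inE] Ox /=; rewrite GE.
split => //; exists dp => //; apply/weak_derivativeP => psi tpsi.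
have [spsi sdpsi] := sqint_test mO bO Ofin tpsi.
rewrite (eq_on_ip mO sG sp sdpsi sdpsi Gp (ae_eq_refl _ _ _)).
exact: (weak_derivative_C1 dpE cdp tpsi).
Qed.

End WeakDerivativeC1.

(** * Functions with values 0 and 1 *)

Section ZeroOneValued.
Context {R : realType}.
Local Notation mu := (@lebesgue_measure R).
Variable Omega : set R.
Hypothesis mO : measurable Omega.
Hypothesis Ofin : (mu Omega < +oo)%E.
Implicit Types (f g phi : R -> R).

(** Besides binary functions this covers their differences, with values -1, 0, 1; for all of them
    $|f|^p = f^2$ a.e. *)
Definition norm01 f := {ae mu, forall x, Omega x -> `|f x| = 0 \/ `|f x| = 1}.

Definition binary phi := {ae mu, forall x, Omega x -> phi x = 0 \/ phi x = 1}.

Lemma binary_norm01 phi : binary phi -> norm01 phi.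
Proof.
apply: aeS => x h Ox; have [->|->] := h Ox; rewrite ?normr0 ?normr1; [by left|by right].
Qed.

Lemma binaryB_norm01 phi psi : binary phi -> binary psi -> norm01 (phi \- psi).
Proof.
apply: aeS2 => x h1 h2 Ox /=.
have [->|->] := h1 Ox; have [->|->] := h2 Ox; rewrite ?subrr ?subr0 ?sub0r ?normrN;
  by [left; rewrite normr0|right; rewrite normr1].
Qed.

Lemma eq_on_sqint f g : measurable_fun Omega f -> sqint Omega g -> eq_on Omega f g ->
  sqint Omega f.
Proof.
move=> mf [mg g2] fg; split => //; apply/integrableP; split.
  by apply/measurable_EFinP; exact: measurable_funX.
move/integrableP : g2 => [_]; apply: le_lt_trans; rewrite le_eqVlt; apply/orP; left.
apply/eqP; apply: (ae_eq_integral (mu := mu)) => //.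
- apply: (@measurableT_comp _ _ _ _ _ _ abse) => //.
  by apply/measurable_EFinP; exact: measurable_funX.
- apply: (@measurableT_comp _ _ _ _ _ _ abse) => //.
  by apply/measurable_EFinP; exact: measurable_funX.
- by move: fg; apply: aeS => x h Ox /=; rewrite h.
Qed.

Lemma norm01_sqint f : measurable_fun Omega f -> norm01 f -> sqint Omega f.
Proof.
move=> mf f01; pose g x := Num.max (- 1) (Num.min 1 (f x)).
have mg : measurable_fun Omega g.
  by apply: measurable_maxr => //; apply: measurable_minr.
apply: (@eq_on_sqint _ g) => //.
  apply: (@sqint_bounded _ _ mO Ofin _ 1) => // x _.
  by rewrite /g ler_norml le_max lexx/= ge_max ge_min lexx/= andbT; lra.
move: f01; apply: aeS => x h Ox; have : `|f x| <= 1 by case: (h Ox) => ->.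
by rewrite ler_norml => /andP[h1 h2]; rewrite /g (min_idPr h2) (max_idPr h1).
Qed.

Lemma norm01_Lp (p : R) f : measurable_fun Omega f -> norm01 f -> 1 <= p ->
  Lp Omega p%:E f /\ Lpnorm Omega p%:E f = (ip Omega f f `^ p^-1)%:E.
Proof.
move=> mf f01 p1; have p0 : p != 0 by rewrite gt_eqF// (lt_le_trans ltr01).
have sf := norm01_sqint mf f01.
have E : (\int[mu]_(x in Omega) (`|f x| `^ p)%:E = \int[mu]_(x in Omega) (f x * f x)%:E)%E.
  apply: (ae_eq_integral (mu := mu)) => //.
  - apply/measurable_EFinP; apply: (measurableT_comp (measurable_powR _)) => //.
    exact: (measurableT_comp (@normr_measurable R setT)).
  - by apply/measurable_EFinP; exact: measurable_funM.
  - move: f01; apply: aeS => x h Ox; congr EFin.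
    rewrite -expr2 -(real_normK (num_real (f x))).
    by case: (h Ox) => ->; rewrite ?powR0 ?powR1 ?expr0n ?expr1n.
have fin := @integrable_fin_num _ _ _ mu Omega mO _ (sqint_mul mO sf sf).
split; first by apply/(LpP mO _ p1); split => //; rewrite E ltey_eq fin.
by rewrite LpnormE// E -[X in (X `^ _)%E]fineK// poweR_EFin.
Qed.

Lemma W_binary n phi : (0 < n)%N -> eq_on Omega (W n phi) (cst 0) <-> binary phi.
Proof.
move=> n0; split; apply: aeS => x h Ox; move: (h Ox); rewrite /W.
  move/eqP; rewrite mulf_eq0 !expf_eq0 n0/= => /orP[/eqP ->|]; first by left.
  by rewrite subr_eq0 => /eqP ->; right.
by move=> [->|->]; rewrite ?subrr expr0n gtn_eqF// ?mul0r ?mulr0.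
Qed.

Lemma nrm_eq0 f : sqint Omega f -> nrm Omega f = 0 <-> eq_on Omega f (cst 0).
Proof.
move=> sf; split=> [f0|f0]; last first.
  rewrite (eq_on_nrm mO sf (sqint0 mO) f0) /nrm ler0_sqrtr// /ip.
  by under eq_Rintegral do rewrite mulr0; rewrite (@Rintegral_cst _ _ _ mu _ mO) mul0r.
have sn := sqint_norm mO sf.
have int0 : \int[mu]_(x in Omega) `|f x| = 0.
  apply/eqP; rewrite eq_le (@Rintegral_ge0 _ _ _ mu) ?andbT//.
  by apply: le_trans (integral_norm_le_nrm mO Ofin sf) _; rewrite f0 mul0r.
have : (\int[mu]_(x in Omega) `|(f x)%:E| = 0)%E.
  have := sqint_integrable mO Ofin sn.
  move=> /(@integrable_fin_num _ _ _ mu Omega mO) fin.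
  by rewrite -[LHS]fineK// -[X in _ = X%:E]int0.
have mf : measurable_fun Omega (EFin \o f) by apply/measurable_EFinP; exact: sf.1.
move=> /(ae_eq_integral_abs mu mO mf); apply: aeS => x h Ox.
by have [] := h Ox.
Qed.

(** From $\phi_j^2 = \phi_j$ one gets $\psi(1-\psi) = (\phi_j - \psi)(\psi + \phi_j - 1)$; the first
    factor tends to 0 in $L^2$ and the second stays bounded, so the left side has integral norm
    0. *)
Lemma binary_closed (phi : nat -> R -> R) psi : (forall j, sqint Omega (phi j)) ->
  sqint Omega psi -> (forall j, binary (phi j)) ->
  (forall j, nrm Omega (phi j \- psi) <= 2 * 2^-1 ^+ j) -> binary psi.
Proof.
move=> sphi spsi bphi cvgphi.
have s1 : sqint Omega (cst 1).
  by apply: (@sqint_bounded _ _ mO Ofin _ 1) => // x _; rewrite /= normr1.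
pose g x := psi x * (psi x - 1).
have sp1 : sqint Omega (psi \- cst 1) by exact: sqintB.
have ig : mu.-integrable Omega (EFin \o g) by exact: (sqint_mul mO spsi sp1).
have mg : measurable_fun Omega g by apply/measurable_EFinP; exact: (measurable_int mu ig).
have int0 : \int[mu]_(x in Omega) `|g x| <= 0.
  apply: (@le_half_pow _ (2 * (2 * nrm Omega (psi \- cst 1) + 2 + nrm Omega (cst 1)))) => j.
  pose d := phi j \- psi; pose e x := psi x + phi j x - 1.
  have sd : sqint Omega d by exact: sqintB.
  have se : sqint Omega e.
    have := sqintB mO (sqintD mO spsi (sphi j)) s1; by [].
  have -> : \int[mu]_(x in Omega) `|g x| = ip Omega (Num.norm \o d) (Num.norm \o e).
    apply: ae_eq_Rintegral => //.
    - exact: (measurableT_comp (@normr_measurable R setT)).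
    - by apply: measurable_funM; [exact: (sqint_norm mO sd).1|exact: (sqint_norm mO se).1].
    - move: (bphi j); apply: aeS => x h Ox /=; rewrite -normrM -normrN; congr `|_|.
      by rewrite /g /d /e /=; case: (h Ox) => ->; ring.
  apply: le_trans (ler_norm _) _.
  apply: le_trans (cauchy_schwarz mO (sqint_norm mO sd) (sqint_norm mO se)) _.
  rewrite !ip_norm -/(nrm Omega d) -/(nrm Omega e) add0r.
  have q0 : 0 < (2^-1 : R) ^+ j by rewrite exprn_gt0 ?invr_gt0.
  have q1 : (2^-1 : R) ^+ j <= 1 by rewrite exprn_ile1 ?invr_ge0// invf_le1// ler1n.
  have ele : nrm Omega e <= 2 * nrm Omega (psi \- cst 1) + 2 + nrm Omega (cst 1).
    have -> : nrm Omega e = nrm Omega (((psi \- cst 1) \+ (psi \- cst 1)) \+ (d \+ cst 1)).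
      by apply: eq_nrm => x; rewrite /e /d /=; ring.
    have sdd := sqintD mO sd s1; have spp := sqintD mO sp1 sp1.
    have := nrm_triangle mO spp sdd; have := nrm_triangle mO sp1 sp1.
    have := nrm_triangle mO sd s1; have := cvgphi j; rewrite -/d; move: q0 q1; lra.
  rewrite mulrAC; apply: ler_pM => //; try exact: nrm_ge0; exact: cvgphi.
have : \int[mu]_(x in Omega) `|g x| = 0.
  by apply/eqP; rewrite eq_le int0 (@Rintegral_ge0 _ _ _ mu).
move=> {}int0; have : (\int[mu]_(x in Omega) `|(g x)%:E| = 0)%E.
  have /(@integrable_fin_num _ _ _ mu Omega mO) fin := integrable_norm ig.
  by rewrite -[LHS]fineK// -[X in _ = X%:E]int0.
move=> /(ae_eq_integral_abs mu mO (measurable_int mu ig)); apply: aeS => x h Ox.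
have [/eqP] := h Ox; rewrite /g mulf_eq0 subr_eq0 => /orP[/eqP ->|/eqP ->]; [by left|by right].
Qed.

End ZeroOneValued.

(** * Joint compactness of kernels and binary functions *)

Section FeasibleCompactness.
Context {R : realType}.
Local Notation mu := (@lebesgue_measure R).
Variable Omega : set R.
Hypothesis iO : is_interval Omega.
Hypothesis bO : bounded_set Omega.

Let mO : measurable Omega.
Proof. by have [] := bounded_interval_cases iO bO. Qed.

Let Ofin : (mu Omega < +oo)%E.
Proof. by have [] := bounded_interval_cases iO bO. Qed.

Lemma feasible_compactness (u phi : nat -> R -> R) (h v : nat -> R) (C : R) :
  (forall j, sqint Omega (u j)) -> (forall j, sqint Omega (phi j)) ->
  (forall j, binary Omega (phi j)) ->
  (forall j, H1norm Omega (u j) = (h j)%:E) -> (forall j, h j <= C) ->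
  (forall j, BVseminorm Omega (phi j) = (v j)%:E) -> (forall j, v j <= C) ->
  exists s : nat -> nat, exists (u' phi' : R -> R) (h' v' : R),
    [/\ {homo s : i j / (i < j)%N},
      [/\ sqint Omega u', sqint Omega phi' & binary Omega phi'],
      (forall j, nrm Omega (u (s j) \- u') <= 2 * 2^-1 ^+ j) /\
      (forall j, nrm Omega (phi (s j) \- phi') <= 2 * 2^-1 ^+ j),
      (forall j, `|h (s j) - h'| <= 2^-1 ^+ j) /\
      (forall j, `|v (s j) - v'| <= 2^-1 ^+ j) &
      [/\ (H1norm Omega u' <= h'%:E)%E, (BVseminorm Omega phi' <= v'%:E)%E,
        0 <= h' & 0 <= v']].
Proof.
move=> su sphi bphi uh hC phiv vC.
have [U [UU ooU]] := @ultraFilterLemma nat \oo _.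
have h0 j : 0 <= h j by rewrite -lee_fin -uh; exact: H1norm_ge0.
have v0 j : 0 <= v j by rewrite -lee_fin -phiv; exact: BVseminorm_ge0.
have C0 : 0 <= C by exact: le_trans (h0 0%N) (hC 0%N).
have uC j : (H1norm Omega (u j) < (C + 1)%:E)%E.
  by rewrite uh lte_fin (le_lt_trans (hC j))// ltrDl.
have nu j : nrm Omega (u j) <= C + 1.
  have [g [_ _ _ ltg]] := H1norm_lt mO (uC j).
  rewrite -(@ler_pXn2r _ 2)// ?nnegrE ?nrm_ge0 ?addr_ge0// sqr_nrm.
  by have := ip_ge0 Omega g; lra.
have BVu j := BVseminorm_le_H1norm mO bO Ofin (uC j).
have BVphi j : (BVseminorm Omega (phi j) <= C%:E)%E by rewrite phiv lee_fin.
(* A binary square equals its minimum with 1 a.e., and that minimum can be compared pointwise with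
   the constant 1. *)
have nphi j : nrm Omega (phi j) <= Num.sqrt (fine (mu Omega)) + 1.
  have s1 : sqint Omega (cst 1).
    by apply: (@sqint_bounded _ _ mO Ofin _ 1) => // x _; rewrite /= normr1.
  rewrite ler_wpDr// /nrm ler_sqrt ?fine_ge0// -[leRHS]mul1r.
  rewrite -(@Rintegral_cst _ _ _ mu _ mO).
  have -> : ip Omega (phi j) (phi j) =
      \int[mu]_(x in Omega) (Num.min 1 (phi j x * phi j x)).
    have mm := (sqint_mul mO (sphi j) (sphi j)).
    apply: ae_eq_Rintegral => //.
    - by apply: measurable_funM; exact: (sphi j).1.
    - apply: measurable_minr => //.
      by apply: measurable_funM; exact: (sphi j).1.
    - by move: (bphi j); apply: aeS => x hx Ox; case: (hx Ox) => ->;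
        rewrite ?mulr0 ?mulr1 ?minxx// min_r.
  apply: (@le_Rintegral _ _ _ mu _ _ _ mO).
  - apply: (@measurable_bounded_integrable _ _ _ mu) => //.
      apply: measurable_minr => //.
      by apply: measurable_funM; exact: (sphi j).1.
    exists 1; split; [exact: num_real|move=> z /ltW z1 x _ /=].
    apply: le_trans z1; rewrite ger0_norm ?ge_min ?lexx//.
    by rewrite le_min ler01 -expr2 sqr_ge0.
  - by have := sqint_mul mO s1 s1; apply: eq_integrable => // x _ /=; rewrite mulr1.
  - by move=> x _; rewrite ge_min lexx.
have habs j : `|h j| <= C by rewrite ger0_norm.
have vabs j : `|v j| <= C by rewrite ger0_norm.
have [h' hh'] := ultra_cvg_bounded UU habs.
have [v' vv'] := ultra_cvg_bounded UU vabs.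
have q0 m : 0 < (2^-1 : R) ^+ m by rewrite exprn_gt0 ?invr_gt0.
have /choice[A hA] (m : nat) : exists A : set nat, U A /\ forall i j, A i -> A j ->
    nrm Omega (u i \- u j) <= 2^-1 ^+ m.
  by have [A ? ?] := BV_ultra_cauchy UU iO bO su nu BVu (q0 m); exists A.
have /choice[A' hA'] (m : nat) : exists A : set nat, U A /\ forall i j, A i -> A j ->
    nrm Omega (phi i \- phi j) <= 2^-1 ^+ m.
  by have [A0 ? ?] := BV_ultra_cauchy UU iO bO sphi nphi BVphi (q0 m); exists A0.
(* All four convergences at precision $2^{-m}$ in one set of [U], so that a single subsequence
   serves them together. *)
pose E m := (A m `&` A' m) `&`
  ([set i | `|h' - h i| < 2^-1 ^+ m] `&` [set i | `|v' - v i| < 2^-1 ^+ m]).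
have PU : ProperFilter U by exact: ultra_proper.
have UE m : U (E m).
  apply: filterI; apply: filterI; [exact: (hA m).1|exact: (hA' m).1| |].
    by move/cvgrPdist_lt : hh' => /(_ _ (q0 m)).
  by move/cvgrPdist_lt : vv' => /(_ _ (q0 m)).
have [s homos sE] := ultra_subseq UU ooU UE.
have fastu j : nrm Omega (u (s j.+1) \- u (s j)) <= 2^-1 ^+ j.
  have [[a1 _] _] := sE j j (leqnn j); have [[a2 _] _] := sE j j.+1 (leqnSn j).
  exact: (hA j).2.
have fastphi j : nrm Omega (phi (s j.+1) \- phi (s j)) <= 2^-1 ^+ j.
  have [[_ a1] _] := sE j j (leqnn j); have [[_ a2] _] := sE j j.+1 (leqnSn j).
  exact: (hA' j).2.
have [u' su' uu'] := sqint_fast_complete mO Ofin (fun j => su (s j)) fastu.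
have [phi' sphi' pp'] := sqint_fast_complete mO Ofin (fun j => sphi (s j)) fastphi.
have hs j : `|h (s j) - h'| <= 2^-1 ^+ j.
  by have [_ [a1 _]] := sE j j (leqnn j); rewrite distrC ltW.
have vs j : `|v (s j) - v'| <= 2^-1 ^+ j.
  by have [_ [_ a1]] := sE j j (leqnn j); rewrite distrC ltW.
have h'0 : 0 <= h'.
  apply: (@le_half_pow _ 1) => j; have := hs j; have := h0 (s j).
  by rewrite ler_norml => ? /andP[]; lra.
have v'0 : 0 <= v'.
  apply: (@le_half_pow _ 1) => j; have := vs j; have := v0 (s j).
  by rewrite ler_norml => ? /andP[]; lra.
exists s, u', phi', h', v'; split => //.
- split => //; exact: (binary_closed mO Ofin (fun j => sphi (s j)) sphi' (fun j => bphi (s j)) pp').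
- split => //.
  + apply: (H1norm_closed mO bO Ofin (fun j => su (s j)) su' h'0 uu' (v := h \o s)).
      by move=> j; rewrite uh.
    by move=> j /=; have := hs j; rewrite ler_norml => /andP[]; lra.
  + apply: (BVseminorm_closed mO bO Ofin (fun j => sphi (s j)) sphi' pp' (v := v \o s)).
      by move=> j; rewrite phiv.
    by move=> j /=; have := vs j; rewrite ler_norml => /andP[]; lra.
Qed.

End FeasibleCompactness.

(** * Convergence of real sequences and continuity of powers *)

Section HalfPowCvg.
Context {R : realType}.

Lemma half_pow_cvg (a : nat -> R) (l C : R) : (forall j, `|a j - l| <= C * 2^-1 ^+ j) ->
  a j @[j --> \oo] --> l.
Proof.
move=> h; apply/cvgrPdist_le => e e0.
have := @cvg_expr R 2^-1; rewrite ger0_norm ?invr_ge0// invf_lt1// ltr1n => /(_ isT) c0.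
have : C * 2^-1 ^+ j @[j --> \oo] --> C * 0 by apply: cvgMr.
rewrite mulr0 => /cvgrPdist_le/(_ e e0); apply: filterS => j.
rewrite sub0r normrN distrC => hj; apply: le_trans (h j) _.
exact: le_trans (ler_norm _) hj.
Qed.

Lemma powR_continuous_pos (a w : R) : 0 < w -> x `^ a @[x --> w] --> w `^ a.
Proof.
move=> w0; have c : expR (a * ln x) @[x --> w] --> expR (a * ln w).
  apply: (@cvg_comp _ _ _ (fun x => a * ln x) expR _ (nbhs (a * ln w))).
    by apply: cvgMr; exact: continuous_ln.
  exact: continuous_expR.
have -> : w `^ a = expR (a * ln w) by rewrite /powR gt_eqF.
apply: cvg_trans c; apply: near_eq_cvg.
near=> x; rewrite /powR gt_eqF//; near: x; exact: lt_nbhsr.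
Unshelve. all: by end_near. Qed.

End HalfPowCvg.

(** * The functional on the feasible set *)

Section Functional.
Context {R : realType}.
Local Notation mu := (@lebesgue_measure R).
Variables (Omega : set R) (n : nat) (beta1 beta2 beta3 : R) (K0 : R -> R).
Hypothesis iO : is_interval Omega.
Hypothesis bO : bounded_set Omega.
Hypothesis n_gt0 : (0 < n)%N.
Hypothesis beta1_gt0 : 0 < beta1.
Hypothesis beta2_gt0 : 0 < beta2.
Hypothesis beta3_gt0 : 0 < beta3.
Hypothesis sK0 : sqint Omega K0.

Let mO : measurable Omega.
Proof. by have [] := bounded_interval_cases iO bO. Qed.

Let Ofin : (mu Omega < +oo)%E.
Proof. by have [] := bounded_interval_cases iO bO. Qed.

Let n4 : 1 <= ((4 * n)%:R : R).
Proof. by rewrite ler1n muln_gt0. Qed.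

(** The constraints alone; the condition of [Ad] on the convolution is automatic by
    [feasible_Ad]. *)
Definition feasible : set (triple R) := [set x | let: (K', K, phi) := x in
  [/\ X Omega n x, eq_on Omega (W n phi) (cst 0) & eq_on Omega (M K' K) (cst 0)]].

Lemma feasible_Gamma : X Omega n `&` Gamma Omega n (cst 0, cst 0) = feasible.
Proof.
by apply/seteqP; split => -[[K' K] phi]; [move=> [? [? ? ?]]|move=> [? ? ?]].
Qed.

Lemma feasibleP K' K phi : feasible (K', K, phi) ->
  [/\ sqint Omega K', sqint Omega K, sqint Omega phi, binary Omega phi & eq_on Omega K' K].
Proof.
move=> [[/(Lp2P mO) sK' /(Lp2P mO) sK [/(LpP mO _ n4)[mphi _] _]] /(W_binary _ _ n_gt0) bphi KK].
split => //; first exact: norm01_sqint (binary_norm01 bphi).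
by move: KK; apply: aeS => x h Ox; apply/eqP; rewrite -subr_eq0; apply/eqP; exact: h.
Qed.

Lemma feasibleI K phi : sqint Omega K -> sqint Omega phi -> binary Omega phi ->
  (BVseminorm Omega phi < +oo)%E -> feasible (K, K, phi).
Proof.
move=> sK sphi bphi Vphi; split.
- split; [exact/(Lp2P mO)|exact/(Lp2P mO)|split].
    by have [] := norm01_Lp mO Ofin sphi.1 (binary_norm01 bphi) n4.
  by split => //; apply/(Lp1P mO); exact: sqint_integrable.
- exact/(W_binary _ _ n_gt0).
- by apply: aeW => x Ox; rewrite /M /= subrr.
Qed.

Lemma feasible_Ad K' K phi : feasible (K', K, phi) -> Ad Omega n (K', K, phi).
Proof.
move=> fx; have [sK' sK sphi bphi KK] := feasibleP fx; have [? ? ?] := fx.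
by split => //; apply/(Lp2P mO); exact: sqint_convolution.
Qed.

(** The value of [F] at a feasible point as a function of real parameters: [d] is the misfit, [h]
    the distance to [K0] in $H^1$, common to both kernels, [v] the variation of [phi], and [w] its
    squared $L^2$ norm, whose root of order [4 * n] is the $L^{4n}$ norm of a binary function. *)
Definition objective (alpha d h w v : R) : R :=
  d ^+ 2 + alpha * (beta1 * h ^+ 2 + beta2 * (w `^ (4 * n)%:R^-1) ^+ 2 + beta3 * v + beta1 * h).

Lemma F_objective yd (alpha : R) K' K phi (h v : R) : sqint Omega yd ->
  feasible (K', K, phi) ->
  H1norm Omega (K \- K0) = h%:E -> BVseminorm Omega phi = v%:E ->
  F Omega n beta1 beta2 beta3 K0 yd alpha (K', K, phi) =
  (objective alpha (nrm Omega (convolution Omega K phi \- yd)) h (ip Omega phi phi) v)%:E.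
Proof.
move=> syd fx Kh phiv; have [sK' sK sphi bphi KK] := feasibleP fx.
have E : H1norm Omega (K' \- K0) = h%:E.
  rewrite -Kh; apply: (eq_on_H1norm mO bO Ofin); [exact: sqintB|exact: sqintB|].
  by move: KK; apply: aeS => x h1 Ox /=; rewrite h1.
have [_ N] := norm01_Lp mO Ofin sphi.1 (binary_norm01 bphi) n4.
rewrite /F /Reg E Kh phiv N (Lpnorm2E mO); last by apply: sqintB => //; exact: sqint_convolution.
by rewrite -!EFin_expe -!EFinM -!EFinD.
Qed.

(** At a feasible point only the $H^1$ terms can be infinite, and the two are infinite together
    since the kernels agree a.e. *)
Lemma F_cases yd (alpha : R) K' K phi : 0 < alpha -> sqint Omega yd ->
  feasible (K', K, phi) ->
  F Omega n beta1 beta2 beta3 K0 yd alpha (K', K, phi) = +oo%E \/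
  exists h v, [/\ H1norm Omega (K \- K0) = h%:E, BVseminorm Omega phi = v%:E,
    0 <= h & 0 <= v].
Proof.
move=> a0 syd fx; have [sK' sK sphi bphi KK] := feasibleP fx.
have E : H1norm Omega (K' \- K0) = H1norm Omega (K \- K0).
  apply: (eq_on_H1norm mO bO Ofin); [exact: sqintB|exact: sqintB|].
  by move: KK; apply: aeS => x h1 Ox /=; rewrite h1.
have [v phiv] : exists v, BVseminorm Omega phi = v%:E.
  have := BVseminorm_ge0 mO phi; have [[_ _ [_ [_ +]]] _ _] := fx.
  by case: (BVseminorm Omega phi) => // r; exists r.
have v0 : 0 <= v by rewrite -lee_fin -phiv; exact: BVseminorm_ge0.
have [_ N] := norm01_Lp mO Ofin sphi.1 (binary_norm01 bphi) n4.
have := H1norm_ge0 Omega (K \- K0); case Kh : (H1norm Omega (K \- K0)) => [h| |] // h0.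
  by right; exists h, v.
left; rewrite /F /Reg E Kh phiv N (Lpnorm2E mO); last by apply: sqintB => //; exact: sqint_convolution.
have yy : ((+oo : \bar R) ^+ 2 = +oo)%E by rewrite expe2 mulyy.
by rewrite yy gt0_muley ?lte_fin// -!EFin_expe -!EFinM !addye// gt0_muley ?lte_fin//.
Qed.

Lemma convolution_fast K phi (Kj phij : nat -> R -> R) :
  sqint Omega K -> sqint Omega phi ->
  (forall j, sqint Omega (Kj j)) -> (forall j, sqint Omega (phij j)) ->
  (forall j, nrm Omega (Kj j \- K) <= 2 * 2^-1 ^+ j) ->
  (forall j, nrm Omega (phij j \- phi) <= 2 * 2^-1 ^+ j) ->
  exists C, forall j, nrm Omega (convolution Omega (Kj j) (phij j) \- convolution Omega K phi)
    <= C * 2^-1 ^+ j.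
Proof.
move=> sK sphi sKj sphij hK hphi.
exists ((2 * (nrm Omega phi + 2) + nrm Omega K * 2) * Num.sqrt (fine (mu Omega))) => j.
apply: le_trans (nrm_convolutionB mO Ofin (sKj j) sK (sphij j) sphi) _.
rewrite [leRHS]mulrAC ler_wpM2r ?sqrtr_ge0//.
have q0 : 0 < (2^-1 : R) ^+ j by rewrite exprn_gt0 ?invr_gt0.
have q1 : (2^-1 : R) ^+ j <= 1 by rewrite exprn_ile1 ?invr_ge0// invf_le1// ler1n.
have phiC : nrm Omega (phij j) <= nrm Omega phi + 2.
  by have := nrm_le mO (sphij j) sphi; have := hphi j; lra.
rewrite mulrDl; apply: lerD.
  rewrite mulrAC; apply: ler_pM => //; exact: nrm_ge0.
by rewrite -mulrA ler_wpM2l ?nrm_ge0.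
Qed.

Lemma objective_lsc (alpha d h w v c : R) (dj hj wj vj : nat -> R) : 0 < alpha ->
  dj j @[j --> \oo] --> d -> hj j @[j --> \oo] --> h -> wj j @[j --> \oo] --> w ->
  vj j @[j --> \oo] --> v -> 0 <= w ->
  (forall j, objective alpha (dj j) (hj j) (wj j) (vj j) <= c + 2^-1 ^+ j) ->
  objective alpha d h w v <= c.
Proof.
move=> a0 dd hh ww vv w0 le_c.
have sq (a : nat -> R) (l : R) : a j @[j --> \oo] --> l -> a j ^+ 2 @[j --> \oo] --> l ^+ 2.
  by move=> al; rewrite expr2; under eq_fun do rewrite expr2; exact: cvgM.
have cc : c + 2^-1 ^+ j @[j --> \oo] --> c.
  rewrite -[X in _ --> X]addr0; apply: cvgD; first exact: cvg_cst.
  by apply: cvg_expr; rewrite ger0_norm ?invr_ge0// invf_lt1// ltr1n.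
pose T x := beta2 * (x `^ (4 * n)%:R^-1) ^+ 2.
(* Continuity of the power is used at positive points only; when [w = 0] the term is minorized by 0,
   its value there, which suffices for lower semicontinuity. *)
pose T' x := if w == 0 then 0 else T x.
have T0 x : 0 <= T x by rewrite mulr_ge0 ?sqr_ge0// ltW.
have T'T x : T' x <= T x by rewrite /T'; case: ifP.
have Tw : T w = T' w.
  rewrite /T' /T; case: eqP => [->|//].
  rewrite powR0 ?expr0n ?mulr0//.
  by rewrite invr_neq0// pnatr_eq0 muln_eq0/= -lt0n.
have T'cvg : T' (wj j) @[j --> \oo] --> T' w.
  rewrite /T'; case: eqP => [_|/eqP wn0]; first exact: cvg_cst.
  have wp : 0 < w by rewrite lt_def wn0.
  apply: cvgMr; apply: sq.
  apply: (@cvg_comp _ _ _ wj (fun x => x `^ (4 * n)%:R^-1) \oo (nbhs w)) => //.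
  exact: powR_continuous_pos.
rewrite /objective -/(T w) Tw.
have lim : (dj j ^+ 2 + alpha * (beta1 * hj j ^+ 2 + T' (wj j) + beta3 * vj j + beta1 * hj j))
    @[j --> \oo] --> d ^+ 2 + alpha * (beta1 * h ^+ 2 + T' w + beta3 * v + beta1 * h).
  apply: cvgD; first exact: sq.
  apply: cvgMr; apply: cvgD; last exact: cvgMr.
  apply: cvgD; last exact: cvgMr.
  by apply: cvgD => //; apply: cvgMr; exact: sq.
apply: (ler_cvg_to lim cc); apply: nearW => j; apply: le_trans (le_c j).
by rewrite /objective lerD2l ler_pM2l// !lerD2r lerD2l.
Qed.

End Functional.

(** * Existence of minimizers for fixed data *)

Section Minimizers.
Context {R : realType}.
Local Notation mu := (@lebesgue_measure R).
Variables (Omega : set R) (n : nat) (beta1 beta2 beta3 gamma : R) (K0 y : R -> R).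
Hypothesis iO : is_interval Omega.
Hypothesis bO : bounded_set Omega.
Hypothesis n_gt0 : (0 < n)%N.
Hypothesis beta1_gt0 : 0 < beta1.
Hypothesis beta2_gt0 : 0 < beta2.
Hypothesis beta3_gt0 : 0 < beta3.
Hypothesis K0_H1 : H1space Omega K0.
Hypothesis y_L2 : Lp Omega 2%:E y.
Hypothesis A3 : attainable Omega n gamma y.

Let mO : measurable Omega.
Proof. by have [] := bounded_interval_cases iO bO. Qed.

Let Ofin : (mu Omega < +oo)%E.
Proof. by have [] := bounded_interval_cases iO bO. Qed.

Let sK0 : sqint Omega K0.
Proof. by have [/(Lp2P mO)] := K0_H1. Qed.

Let sy : sqint Omega y.
Proof. exact/(Lp2P mO). Qed.

Local Notation F := (F Omega n beta1 beta2 beta3 K0).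
Local Notation Ftilde := (Ftilde Omega n beta1 beta2 beta3 K0).
Local Notation objective := (objective n beta1 beta2 beta3).
Local Notation feasible := (feasible Omega n).

(** Coercivity: all summands are nonnegative. The unsquared term of the regularizer bounds [h]
    linearly. *)
Lemma objective_ge0 (alpha d h w v : R) : 0 < alpha -> 0 <= h -> 0 <= v ->
  [/\ d ^+ 2 <= objective alpha d h w v,
    alpha * (beta1 * h) <= objective alpha d h w v &
    alpha * (beta3 * v) <= objective alpha d h w v].
Proof.
move=> a0 h0 v0; rewrite /objective !mulrDr.
have [aw b1 b2 b3] : [/\ 0 <= alpha, 0 <= beta1, 0 <= beta2 & 0 <= beta3] by split; exact: ltW.
have t1 : 0 <= alpha * (beta1 * h ^+ 2) by rewrite !mulr_ge0 ?sqr_ge0.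
have t2 : 0 <= alpha * (beta2 * (w `^ (4 * n)%:R^-1) ^+ 2) by rewrite !mulr_ge0 ?powR_ge0.
have t3 : 0 <= alpha * (beta3 * v) by rewrite !mulr_ge0.
have t4 : 0 <= alpha * (beta1 * h) by rewrite !mulr_ge0.
by have := sqr_ge0 d; split; lra.
Qed.

(** The Gaussian of [A3], taken for both kernels, with the binary [phi]: the convolution reproduces
    [y], and [c] is the value of the regularizer. *)
Lemma reference_point : exists x : triple R, feasible x /\ exists2 c : R, 0 <= c &
  forall alpha yd, 0 < alpha -> sqint Omega yd ->
    F yd alpha x = (nrm Omega (y \- yd) ^+ 2 + alpha * c)%:E.
Proof.
have [sigma [K [u [phi [s0 [KE KL2] [[u1 _] _] uy [[[_ Vphi] L4] phiu Wphi]]]]]] := A3.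
have [sK [g sg wg]] : sqint Omega K /\ exists2 g, sqint Omega g & weak_derivative Omega K g.
  by rewrite KE; exact: gaussian_H1.
have n4 : 1 <= ((4 * n)%:R : R) by rewrite ler1n muln_gt0.
have mphi : measurable_fun Omega phi by have [] := (LpP mO phi n4).1 L4.
have bphi := (W_binary _ _ n_gt0).1 Wphi.
have sphi := norm01_sqint mO Ofin mphi (binary_norm01 bphi).
have mu' : measurable_fun Omega u.
  by have /measurable_int/measurable_EFinP := (Lp1P mO u).1 u1.
have su : sqint Omega u by apply: (eq_on_sqint mO mu' sphi); exact: ae_eq_sym.
have [h Kh] : exists h, H1norm Omega (K \- K0) = h%:E.
  have [_ [g0 /(Lp2P mO) sg0 wg0]] := K0_H1.
  have wgg : weak_derivative Omega (K \- K0) (g \- g0).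
    apply/weak_derivativeP => psi tpsi; have [sp sdp] := sqint_test mO bO Ofin tpsi.
    have e1 : ip Omega K (derive1 psi) = - ip Omega g psi := wg _ tpsi.
    have e2 : ip Omega K0 (derive1 psi) = - ip Omega g0 psi := wg0 _ tpsi.
    by rewrite !(ipBl mO)// e1 e2; ring.
  have := H1norm_le mO (sqintB mO sK sK0) (sqintB mO sg sg0) wgg.
  have := H1norm_ge0 Omega (K \- K0).
  by case: (H1norm _ _) => // r; exists r.
have h0 : 0 <= h by rewrite -lee_fin -Kh; exact: H1norm_ge0.
have [v phiv] : exists v, BVseminorm Omega phi = v%:E.
  have := BVseminorm_ge0 mO phi; move: Vphi.
  by case: (BVseminorm Omega phi) => // r; exists r.
have v0 : 0 <= v by rewrite -lee_fin -phiv; exact: BVseminorm_ge0.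
have fx : feasible (K, K, phi) by apply: feasibleI.
exists (K, K, phi); split => //.
exists (beta1 * h ^+ 2 + beta2 * (ip Omega phi phi `^ (4 * n)%:R^-1) ^+ 2 + beta3 * v + beta1 * h).
  have [b1 b2 b3] : [/\ 0 <= beta1, 0 <= beta2 & 0 <= beta3] by split; exact: ltW.
  by rewrite !addr_ge0 ?mulr_ge0 ?powR_ge0.
move=> alpha yd a0 syd; rewrite (F_objective beta1 beta2 beta3 iO bO n_gt0 sK0 alpha syd fx Kh phiv).
rewrite /objective; congr (_ ^+ 2 + _)%:E.
apply: eq_on_nrm => //; [by apply: sqintB => //; exact: sqint_convolution|exact: sqintB|].
move: uy; rewrite (eq_on_convolution mO sK su sphi (ae_eq_sym phiu)).
by apply: aeS => x hx Ox /=; rewrite hx.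
Qed.

Lemma Ftilde_feasible yd (alpha : R) x : feasible x -> Ftilde yd alpha x = F yd alpha x.
Proof. by rewrite /Ftilde feasible_Gamma => fx; rewrite mem_set. Qed.

Lemma Ftilde_infeasible yd (alpha : R) x : ~ feasible x -> Ftilde yd alpha x = +oo%E.
Proof. by rewrite /Ftilde feasible_Gamma => fx; rewrite memNset. Qed.

(** The finite value at the reference point excludes infeasible minimizers, where the functional is
    infinite. *)
Lemma argmin_Ftilde yd (alpha : R) x : 0 < alpha -> sqint Omega yd ->
  argmin Omega n (Ftilde yd alpha) x <->
  feasible x /\ forall x', feasible x' -> (F yd alpha x <= F yd alpha x')%E.
Proof.
move=> a0 syd; have [xr [fxr [c c0 Fxr]]] := reference_point.
have feasX x' : feasible x' -> X Omega n x' by case: x' => [[? ?] ?] [].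
split=> [[Xx minx]|[fx minx]].
  have fx : feasible x.
    apply: contrapT => nfx; have := minx _ (feasX _ fxr).
    by rewrite Ftilde_infeasible// Ftilde_feasible// Fxr// leye_eq.
  split => // x' fx'; have := minx _ (feasX _ fx').
  by rewrite !Ftilde_feasible.
split; first exact: feasX.
move=> x' _; rewrite Ftilde_feasible//.
have [fx'|nfx'] := pselect (feasible x'); first by rewrite Ftilde_feasible//; exact: minx.
by rewrite Ftilde_infeasible// leey.
Qed.

Lemma minimizer_exists yd (alpha : R) : 0 < alpha -> sqint Omega yd ->
  exists2 x, feasible x & forall x', feasible x' -> (F yd alpha x <= F yd alpha x')%E.
Proof.
move=> a0 syd; have [xr [fxr [c c0 Fxr]]] := reference_point.
pose A := [set r | exists2 x, feasible x & F yd alpha x = r%:E].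
have F_A x : feasible x -> F yd alpha x = +oo%E \/ exists2 r, A r & F yd alpha x = r%:E.
  move: x => [[K' K] phi] fx.
  have [->|[h [v [Kh phiv h0 v0]]]] := F_cases beta2 beta3 iO bO n_gt0 beta1_gt0 sK0 a0 syd fx.
    by left.
  have E := F_objective beta1 beta2 beta3 iO bO n_gt0 sK0 alpha syd fx Kh phiv.
  by right; eexists; [exists (K', K, phi); [exact: fx|exact: E]|exact: E].
have A0 : A !=set0 by eexists; exists xr; [exact: fxr|exact: Fxr].
have A_obj r : A r -> exists K phi h v, [/\ feasible (K, K, phi),
    H1norm Omega (K \- K0) = h%:E, BVseminorm Omega phi = v%:E, 0 <= h /\ 0 <= v &
    r = objective alpha (nrm Omega (convolution Omega K phi \- yd)) h (ip Omega phi phi) v].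
  move=> [[[K' K] phi] fx Er].
  have [E|[h [v [Kh phiv h0 v0]]]] := F_cases beta2 beta3 iO bO n_gt0 beta1_gt0 sK0 a0 syd fx.
    by rewrite E in Er.
  have E := F_objective beta1 beta2 beta3 iO bO n_gt0 sK0 alpha syd fx Kh phiv.
  have [_ sK sphi bphi _] := feasibleP iO bO n_gt0 fx.
  exists K, phi, h, v; split => //; first by apply: feasibleI => //; rewrite phiv ltry.
  by apply: EFin_inj; rewrite -Er E.
have Alb : lbound A 0.
  move=> r /A_obj[K [phi [h [v [_ _ _ [h0 v0] ->]]]]].
  have [+ _ _] := objective_ge0 (nrm Omega (convolution Omega K phi \- yd)) (ip Omega phi phi) a0 h0 v0.
  by apply: le_trans; exact: sqr_ge0.
have hA : has_inf A by split => //; exists 0.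
set m := inf A.
have m_le r : A r -> m <= r by move=> Ar; apply: inf_lbound => //; exists 0.
(* A minimizing sequence with the rate that [objective_lsc] expects. *)
have /choice[r hr] j : exists r, A r /\ r < m + 2^-1 ^+ j.
  have q0 : 0 < (2^-1 : R) ^+ j by rewrite exprn_gt0 ?invr_gt0.
  by have [r Ar rm] := inf_adherent q0 hA; exists r.
have /choice[K hK] j := A_obj _ (hr j).1.
have /choice[phi hphi] := hK; have /choice[h hh] := hphi; have /choice[v hv] := hh.
have q1 j : (2^-1 : R) ^+ j <= 1 by rewrite exprn_ile1 ?invr_ge0// invf_le1// ler1n.
have fxj j : feasible (K j, K j, phi j) by case: (hv j).
have [sK [sphi bphi]] : (forall j, sqint Omega (K j)) /\ (forall j, sqint Omega (phi j)) /\
    (forall j, binary Omega (phi j)).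
  by split => [|]; [|split] => j; have [] := feasibleP iO bO n_gt0 (fxj j).
have Kh j : H1norm Omega (K j \- K0) = (h j)%:E by case: (hv j).
have phiv j : BVseminorm Omega (phi j) = (v j)%:E by case: (hv j).
have hv0 j : 0 <= h j /\ 0 <= v j by case: (hv j).
have rE j : r j = objective alpha (nrm Omega (convolution Omega (K j) (phi j) \- yd)) (h j)
    (ip Omega (phi j) (phi j)) (v j) by case: (hv j).
pose C := (m + 1) / (alpha * beta1) + (m + 1) / (alpha * beta3).
have ab1 : 0 < alpha * beta1 by exact: mulr_gt0.
have ab3 : 0 < alpha * beta3 by exact: mulr_gt0.
have m10 : 0 <= m + 1 by apply: addr_ge0 => //; apply: lb_le_inf.
have rm1 j : r j <= m + 1 by have := (hr j).2; have := q1 j; lra.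
have hC j : h j <= C.
  have [_ + _] := objective_ge0 (nrm Omega (convolution Omega (K j) (phi j) \- yd))
    (ip Omega (phi j) (phi j)) a0 (hv0 j).1 (hv0 j).2.
  rewrite -rE => /le_trans/(_ (rm1 j)); rewrite mulrA mulrC -ler_pdivlMr// => /le_trans; apply.
  by rewrite lerDl divr_ge0// ltW.
have vC j : v j <= C.
  have [_ _] := objective_ge0 (nrm Omega (convolution Omega (K j) (phi j) \- yd))
    (ip Omega (phi j) (phi j)) a0 (hv0 j).1 (hv0 j).2.
  rewrite -rE => /le_trans/(_ (rm1 j)); rewrite mulrA mulrC -ler_pdivlMr// => /le_trans; apply.
  by rewrite lerDr divr_ge0// ltW.
have su j : sqint Omega (K j \- K0) by exact: sqintB.
have [s [u' [phi' [h' [v' [homos [su' sphi' bphi'] [cu cphi] [ch cv] [H1u BVp h'0 v'0]]]]]]] :=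
  feasible_compactness iO bO su sphi bphi Kh hC phiv vC.
pose Kl := u' \+ K0.
have sKl : sqint Omega Kl by exact: sqintD.
have cK j : nrm Omega (K (s j) \- Kl) <= 2 * 2^-1 ^+ j.
  by apply: le_trans (cu j); rewrite (@eq_nrm _ _ _ ((K (s j) \- K0) \- u'))// => x; rewrite /Kl /=; ring.
have [Cc hCc] := convolution_fast iO bO sKl sphi' (fun j => sK (s j)) (fun j => sphi (s j)) cK cphi.
have fxl : feasible (Kl, Kl, phi') by apply: feasibleI => //; apply: le_lt_trans BVp _; exact: ltry.
have uE : Kl \- K0 = u' by apply/funext => x; rewrite /Kl /=; ring.
have [hl Khl] : exists hl, H1norm Omega (Kl \- K0) = hl%:E.
  rewrite uE; have := H1norm_ge0 Omega u'; move: H1u.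
  by case: (H1norm Omega u') => // q; exists q.
have [vl phivl] : exists vl, BVseminorm Omega phi' = vl%:E.
  have := BVseminorm_ge0 mO phi'; move: BVp.
  by case: (BVseminorm Omega phi') => // q; exists q.
have hl0 : 0 <= hl by rewrite -lee_fin -Khl; exact: H1norm_ge0.
have hlh : hl <= h' by rewrite -lee_fin -Khl uE.
have vlv : vl <= v' by rewrite -lee_fin -phivl.
exists (Kl, Kl, phi') => // x' fx'.
have [->|[r' Ar' ->]] := F_A _ fx'; first exact: leey.
rewrite (F_objective beta1 beta2 beta3 iO bO n_gt0 sK0 alpha syd fxl Khl phivl) lee_fin.
apply: (@le_trans _ _ m); last exact: m_le.
(* Through the limits [h'] and [v'] of the norms: they dominate the norms of the limit, and
   [objective] is monotone in these arguments. *)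
apply: (@le_trans _ _ (objective alpha (nrm Omega (convolution Omega Kl phi' \- yd)) h'
    (ip Omega phi' phi') v')).
  rewrite /objective lerD2l ler_pM2l//.
  have h1 : beta1 * hl ^+ 2 <= beta1 * h' ^+ 2 by rewrite ler_pM2l// lerXn2r// nnegrE.
  have h2 : beta1 * hl <= beta1 * h' by rewrite ler_pM2l.
  have h3 : beta3 * vl <= beta3 * v' by rewrite ler_pM2l.
  by apply: lerD => //; apply: lerD => //; rewrite lerD2r.
pose dj j := nrm Omega (convolution Omega (K (s j)) (phi (s j)) \- yd).
apply: (@objective_lsc _ n beta1 beta2 beta3 n_gt0 beta2_gt0 alpha _ _ _ _ m dj (h \o s)
   (fun j => ip Omega (phi (s j)) (phi (s j))) (v \o s)) => //.
- apply: (@half_pow_cvg _ _ _ Cc) => j; apply: le_trans (hCc j); rewrite /dj.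
  have sc j' : sqint Omega (convolution Omega (K j') (phi j') \- yd).
    by apply: sqintB => //; exact: sqint_convolution.
  have sl : sqint Omega (convolution Omega Kl phi' \- yd).
    by apply: sqintB => //; exact: sqint_convolution.
  apply: le_trans (nrm_dist mO (sc (s j)) sl) _.
  by rewrite (@eq_nrm _ _ _ (convolution Omega (K (s j)) (phi (s j)) \- convolution Omega Kl phi'))// => x /=; ring.
- by apply: (@half_pow_cvg _ _ _ 1) => j; rewrite mul1r; exact: ch.
- have np : nrm Omega (phi (s j)) @[j --> \oo] --> nrm Omega phi'.
    apply: (@half_pow_cvg _ _ _ 2) => j; apply: le_trans (cphi j).
    exact: nrm_dist.
  rewrite -sqr_nrm expr2; under eq_fun do rewrite -sqr_nrm expr2.
  exact: cvgM.
- by apply: (@half_pow_cvg _ _ _ 1) => j; rewrite mul1r; exact: cv.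
- exact: ip_ge0.
- move=> j; rewrite /dj /= -rE; apply: le_trans (ltW (hr (s j)).2) _.
  rewrite lerD2l ler_wiXn2l ?invr_ge0// ?invf_le1// ?ler1n//.
  elim: j => // j ih; exact: leq_ltn_trans ih (homos _ _ (ltnSn j)).
Qed.

End Minimizers.

(** * Minimizers for vanishing regularization parameter *)

Section Convergence.
Context {R : realType}.
Local Notation mu := (@lebesgue_measure R).

Lemma cvg_subseq (a : nat -> R) (l : R) (s : nat -> nat) :
  {homo s : i j / (i < j)%N} -> a j @[j --> \oo] --> l -> a (s j) @[j --> \oo] --> l.
Proof.
move=> homos al; apply: (@cvg_comp _ _ _ s a \oo \oo) => // A [N _ NA].
exists N => // j /= Nj; apply: NA => /=; apply: leq_trans Nj _.
elim: j => // j ih; exact: leq_ltn_trans ih (homos _ _ (ltnSn j)).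
Qed.

(** The limit of the power at 0 is taken through positive values, while [w j] may vanish; it is
    squeezed under a positive sequence. *)
Lemma powR_half_pow_cvg (w : nat -> R) (p : R) : 0 < p -> (forall j, 0 <= w j) ->
  (forall j, w j <= (2 * 2^-1 ^+ j) ^+ 2) -> w j `^ p @[j --> \oo] --> 0.
Proof.
move=> p0 w0 wq; pose u j : R := (2 * 2^-1 ^+ j) ^+ 2.
have u0 j : 0 < u j by rewrite exprn_gt0// mulr_gt0// exprn_gt0// invr_gt0.
have ucvg : u j @[j --> \oo] --> 0.
  have c : 2 * 2^-1 ^+ j @[j --> \oo] --> (0 : R).
    by apply: (@half_pow_cvg _ _ _ 2) => j; rewrite subr0 ger0_norm// mulr_ge0// exprn_ge0// invr_ge0.
  rewrite -[X in _ --> X](mulr0 (0 : R)) /u; under eq_fun do rewrite expr2.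
  exact: cvgM.
have := (cvg_at_rightP _ _ _).1 (powR_cvg0 p0) u (conj u0 ucvg).
apply: squeeze_cvgr; last exact: cvg_cst.
apply: nearW => j; rewrite powR_ge0/= ge0_ler_powR ?nnegrE ?(ltW p0) ?(ltW (u0 j))//.
Qed.

Variables (Omega : set R) (n : nat) (beta1 beta2 beta3 gamma : R) (K0 y : R -> R).
Hypothesis iO : is_interval Omega.
Hypothesis bO : bounded_set Omega.
Hypothesis n_gt0 : (0 < n)%N.
Hypothesis beta1_gt0 : 0 < beta1.
Hypothesis beta2_gt0 : 0 < beta2.
Hypothesis beta3_gt0 : 0 < beta3.
Hypothesis K0_H1 : H1space Omega K0.
Hypothesis y_L2 : Lp Omega 2%:E y.
Hypothesis A3 : attainable Omega n gamma y.

Let mO : measurable Omega.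
Proof. by have [] := bounded_interval_cases iO bO. Qed.

Let Ofin : (mu Omega < +oo)%E.
Proof. by have [] := bounded_interval_cases iO bO. Qed.

Let sK0 : sqint Omega K0.
Proof. by have [/(Lp2P mO)] := K0_H1. Qed.

Let sy : sqint Omega y.
Proof. exact/(Lp2P mO). Qed.

Lemma Lp2_cvg (f : nat -> R -> R) g : (forall j, sqint Omega (f j)) -> sqint Omega g ->
  (forall j, nrm Omega (f j \- g) <= 2 * 2^-1 ^+ j) -> Lp_cvg Omega 2%:E f g.
Proof.
move=> sf sg fg; split; [by move=> j; exact/(Lp2P mO)|exact/(Lp2P mO)|].
rewrite (_ : (fun j => _) = (fun j => (nrm Omega (f j \- g))%:E)); last first.
  by apply/funext => j; rewrite (Lpnorm2E mO)//; exact: sqintB.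
apply: cvg_EFin; first exact: nearW.
apply: (@half_pow_cvg _ _ _ 2) => j /=.
by rewrite subr0 ger0_norm ?nrm_ge0.
Qed.

Lemma binary_Lp_cvg (p : R) (f : nat -> R -> R) g : 1 <= p ->
  (forall j, sqint Omega (f j)) -> sqint Omega g ->
  (forall j, binary Omega (f j)) -> binary Omega g ->
  (forall j, nrm Omega (f j \- g) <= 2 * 2^-1 ^+ j) -> Lp_cvg Omega p%:E f g.
Proof.
move=> p1 sf sg bf bg fg; have p0 : 0 < p by exact: lt_le_trans p1.
have d01 j := binaryB_norm01 (bf j) bg.
have sd j : sqint Omega (f j \- g) by exact: sqintB.
split.
- by move=> j; have [] := norm01_Lp mO Ofin (sf j).1 (binary_norm01 (bf j)) p1.
- by have [] := norm01_Lp mO Ofin sg.1 (binary_norm01 bg) p1.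
rewrite (_ : (fun j => _) = (fun j => (ip Omega (f j \- g) (f j \- g) `^ p^-1)%:E)); last first.
  by apply/funext => j; have [_ ->] := norm01_Lp mO Ofin (sd j).1 (d01 j) p1.
apply: cvg_EFin; first exact: nearW.
apply: powR_half_pow_cvg; first by rewrite invr_gt0.
  by move=> j; exact: ip_ge0.
move=> j; rewrite -sqr_nrm lerXn2r ?nnegrE ?nrm_ge0//.
Qed.

(** Common core of convergence and stability, with [C] bounding $\delta_j^2/\alpha_j$. Comparison
    with the reference point gives values at most $\delta_j^2 + \alpha_j c$: divided by $\alpha_j$
    this bounds the norms, and as it stands it sends the misfit to 0. *)
Lemma minimizers_converge (alpha delta : nat -> R) (yd : nat -> R -> R)
    (x : nat -> triple R) (C : R) :
  (forall j, 0 < alpha j) -> alpha j @[j --> \oo] --> 0 ->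
  (forall j, 0 <= delta j) -> delta j @[j --> \oo] --> 0 ->
  (forall j, delta j ^+ 2 <= C * alpha j) ->
  (forall j, sqint Omega (yd j)) -> (forall j, nrm Omega (y \- yd j) <= delta j) ->
  (forall j, argmin Omega n (Ftilde Omega n beta1 beta2 beta3 K0 (yd j) (alpha j)) (x j)) ->
  exists (s : nat -> nat) (l : triple R),
    [/\ {homo s : i j / (i < j)%N},
      forall p : R, 1 <= p -> X_cvg Omega p (fun j => x (s j)) l,
      Ad Omega n l & solves_system Omega n y l].
Proof.
move=> a0 acvg d0 dcvg dC syd yyd minx.
have [xr [fxr [c c0 Fxr]]] := reference_point iO bO n_gt0 beta1_gt0 beta2_gt0 beta3_gt0 K0_H1 y_L2 A3.
pose B j := delta j ^+ 2 + alpha j * c.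
have key j : exists K' K phi h v, [/\ x j = (K', K, phi),
    feasible Omega n (K', K, phi),
    [/\ H1norm Omega (K \- K0) = h%:E, BVseminorm Omega phi = v%:E, 0 <= h & 0 <= v] &
    objective n beta1 beta2 beta3 (alpha j)
      (nrm Omega (convolution Omega K phi \- yd j)) h (ip Omega phi phi) v <= B j].
  have [fx /(_ _ fxr)] := (argmin_Ftilde iO bO n_gt0 beta1_gt0 beta2_gt0 beta3_gt0 K0_H1
    y_L2 A3 (x j) (a0 j) (syd j)).1 (minx j).
  rewrite Fxr//; case: (x j) fx => [[K' K] phi] fx.
  have [->|[h [v [Kh phiv h0 v0]]]] := F_cases beta2 beta3 iO bO n_gt0 beta1_gt0 sK0 (a0 j) (syd j) fx.
    by rewrite leye_eq.
  rewrite (F_objective beta1 beta2 beta3 iO bO n_gt0 sK0 (alpha j) (syd j) fx Kh phiv) lee_fin => Fle.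
  exists K', K, phi, h, v; split => //; apply: le_trans Fle _.
  by rewrite /B lerD2r lerXn2r ?nnegrE ?nrm_ge0.
have /choice[K' /choice[K /choice[phi /choice[h /choice[v hv]]]]] := key.
have fx j : feasible Omega n (K' j, K j, phi j) by case: (hv j).
have fs j := feasibleP iO bO n_gt0 (fx j).
have sK' j : sqint Omega (K' j) by case: (fs j).
have sK j : sqint Omega (K j) by case: (fs j).
have sphi j : sqint Omega (phi j) by case: (fs j).
have bphi j : binary Omega (phi j) by case: (fs j).
have KK j : eq_on Omega (K' j) (K j) by case: (fs j).
have Kh j : H1norm Omega (K j \- K0) = (h j)%:E by case: (hv j) => _ _ [].
have phiv j : BVseminorm Omega (phi j) = (v j)%:E by case: (hv j) => _ _ [].
have hv0 j : 0 <= h j /\ 0 <= v j by case: (hv j) => _ _ [].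
have obj j : objective n beta1 beta2 beta3 (alpha j)
      (nrm Omega (convolution Omega (K j) (phi j) \- yd j)) (h j) (ip Omega (phi j) (phi j)) (v j) <= B j.
  by case: (hv j).
pose bounds j := objective_ge0 n beta1_gt0 beta2_gt0 beta3_gt0
  (nrm Omega (convolution Omega (K j) (phi j) \- yd j)) (ip Omega (phi j) (phi j))
  (a0 j) (hv0 j).1 (hv0 j).2.
have BC j : B j <= alpha j * (C + c).
  by rewrite /B mulrDr lerD2r mulrC dC.
have C0 : 0 <= C + c.
  by have := le_trans (addr_ge0 (sqr_ge0 _) (mulr_ge0 (ltW (a0 0%N)) c0)) (BC 0%N); rewrite pmulr_rge0.
pose D := (C + c) / beta1 + (C + c) / beta3.
have hD j : h j <= D.
  have [_ b1 _] := bounds j; have := le_trans b1 (le_trans (obj j) (BC j)).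
  rewrite ler_pM2l// mulrC -ler_pdivlMr// => /le_trans; apply.
  by rewrite lerDl divr_ge0// ltW.
have vD j : v j <= D.
  have [_ _ b1] := bounds j; have := le_trans b1 (le_trans (obj j) (BC j)).
  rewrite ler_pM2l// mulrC -ler_pdivlMr// => /le_trans; apply.
  by rewrite lerDr divr_ge0// ltW.
have su j : sqint Omega (K j \- K0) by exact: sqintB.
have [s [u' [phi' [h' [v' [homos [su' sphi' bphi'] [cu cphi] _ [_ BVp _ _]]]]]]] :=
  feasible_compactness iO bO su sphi bphi Kh hD phiv vD.
pose Kl := u' \+ K0.
have sKl : sqint Omega Kl by exact: sqintD.
have cK j : nrm Omega (K (s j) \- Kl) <= 2 * 2^-1 ^+ j.
  by apply: le_trans (cu j); rewrite (@eq_nrm _ _ _ ((K (s j) \- K0) \- u'))// => z; rewrite /Kl /=; ring.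
have cK' j : nrm Omega (K' (s j) \- Kl) <= 2 * 2^-1 ^+ j.
  apply: le_trans (cK j); rewrite (@eq_on_nrm _ _ mO _ (K (s j) \- Kl))//; [exact: sqintB|exact: sqintB|].
  by move: (KK (s j)); apply: aeS => z hz Oz /=; rewrite hz.
have [Cc hCc] := convolution_fast iO bO sKl sphi' (fun j => sK (s j)) (fun j => sphi (s j)) cK cphi.
have fxl : feasible Omega n (Kl, Kl, phi').
  by apply: (feasibleI iO bO) => //; apply: le_lt_trans BVp _; exact: ltry.
have xE j : x j = (K' j, K j, phi j) by case: (hv j).
have sconv (k f : R -> R) : sqint Omega k -> sqint Omega f -> sqint Omega (convolution Omega k f).
  by move=> sk sf; exact: sqint_convolution.
have limy : nrm Omega (convolution Omega Kl phi' \- y) = 0.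
  apply/eqP; rewrite eq_le nrm_ge0 andbT.
  have B0 : B j @[j --> \oo] --> 0.
    rewrite -[X in _ --> X](addr0 0) /B; apply: cvgD.
      by rewrite -[X in _ --> X](mulr0 (0 : R)); under eq_fun do rewrite expr2; exact: cvgM.
    by rewrite -[X in _ --> X](mul0r c); apply: cvgMl.
  have sB0 : Num.sqrt (B j) @[j --> \oo] --> 0.
    rewrite -[X in _ --> X]sqrtr0.
    apply: (@cvg_comp _ _ _ B Num.sqrt \oo (nbhs 0)) => //; exact: sqrt_continuous.
  (* Three steps from the limiting convolution to [y]: to the convolutions of the subsequence, to
     the noisy data by minimality, to the exact data. *)
  have lim : Cc * 2^-1 ^+ j + Num.sqrt (B (s j)) + delta (s j) @[j --> \oo] --> 0.
    rewrite -[X in _ --> X](addr0 0); apply: cvgD; last exact: cvg_subseq dcvg.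
    rewrite -[X in _ --> X](addr0 0); apply: cvgD; last exact: (cvg_subseq homos sB0).
    rewrite -[X in _ --> X](mulr0 Cc); apply: cvgMr; apply: cvg_expr.
    by rewrite ger0_norm ?invr_ge0// invf_lt1// ltr1n.
  apply: (ler_cvg_to (cvg_cst _) lim); apply: nearW => j.
  have s1 := sconv _ _ sKl sphi'; have s2 := sconv _ _ (sK (s j)) (sphi (s j)).
  apply: le_trans (nrm_distD mO s1 s2 sy) _; rewrite -addrA; apply: lerD.
    by rewrite nrmB_sym.
  apply: le_trans (nrm_distD mO s2 (syd (s j)) sy) _; apply: lerD; last first.
    by rewrite nrmB_sym.
  have [b1 _ _] := bounds (s j); have b2 := le_trans b1 (obj (s j)).
  by rewrite -(ger0_norm (nrm_ge0 _ _)) -sqrtr_sqr ler_sqrt// (le_trans (sqr_ge0 _) b2).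
have convy : eq_on Omega (convolution Omega Kl phi') y.
  have s1 := sqintB mO (sconv _ _ sKl sphi') sy.
  move: ((nrm_eq0 mO Ofin s1).1 limy); apply: aeS => z hz Oz.
  by apply/eqP; rewrite -subr_eq0; apply/eqP; exact: hz.
exists s, (Kl, Kl, phi'); split => //.
- move=> p p1; rewrite /X_cvg; under eq_fun do rewrite xE; split => /=.
  + exact: Lp2_cvg cK'.
  + by under eq_fun do rewrite xE; exact: Lp2_cvg cK.
  + by under eq_fun do rewrite xE; exact: binary_Lp_cvg cphi.
- exact: (feasible_Ad iO bO n_gt0 fxl).
- by have [Xl Wl _] := fxl.
Qed.

End Convergence.

Theorem theorem5 (R : realType) (Omega : set R) (n : nat)
    (beta1 beta2 beta3 gamma : R) (K0 y : R -> R)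
    (Omega_itv : is_interval Omega) (Omega_bnd : bounded_set Omega)
    (n_gt0 : (0 < n)%N)
    (beta1_gt0 : 0 < beta1) (beta2_gt0 : 0 < beta2) (beta3_gt0 : 0 < beta3)
    (gamma_gt0 : 0 < gamma)
    (K0_H1 : H1space Omega K0) (y_L2 : Lp Omega 2%:E y)
    (A3 : attainable Omega n gamma y) :
  let Ftilde := Ftilde Omega n beta1 beta2 beta3 K0 in
  let solves_P := solves_P Omega n beta1 beta2 beta3 K0 in
  let Lagr := Lagr Omega n beta1 beta2 beta3 K0 in
  let threshold := exact_penalty_threshold Omega n beta1 beta2 beta3 K0 in
  let argmin := argmin Omega n in
  let Ad := Ad Omega n in
  [/\
    (* i)-iv), for arbitrary noisy data and regularization parameter *)
    forall (alpha delta : R) (yd : R -> R),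
      0 < alpha -> Lp Omega 2%:E yd ->
      (Lpnorm Omega 2%:E (y \- yd)%R <= delta%:E)%E ->
      [/\ exists2 x, Ad x & argmin (Ftilde yd alpha) x,
          exists2 x, Ad x & solves_P yd alpha x &
          forall (lambda : pair2 R) (mbar m : R),
            threshold yd alpha lambda mbar -> mbar < m ->
            (exists2 x, Ad x & argmin (Lagr yd alpha lambda m) x) /\
            (argmin (Lagr yd alpha lambda m) !=set0 /\
             forall x, argmin (Lagr yd alpha lambda m) x ->
                       solves_P yd alpha x)],
    (* v) *)
    forall (lambda : R -> pair2 R) (mbar m : R -> R)
           (x : R -> triple R),
      (forall alpha : R, 0 < alpha ->
        [/\ threshold y alpha (lambda alpha) (mbar alpha),
            mbar alpha < m alpha,
            Ad (x alpha) &
            argmin (Lagr y alpha (lambda alpha) (m alpha)) (x alpha)]) ->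
      forall a : nat -> R, (forall j, 0 < a j) -> a j @[j --> \oo] --> 0 ->
      exists (s : nat -> nat) (l : triple R),
        [/\ {homo s : i j / (i < j)%N},
            forall p : R, 1 <= p -> X_cvg Omega p (fun j => x (a (s j))) l,
            Ad l & solves_system Omega n y l] &
    (* vi) *)
    forall (alpha : R -> R),
      (forall d : R, 0 < d -> 0 < alpha d) ->
      alpha d @[d --> 0^'+] --> 0 ->
      d ^+ 2 / alpha d @[d --> 0^'+] --> 0 ->
      forall (delta : nat -> R) (yd : nat -> R -> R)
             (lambda : nat -> pair2 R) (mbar m : nat -> R)
             (x : nat -> triple R),
      (forall j, 0 < delta j) -> delta j @[j --> \oo] --> 0 ->
      (forall j, Lp Omega 2%:E (yd j)) ->
      (forall j, (Lpnorm Omega 2%:E (y \- yd j)%R <= (delta j)%:E)%E) ->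
      (forall j,
        [/\ threshold (yd j) (alpha (delta j)) (lambda j) (mbar j),
            mbar j < m j &
            argmin (Lagr (yd j) (alpha (delta j)) (lambda j) (m j)) (x j)]) ->
      exists (s : nat -> nat) (l : triple R),
        [/\ {homo s : i j / (i < j)%N},
            forall p : R, 1 <= p -> X_cvg Omega p (fun j => x (s j)) l &
            solves_system Omega n y l]].
Proof.
move=> Ft sP Lg thr am ad.
have [mO Ofin _] := bounded_interval_cases Omega_itv Omega_bnd.
have sy : sqint Omega y by exact/(Lp2P mO).
have thr_argmin yd alpha lambda mbar m x : thr yd alpha lambda mbar -> mbar < m ->
    am (Lg yd alpha lambda m) x <-> am (Ft yd alpha) x.
  by move=> [_ _ h] mm; have [_ E] := h m mm; rewrite /am /Lg /Ft E.
split.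
- move=> alpha delta yd a0 /(Lp2P mO) syd _.
  have [x fx minx] := minimizer_exists Omega_itv Omega_bnd n_gt0 beta1_gt0 beta2_gt0 beta3_gt0
    K0_H1 y_L2 A3 a0 syd.
  have argminP x' := argmin_Ftilde Omega_itv Omega_bnd n_gt0 beta1_gt0 beta2_gt0 beta3_gt0
    K0_H1 y_L2 A3 x' a0 syd.
  have Adx : ad x by move: x fx {minx} => [[K' K] phi]; exact: feasible_Ad.
  split; first by exists x => //; exact/argminP.
    by exists x.
  move=> lambda mbar m th mm; split.
    by exists x => //; apply/(thr_argmin _ _ _ _ _ _ th mm)/argminP.
  split; first by exists x; apply/(thr_argmin _ _ _ _ _ _ th mm)/argminP.
  by move=> x' /(thr_argmin _ _ _ _ _ _ th mm)/argminP.
- move=> lambda mbar m x hx a a0 acvg.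
  (* Exact data is the case of zero noise level, with [C = 0]. *)
  have d0 (j : nat) : (0 : R) ^+ 2 <= 0 * a j by rewrite expr0n mul0r.
  have yy (j : nat) : nrm Omega (y \- y) <= 0.
    rewrite (_ : y \- y = cst 0); last by apply/funext => z /=; rewrite subrr.
    by rewrite ((nrm_eq0 mO Ofin (sqint0 mO)).2 (ae_eq_refl _ _ _)).
  have minx j : am (Ft y (a j)) (x (a j)).
    by have [th mm _ minx] := hx _ (a0 j); exact: (thr_argmin _ _ _ _ _ _ th mm).1 minx.
  have [s [l [homos cvgl Adl soll]]] := minimizers_converge Omega_itv Omega_bnd n_gt0
    beta1_gt0 beta2_gt0 beta3_gt0 K0_H1 y_L2 A3 a0 acvg (fun=> lexx 0) (cvg_cst 0) d0
    (fun=> sy) yy minx.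
  by exists s, l.
- move=> alpha al0 alcvg dalcvg delta yd lambda mbar m x d0 dcvg ydL2 yyd hx.
  have syd j : sqint Omega (yd j) by exact/(Lp2P mO).
  have acvg : alpha (delta j) @[j --> \oo] --> 0.
    exact: (cvg_at_rightP _ _ _).1 alcvg delta (conj d0 dcvg).
  have dacvg : delta j ^+ 2 / alpha (delta j) @[j --> \oo] --> 0.
    exact: (cvg_at_rightP _ _ _).1 dalcvg delta (conj d0 dcvg).
  (* A convergent sequence is bounded, which turns the limit of $\delta^2/\alpha$ into a constant
     valid for all indices. *)
  have [C dC] : exists C, forall j, delta j ^+ 2 <= C * alpha (delta j).
    have /cvg_seq_bounded[M [_ hM]] : cvgn (fun j => delta j ^+ 2 / alpha (delta j)).
      by apply/cvg_ex; eexists; exact: dacvg.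
    exists (M + 1) => j; rewrite -ler_pdivrMr; last exact: al0.
    by apply: le_trans (ler_norm _) _; apply: hM => //; rewrite ltrDl.
  have ydy j : nrm Omega (y \- yd j) <= delta j.
    by rewrite -lee_fin -(Lpnorm2E mO) ?yyd//; exact: sqintB.
  have minx j : am (Ft (yd j) (alpha (delta j))) (x j).
    by have [th mm minx] := hx j; exact: (thr_argmin _ _ _ _ _ _ th mm).1 minx.
  have [s [l [homos cvgl Adl soll]]] := minimizers_converge Omega_itv Omega_bnd n_gt0
    beta1_gt0 beta2_gt0 beta3_gt0 K0_H1 y_L2 A3 (fun j => al0 _ (d0 j)) acvg
    (fun j => ltW (d0 j)) dcvg dC syd ydy minx.
  by exists s, l.
Qed.
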